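(* Let $K\ge 1$ be an integer, and let $\nu_h,\nu_J$ be probability laws of a random measurable node potential $h:\mathbb{R}\to\mathbb{R}_+$ and a random measurable edge potential $J:\mathbb{R}^K\to\mathbb{R}_+$. Suppose there exist values $\kappa>0$, $\rho_{\max}\ge\rho_{\min}>0$, $0<J_{\max}\le\rho_{\max}$ and a set $\Omega_h\subset\mathbb{R}$ such that: 1. $[0,\kappa]\subset\Omega_h$; $\nu_h$-almost surely $h(x)=0$ for all $x\notin\Omega_h$; and $\nu_h$-almost surely $\rho_{\min}\le\int_{[0,\kappa]}h(x)\,dx\le\int_{\mathbb{R}}h(x)\,dx\le\rho_{\max}$. 2. $\sup_{x\in\mathbb{R}^K}J(x)\le J_{\max}$, $\nu_J$-almost surely. 3. For every $i=1,\dots,K$, $\nu_J$-almost surely, $\{x\in\mathbb{R}^K:\ x_i\in[0,\kappa),\ x_k\in\Omega_h,\ 1\le k\le K\}\subset\{x\in\mathbb{R}^K:\ J(x)\ge\rho_{\min}\}$. Suppose further that there exists a constant $\alpha\ge J_{\max}$ such that for all integers $n,r\ge1$ and all $x^1,\dots,x^r\in\Omega_h^n$, the expected tensor product $$\mathbb{E}\bigotimes_{1\le l\le r}A_l,\qquad A_l=\bigl(\alpha-J(x^l_{i_1},\dots,x^l_{i_K}),\ 1\le i_1,\dots,i_K\le n\bigr),$$ is convex on the set $\mathbb{R}_+^{n^r}$, where the same random copy of $J\sim\nu_J$ is used in all the $A_l$, and the expectation is over $J$ and taken componentwise. Then for every $c>0$ the random graph sequence $\mathbb{G}(N,c)$,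 $N\ge1$, is right-converging with respect to $\nu_h,\nu_J$.
   Context: Graphs and random graphs. ''Graph'' means $K$-uniform directed hypergraph: each edge is an ordered $K$-tuple $e=(u^e_1,\dots,u^e_K)$ of nodes. For $c>0$, the sparse Erdős–Rényi graph $\mathbb{G}(N,c)$ has node set $\{1,\dots,N\}$ and $\lfloor cN\rfloor$ edges (multiple edges and repeated nodes within an edge are allowed), each chosen independently and uniformly at random from $\{1,\dots,N\}^K$. Partition function. Given a graph $\mathbb{G}$ on nodes $\{1,\dots,N\}$, the nodes $u$ carry i.i.d. random potentials $h_u\sim\nu_h$ and the edges $e$ carry i.i.d. random potentials $J_e\sim\nu_J$, all independent of each other and of the graph. Random potentials are assumed jointly measurable in the randomness and the argument. The partition function is $$Z(\mathbb{G})=\int_{\mathbb{R}^N}\prod_{1\le u\le N}h_u(x_u)\prod_{e\in E(\mathbb{G})}J_e(x_{u^e_1},\dots,x_{u^e_K})\,dx,$$ with $\log 0=-\infty$. Right-convergence. The sequence $\mathbb{G}(N,c)$ is right-converging with respect to $\nu_h,\nu_J$ if there is a deterministic real number $z$ such that for every $\epsilon>0$, $\lim_{N\to\infty}\mathbb{P}\bigl(|N^{-1}\log Z(\mathbb{G}(N,c))-z|>\epsilon\bigr)=0$, the probability being over both the graph and the potentials. Arrays. An $n$-dimensional array of order $K$ is a family of reals $A=(a_{i_1,\dots,i_K},\ 1\le i_1,\dots,i_K\le n)$. The tensor product of arrays of order $K$ multiplies entries: $\bigotimes_{1\le l\le r}A_l$ is the $n^r$-dimensional array of order $K$, with each of its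 $K$ indices being an $r$-tuple in $\{1,\dots,n\}^r$, whose entry at $\bigl((i^1_1,\dots,i^r_1),\dots,(i^1_K,\dots,i^r_K)\bigr)$ is $\prod_{l=1}^r (A_l)_{i^l_1,\dots,i^l_K}$. For a convex set $S\subset\mathbb{R}^m$, an $m$-dimensional array $A$ of order $K$ is convex over $S$ if the function $y\mapsto\sum_{1\le i_1,\dots,i_K\le m}y_{i_1}\cdots y_{i_K}a_{i_1,\dots,i_K}$ is convex on $S$. $\mathbb{R}_+$ denotes the non-negative reals. *)

(* Defs.v *)
From HB Require Import structures.
From mathcomp Require Import all_boot all_order all_algebra finmap.
From mathcomp Require Import all_classical all_reals all_analysis.

Set Implicit Arguments.
Unset Strict Implicit.
Unset Printing Implicit Defensive.

Import Order.TTheory GRing.Theory Num.Theory.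
Import numFieldNormedType.Exports.

Local Open Scope classical_set_scope.
Local Open Scope ring_scope.

Definition tuple_cons (T : Type) (n : nat) (p : T * n.-tuple T) :
  n.+1.-tuple T := [tuple of p.1 :: p.2].

Definition tuple_uncons (T : Type) (n : nat) (t : n.+1.-tuple T) :
  T * n.-tuple T := (thead t, [tuple of behead t]).

Lemma tuple_consK (T : Type) (n : nat) :
  cancel (@tuple_cons T n) (@tuple_uncons T n).
Proof. by move=> [x t]; congr pair; apply/val_inj. Qed.

Lemma tuple_unconsK (T : Type) (n : nat) :
  cancel (@tuple_uncons T n) (@tuple_cons T n).
Proof. by move=> t; rewrite [RHS]tuple_eta. Qed.

Lemma measurable_tuple_cons d (T : measurableType d) (n : nat) :
  measurable_fun [set: T * n.-tuple T] (@tuple_cons T n).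
Proof. exact: (measurable_cons measurable_fst measurable_snd). Qed.

Lemma measurable_tuple_uncons d (T : measurableType d) (n : nat) :
  measurable_fun [set: n.+1.-tuple T] (@tuple_uncons T n).
Proof.
by apply: measurable_fun_pair; [exact: measurable_tnth|exact: measurable_behead].
Qed.

Section cons_measure.
Local Open Scope ereal_scope.
Context d (T : measurableType d) (R : realType) (n : nat).
Variable mu : {sigma_finite_measure set T -> \bar R}.
Variable nu : {sigma_finite_measure set (n.-tuple T) -> \bar R}.

(* [mu \x nu] carried over to tuples along the bijection
   [T * n.-tuple T ~ n.+1.-tuple T]. *)
Definition cons_measure : set (n.+1.-tuple T) -> \bar R :=
  pushforward (mu \x nu) (@tuple_cons T n).

Let cm : {measure set (n.+1.-tuple T) -> \bar R} :=
  measure_function_pushforward__canonical__measure_function_Measure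
    (mu \x nu) (@measurable_tuple_cons d T n).

HB.instance Definition _ := isMeasure.Build _ _ _ cons_measure
  (measure0 cm) (measure_ge0 cm) (@measure_semi_sigma_additive _ _ _ cm).

Let cons_measure_sigma_finite : sigma_finite setT cons_measure.
Proof.
have /sigma_finiteP[F [TF ndF Foo]] := sigma_finiteT mu.
have /sigma_finiteP[G [TG ndG Goo]] := sigma_finiteT nu.
exists (fun k => @tuple_uncons T n @^-1` (F k `*` G k)).
  rewrite -preimage_bigcup (_ : \bigcup_k _ = setT) ?preimage_setT//.
  apply/seteqP; split=> // -[x t] _.
  have [i _ Fix] : (\bigcup_i F i) x by rewrite -TF.
  have [j _ Gjt] : (\bigcup_i G i) t by rewrite -TG.
  exists (maxn i j) => //; split => /=.
    by move: x Fix; exact/subsetPset/ndF/leq_maxl.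
  by move: t Gjt; exact/subsetPset/ndG/leq_maxr.
move=> k; have [mF Fk] := Foo k; have [mG Gk] := Goo k; split.
  rewrite -[X in measurable X]setTI; apply: measurable_tuple_uncons => //.
  exact: measurableX.
rewrite /cons_measure /pushforward -comp_preimage.
rewrite (_ : _ \o _ = id); last by apply/funext => p; exact: tuple_consK.
by rewrite preimage_id product_measure1E// lte_mul_pinfty// ge0_fin_numE.
Qed.

HB.instance Definition _ := Measure_isSigmaFinite.Build _ _ _ cons_measure
  cons_measure_sigma_finite.

End cons_measure.

Section product_power.
Local Open Scope ereal_scope.
Context d (T : measurableType d) (R : realType).

Fixpoint product_power (mu : {sigma_finite_measure set T -> \bar R}) (n : nat) :
    {sigma_finite_measure set (n.-tuple T) -> \bar R} :=
  match n with
  | 0 => \d_([tuple] : 0.-tuple T)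
  | m.+1 => cons_measure mu (product_power mu m)
  end.

(* Rectangles determine the measure, so this lemma pins [product_power mu n]
   down as the n-fold product of [mu]. *)
Lemma product_powerE (mu : {sigma_finite_measure set T -> \bar R}) (n : nat)
    (A : 'I_n -> set T) : (forall i, measurable (A i)) ->
  product_power mu n [set t | forall i, A i (tnth t i)] =
  \prod_(i < n) mu (A i).
Proof.
elim: n A => [|n IHn] A mA.
  rewrite big_ord0 /= diracE mem_set//=.
  by case.
rewrite big_ord_recl -IHn; last by move=> i; exact: mA.
rewrite -product_measure1E; last first.
- rewrite (_ : [set _ | _] = \bigcap_(i in [set: 'I_n])
      ((fun t : n.-tuple T => tnth t i) @^-1` A (lift ord0 i))); last first.
    by apply/seteqP; split=> [t At i _|t At i]; [exact: At|exact: (At i)].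
  apply: fin_bigcap_measurable => // i _.
  by rewrite -[X in measurable X]setTI; exact: measurable_tnth.
- exact: mA.
rewrite /= /cons_measure /pushforward; congr (_ _).
apply/seteqP; split=> [[x t] /= At|[x t] /= [Ax At] i].
  split; first exact: (At ord0).
  by move=> i; have := At (lift ord0 i); rewrite tnthS.
by have [j ->|->//] := unliftP ord0 i; rewrite tnthS.
Qed.

Variable P : probability T R.
Variable n : nat.

(* The joint law of n independent random elements of law [P]. *)
Definition iid_law : set (n.-tuple T) -> \bar R := product_power P n.

HB.instance Definition _ := SigmaFiniteMeasure.on iid_law.

Let iid_law_setT : iid_law setT = 1.
Proof.
have := @product_powerE P n (fun=> setT) (fun=> measurableT).
rewrite big1 => [<-|i _]; last exact: probability_setT.
by congr (_ _); apply/seteqP; split.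
Qed.

HB.instance Definition _ := Measure_isProbability.Build _ _ _ iid_law
  iid_law_setT.

End product_power.
Arguments product_power {d T R} mu n.
Arguments iid_law {d T R} P n.

Definition lebesgue_measure_tuple (R : realType) (n : nat) :
    {sigma_finite_measure set (n.-tuple (measurableTypeR R)) -> \bar R} :=
  product_power (@lebesgue_measure R) n.

HB.instance Definition _ (n : nat) := isPointed.Build 'I_n.+1 ord0.

HB.instance Definition _ (n : nat) := @isMeasurable.Build
  default_measure_display 'I_n.+1 discrete_measurable discrete_measurable0
  discrete_measurableC discrete_measurableU.

Section graph_law.
Variables (R : realType) (n K : nat).

(* Nodes are numbered from 0 and there are N = n.+1 of them; an edge is an
   ordered K-tuple of nodes, uniform over all N ^ K of them. *)
Definition edge_law : set (K.-tuple 'I_n.+1) -> \bar R :=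
  mscale (#|{: K.-tuple 'I_n.+1}|%:R^-1)%:nng counting.

HB.instance Definition _ := Measure.on edge_law.

Let edge_law_setT : edge_law setT = 1%E.
Proof.
have fT : finite_set [set: K.-tuple 'I_n.+1] by exact: finite_finset.
rewrite /edge_law /mscale/= /counting asboolT//.
rewrite (_ : fset_set _ =
    [fset x in (predT : pred (K.-tuple 'I_n.+1))]%fset); last first.
  apply/fsetP => x; rewrite in_fset_set//.
  by apply/idP/idP => _; [rewrite in_fset|exact: mem_set].
rewrite card_finset -EFinM mulVf// pnatr_eq0 -lt0n.
by apply/card_gt0P; exists [tuple of nseq K ord0].
Qed.

HB.instance Definition _ := Measure_isProbability.Build _ _ _ edge_law
  edge_law_setT.

End graph_law.
Arguments edge_law : clear implicits.

(* [tuple of map (tnth x) e] is (x_{u_1}, ..., x_{u_K}) for e = (u_1, ..., u_K). *)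
Definition partition_function (R : realType) (N M K : nat)
    (g : M.-tuple (K.-tuple 'I_N))
    (h : 'I_N -> R -> R) (J : 'I_M -> K.-tuple R -> R) : \bar R :=
  (\int[lebesgue_measure_tuple R N]_x
     (\prod_(u < N) h u (tnth x u) *
      \prod_(e < M) J e [tuple of map (tnth x) (tnth g e)])%:E)%E.

Section random_instance.
Context (R : realType) (K : nat) (dh dJ : measure_display).
Context (Th : measurableType dh) (TJ : measurableType dJ).
Variables (Ph : probability Th R) (PJ : probability TJ R).

Definition nb_edges (c : R) (N : nat) : nat := Num.truncn (c * N%:R).

(* A sample consists of the edges of the graph, the randomness of the node
   potentials and the randomness of the edge potentials; [instance_law] makes
   all of these independent. *)
Definition instance_space (n M : nat) : Type :=
  M.-tuple (K.-tuple 'I_n.+1) * (n.+1.-tuple Th * M.-tuple TJ).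

Definition instance_law (n M : nat) : set (instance_space n M) -> \bar R :=
  (iid_law (edge_law R n K) M \x (iid_law Ph n.+1 \x iid_law PJ M))%E.

Variables (h : Th -> R -> R) (J : TJ -> K.-tuple R -> R).

Definition instance_partition_function (n M : nat) (w : instance_space n M) :
    \bar R :=
  partition_function w.1 (fun u => h (tnth w.2.1 u))
    (fun e => J (tnth w.2.2 e)).

(* [lne] sends 0 to -oo, for which the deviation below is +oo. The index n
   stands for the number of nodes N = n.+1. *)
Definition right_converging (c : R) : Prop :=
  exists z : R, forall eps : R, 0 < eps ->
    (fun n => instance_law [set w : instance_space n (nb_edges c n.+1) |
       (eps%:E < `| (n.+1%:R^-1)%:E * lne (instance_partition_function w)
                    - z%:E |)%E]) @ \oo --> 0%E.

End random_instance.

(* The law of a random function is given by a probability space [T] together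
   with a function jointly measurable in the randomness and the argument;
   [measurableTypeR R] is R with its Borel sigma-algebra, and tuples over it
   carry the product sigma-algebra. *)
Definition random_node_potential (R : realType) d (T : measurableType d)
    (h : T -> R -> R) : Prop :=
  (forall w x, 0 <= h w x) /\
  measurable_fun [set: T * measurableTypeR R] (fun p => h p.1 p.2).

Definition random_edge_potential (R : realType) (K : nat) d
    (T : measurableType d) (J : T -> K.-tuple R -> R) : Prop :=
  (forall w x, 0 <= J w x) /\
  measurable_fun [set: T * K.-tuple (measurableTypeR R)]
    (fun p => J p.1 p.2).

(* An array of order K whose K indices range over [I]; its dimension is #|I|. *)
Definition array (R : realType) (K : nat) (I : finType) : Type :=
  K.-tuple I -> R.

(* The indices of the product are r-tuples of indices, so [i] is a K-tuple of
   r-tuples, and the l-th factor is read at the l-th components of these. *)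
Definition tensor_product (R : realType) (K n r : nat)
    (A : 'I_r -> array R K 'I_n) : array R K (r.-tuple 'I_n) :=
  fun i => \prod_(l < r) A l [tuple of map (fun j => tnth j l) i].

Definition convex_over (R : realType) (K : nat) (I : finType)
    (S : set {ffun I -> R^o}) (a : array R K I) : Prop :=
  @convex_function R {ffun I -> R^o} S
    (fun y => \sum_(i : K.-tuple I) (\prod_(k < K) y (tnth i k)) * a i).

Definition nonneg_orthant (R : realType) (I : finType) : set {ffun I -> R^o} :=
  [set y | forall i, 0 <= (y i : R)].

Arguments nonneg_orthant : clear implicits.

Definition expected_array (R : realType) (K : nat) (I : finType) d
    (T : measurableType d) (P : probability T R) (A : T -> array R K I) :
    array R K I :=
  fun i => fine 'E_P[fun w => A w i].

(* Main.v *)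
(* Let a_N be the expectation of log Z(G(N,c)). Split the nodes into blocks of m
   and n = N - m nodes, and replace the edges, one at a time, by edges that fall
   inside the first block with probability m/N and inside the second one with
   probability n/N. Adding an edge e to a graph adds
   log alpha + log (1 - <alpha - J(x_e)> / alpha) to log Z, where <.> is the Gibbs
   average. Expand the logarithm and write the r-th power of the Gibbs average as
   an average over r independent replicas x^1, ..., x^r: the expectation of each
   term, over e and J, becomes a value of the polynomial of the expected tensor
   product at the vector putting uniform mass on the constant r-tuples of nodes.
   That vector is the combination, with weights m/N and n/N, of the corresponding
   vectors of the two blocks, so by convexity the replacement can only decrease
   the expectation of log Z. At the end of the replacement Z factors over the two
   blocks, whose numbers of edges are binomial. As one edge or one node potential
   changes log Z by at most a multiple of one plus a degree, this gives
   a_m + a_n - C sqrt m <= a_(m+n) for m <= n, hence a_N / N converges, while the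
   Efron-Stein inequality gives Var (log Z) = O(N). *)

Require Import Defs.
From HB Require Import structures.
From mathcomp Require Import all_boot all_order all_algebra.
From mathcomp Require Import ring lra zify measurable_realfun.
From mathcomp Require Import all_classical all_reals all_analysis.

Set Implicit Arguments.
Unset Strict Implicit.
Unset Printing Implicit Defensive.

Import Order.TTheory GRing.Theory Num.Theory.
Import numFieldNormedType.Exports.

Local Open Scope classical_set_scope.
Local Open Scope ring_scope.

(** * Means and variances of bounded random variables *)

(** What shapes the estimates is that [J] may vanish, so [log Z] has no uniformly bounded
    differences. Condition 3 is the only protection: an edge has [J >= rho_min] as soon as one of
    its coordinates lies in [0, kappa[ and the others in the support. Confining the coordinate of a
    node of degree [d] to [0, kappa[ costs a factor [(rho_max / rho_min) ^+ d.+1], and degrees are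
    unbounded. Hence the changes are controlled in mean and in mean square: an endpoint of a random
    edge is a uniform node, and the squared degrees have a mean sum of order N. In the
    interpolation, convexity for every [r] helps because all coefficients of [- log (1 - t)] have
    the same sign, so that each power of the Gibbs average pushes the same way. Node potentials and
    all other edges stay frozen meanwhile, which keeps the ratio of partition functions away from 0
    and lets the series converge uniformly. The error is [sqrt m], for the smaller block, since the
    edge counts of both blocks deviate like the binomial count of the smaller one. Splitting blocks
    of fixed size [m] off a large graph thus costs [C / sqrt m] per node, which vanishes as [m]
    grows. *)

Section expectation.
Context d (T : measurableType d) (R : realType).
Implicit Types (P : probability T R) (f g : T -> R).

(** A class closed under the ring operations and partial means, whose members are integrable under
    every probability law: means are plain reals and Fubini has no side condition. *)
Definition bounded_measurable f :=
  measurable_fun [set: T] f /\ exists B : R, forall x, `|f x| <= B.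

Definition mean P f : R := fine (\int[P]_x (f x)%:E)%E.

Lemma bmeasD f g : bounded_measurable f -> bounded_measurable g ->
  bounded_measurable (fun x => f x + g x).
Proof.
move=> [mf [B fB]] [mg [C gC]]; split; first exact: measurable_funD.
by exists (B + C) => x; rewrite (le_trans (ler_normD _ _)) ?lerD.
Qed.

Lemma bmeasM f g : bounded_measurable f -> bounded_measurable g ->
  bounded_measurable (fun x => f x * g x).
Proof.
move=> [mf [B fB]] [mg [C gC]]; split; first exact: measurable_funM.
by exists (B * C) => x; rewrite normrM ler_pM.
Qed.

Lemma bmeas_cst c : bounded_measurable (fun=> c).
Proof. by split; [exact: measurable_cst|exists `|c|]. Qed.

Lemma bmeasN f : bounded_measurable f -> bounded_measurable (fun x => - f x).
Proof.
by move=> /(bmeasM (bmeas_cst (-1))); under eq_fun do rewrite mulN1r.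
Qed.

Lemma bmeasB f g : bounded_measurable f -> bounded_measurable g ->
  bounded_measurable (fun x => f x - g x).
Proof. by move=> bf bg; apply: bmeasD => //; exact: bmeasN. Qed.

Lemma bmeasX f n : bounded_measurable f ->
  bounded_measurable (fun x => f x ^+ n).
Proof.
move=> bf; elim: n => [|n IHn]; first exact: bmeas_cst.
by under eq_fun do rewrite exprS; exact: bmeasM.
Qed.

Lemma bmeas_sum (I : Type) (s : seq I) (F : I -> T -> R) :
  (forall i, bounded_measurable (F i)) ->
  bounded_measurable (fun x => \sum_(i <- s) F i x).
Proof.
move=> bF; elim: s => [|i s IHs].
  by under eq_fun do rewrite big_nil; exact: bmeas_cst.
by under eq_fun do rewrite big_cons; exact: bmeasD.
Qed.

Lemma bmeas_prod (I : Type) (s : seq I) (F : I -> T -> R) :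
  (forall i, bounded_measurable (F i)) ->
  bounded_measurable (fun x => \prod_(i <- s) F i x).
Proof.
move=> bF; elim: s => [|i s IHs].
  by under eq_fun do rewrite big_nil; exact: bmeas_cst.
by under eq_fun do rewrite big_cons; exact: bmeasM.
Qed.

Lemma bmeas_integrable P f : bounded_measurable f ->
  P.-integrable [set: T] (EFin \o f).
Proof.
move=> [mf [B fB]]; apply: measurable_bounded_integrable => //.
  by rewrite -ge0_fin_numE // fin_num_measure.
exists B; split; first exact: num_real.
by move=> x Bx y _ /=; rewrite (le_trans (fB y))// ltW.
Qed.

Lemma mean_EFin P f : bounded_measurable f ->
  (\int[P]_x (f x)%:E)%E = (mean P f)%:E.
Proof. by move=> /(bmeas_integrable P) fi; rewrite fineK// integrable_fin_num. Qed.

Lemma mean_cst P c : mean P (fun=> c) = c.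
Proof.
rewrite /mean integral_cst//.
by have /= -> := probability_setT P; rewrite mule1.
Qed.

Lemma meanD P f g : bounded_measurable f -> bounded_measurable g ->
  mean P (fun x => f x + g x) = mean P f + mean P g.
Proof.
move=> bf bg; apply: EFin_inj; rewrite EFinD -!mean_EFin//; last exact: bmeasD.
by rewrite -integralD//; [exact: bmeas_integrable|exact: bmeas_integrable].
Qed.

Lemma meanZ P c f : bounded_measurable f ->
  mean P (fun x => c * f x) = c * mean P f.
Proof.
move=> bf; apply: EFin_inj; rewrite EFinM -!mean_EFin//.
  by rewrite -integralZl//; exact: bmeas_integrable.
exact/bmeasM/bf/bmeas_cst.
Qed.

Lemma meanN P f : bounded_measurable f -> mean P (fun x => - f x) = - mean P f.
Proof.
by move=> /(meanZ P (-1)); rewrite mulN1r; under eq_fun do rewrite mulN1r.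
Qed.

Lemma meanB P f g : bounded_measurable f -> bounded_measurable g ->
  mean P (fun x => f x - g x) = mean P f - mean P g.
Proof. by move=> bf bg; rewrite meanD ?meanN//; exact: bmeasN. Qed.

Lemma mean_sum P (I : Type) (s : seq I) (F : I -> T -> R) :
  (forall i, bounded_measurable (F i)) ->
  mean P (fun x => \sum_(i <- s) F i x) = \sum_(i <- s) mean P (F i).
Proof.
move=> bF; elim: s => [|i s IHs].
  by under eq_fun do rewrite big_nil; rewrite big_nil mean_cst.
under eq_fun do rewrite big_cons.
by rewrite big_cons meanD ?IHs//; exact: bmeas_sum.
Qed.

Lemma le_mean P f g : bounded_measurable f -> bounded_measurable g ->
  (forall x, f x <= g x) -> mean P f <= mean P g.
Proof.
move=> bf bg fg; rewrite -lee_fin -!mean_EFin//.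
by apply: le_integral => //; first exact: bmeas_integrable;
  [exact: bmeas_integrable|move=> x _; rewrite lee_fin].
Qed.

Lemma sqr_mean_le P f : bounded_measurable f ->
  mean P f ^+ 2 <= mean P (fun x => f x ^+ 2).
Proof.
move=> bf; rewrite -subr_ge0.
have -> : mean P (fun x => f x ^+ 2) - mean P f ^+ 2 =
    mean P (fun x => (f x - mean P f) ^+ 2).
  transitivity (mean P (fun x => f x ^+ 2 - ((2 * mean P f) * f x - mean P f ^+ 2))).
    rewrite meanB ?meanB ?mean_cst ?meanZ//; first ring.
    - exact/bmeasM/bf/bmeas_cst.
    - exact: bmeas_cst.
    - exact: bmeasX.
    - exact/bmeasB/bmeas_cst/bmeasM/bf/bmeas_cst.
  by congr mean; apply/funext => x; ring.
rewrite -{1}(mean_cst P 0); apply: le_mean.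
- exact: bmeas_cst.
- exact/bmeasX/bmeasB/bmeas_cst.
- by move=> x; exact: sqr_ge0.
Qed.

End expectation.
Arguments bmeas_cst {d T R} c.

Section pairs.
Context d1 d2 (X : measurableType d1) (Y : measurableType d2) (R : realType).
Implicit Types (F : X * Y -> R).

Lemma bmeas_comp (g : X -> Y) (f : Y -> R) : measurable_fun [set: X] g ->
  bounded_measurable f -> bounded_measurable (fun x => f (g x)).
Proof.
move=> mg [mf [B fB]]; split; last by exists B => x.
exact: (measurableT_comp mf mg).
Qed.

Lemma bmeas_pair1 F x : bounded_measurable F ->
  bounded_measurable (fun y => F (x, y)).
Proof. by move=> [mF [B FB]]; split; [exact: measurable_fun_pair2|exists B]. Qed.

Lemma bmeas_pair2 F y : bounded_measurable F ->
  bounded_measurable (fun x => F (x, y)).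
Proof. by move=> [mF [B FB]]; split; [exact: measurable_fun_pair1|exists B]. Qed.

Lemma bmeas_swap F : bounded_measurable F ->
  bounded_measurable (fun p : Y * X => F (p.2, p.1)).
Proof.
move=> [mF [B FB]]; split; last by exists B.
apply: (measurableT_comp mF (g := fun p : Y * X => (p.2, p.1))).
by apply: measurable_fun_pair; [exact: measurable_snd|exact: measurable_fst].
Qed.

Variables (P : probability X R) (Q : probability Y R).

Lemma bmeas_mean2 (f : X -> Y -> R) :
  bounded_measurable (fun p : X * Y => f p.1 p.2) ->
  bounded_measurable (fun x => mean Q (f x)).
Proof.
move=> bF; split; last first.
  have [_ [B FB]] := bF; exists B => x; rewrite ler_norml.
  rewrite -(mean_cst Q (- B)) -{2}(mean_cst Q B).
  have bFx : bounded_measurable (f x) := bmeas_pair1 x bF.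
  by apply/andP; split; apply: le_mean => //; try exact: bmeas_cst;
    move=> y; have := FB (x, y); rewrite ler_norml => /andP[].
have [mF [B FB]] := bF.
(* Adding the bound [B] makes the integrand non-negative, so that Tonelli applies; the same shift is
   used for the other integration formulas below. *)
rewrite (_ : (fun x => _) =
    (fun x => fine (\int[Q]_y (f x y + B)%:E)%E - B)); last first.
  apply/funext => x; rewrite -[fine _]/(mean Q (fun y => f x y + B)).
  rewrite meanD ?mean_cst ?addrK//; last exact: bmeas_cst.
  exact: (bmeas_pair1 x bF).
apply: measurable_funB; last exact: measurable_cst.
apply: (@measurableT_comp _ _ _ _ _ _ fine); first exact: fine_measurable.
apply: (@measurable_fun_fubini_tonelli_F _ _ _ _ _ Q
  (fun p => (f p.1 p.2 + B)%:E)).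
  by apply/measurable_EFinP; apply: measurable_funD => //; exact: measurable_cst.
move=> p; rewrite lee_fin -lerBlDr sub0r lerNl (le_trans (ler_norm _))// normrN.
exact: FB.
Qed.

Lemma mean_prod F : bounded_measurable F ->
  mean (P \x Q)%E F = mean P (fun x => mean Q (fun y => F (x, y))).
Proof.
move=> bF; rewrite {1}/mean.
have Fi : (P \x Q)%E.-integrable setT (EFin \o F) by exact: bmeas_integrable.
rewrite -(integral12_prod_meas1 Fi) {1}/mean; congr fine.
by apply: eq_integral => x _; rewrite /fubini_F mean_EFin//; exact: bmeas_pair1.
Qed.

Lemma exchange_mean (f : X -> Y -> R) :
  bounded_measurable (fun p : X * Y => f p.1 p.2) ->
  mean P (fun x => mean Q (f x)) = mean Q (fun y => mean P (f^~ y)).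
Proof.
move=> bf; have fi := bmeas_integrable (P \x Q)%E bf.
rewrite /mean; congr fine.
transitivity (\int[P]_x \int[Q]_y (f x y)%:E)%E.
  apply: eq_integral => x _; rewrite -mean_EFin//; exact: (bmeas_pair1 x bf).
rewrite (Fubini fi); apply: eq_integral => y _.
by rewrite /= -mean_EFin//; exact: (bmeas_pair2 y bf).
Qed.

End pairs.

Section fubini_mean.
Context d1 d2 (X : measurableType d1) (Y : measurableType d2) (R : realType).
Variables (P : probability X R) (Q : probability Y R) (F : X -> Y -> R).
Hypothesis bF : bounded_measurable (fun p : X * Y => F p.1 p.2).

(* Tensorization of the variance; the mixed term is controlled by Jensen's
   inequality for [fun x => F x y - mean Q (fun y => F x y)]. *)
Lemma variance_prod :
  mean P (fun x => mean Q (fun y => F x y ^+ 2)) -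
  mean P (fun x => mean Q (fun y => F x y)) ^+ 2 <=
  mean Q (fun y => mean P (fun x => F x y ^+ 2) -
                   mean P (fun x => F x y) ^+ 2) +
  mean P (fun x => mean Q (fun y => F x y ^+ 2) -
                   mean Q (fun y => F x y) ^+ 2).
Proof.
pose H x := mean Q (fun y => F x y).
pose G y := mean P (fun x => F x y).
pose c := mean P H.
have bH : bounded_measurable H by exact: bmeas_mean2.
have bG : bounded_measurable G by exact: (@bmeas_mean2 _ _ _ _ _ P _ (bmeas_swap bF)).
have bF2 : bounded_measurable (fun p : X * Y => F p.1 p.2 ^+ 2) by exact: bmeasX.
have bHF : bounded_measurable (fun p : X * Y => H p.1).
  exact: bmeas_comp measurable_fst bH.
have bD : bounded_measurable (fun p : X * Y => (F p.1 p.2 - H p.1) ^+ 2).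
  exact: (bmeasX 2 (bmeasB bF bHF)).
have jensen : mean Q (fun y => (G y - c) ^+ 2) <=
              mean Q (fun y => mean P (fun x => (F x y - H x) ^+ 2)).
  apply: le_mean; first exact/bmeasX/bmeasB/bmeas_cst.
    exact: (@bmeas_mean2 _ _ _ _ _ P _ (bmeas_swap bD)).
  move=> y; have -> : G y - c = mean P (fun x => F x y - H x).
    by rewrite meanB//; exact: (bmeas_pair2 y bF).
  by apply: sqr_mean_le; apply: bmeasB => //; exact: (bmeas_pair2 y bF).
have L : mean Q (fun y => (G y - c) ^+ 2) = mean Q (fun y => G y ^+ 2) - c ^+ 2.
  have cE : c = mean Q G by exact: exchange_mean.
  transitivity (mean Q (fun y => G y ^+ 2 - ((2 * c) * G y - c ^+ 2))).
    by congr mean; apply/funext => y; ring.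
  have b2 : bounded_measurable (fun y => 2 * c * G y).
    exact/bmeasM/bG/bmeas_cst.
  rewrite meanB ?meanB ?mean_cst ?meanZ -?cE//; first ring.
  - exact: bmeas_cst.
  - exact: bmeasX.
  - exact/bmeasB/bmeas_cst.
have M : mean Q (fun y => mean P (fun x => (F x y - H x) ^+ 2)) =
    mean P (fun x => mean Q (fun y => F x y ^+ 2)) -
    mean P (fun x => H x ^+ 2).
  transitivity (mean P (fun x => mean Q (fun y => (F x y - H x) ^+ 2))).
    by rewrite -(exchange_mean P Q bD).
  rewrite -meanB//; last 2 first.
  - exact: (@bmeas_mean2 _ _ _ _ _ Q _ bF2).
  - exact: bmeasX.
  congr mean; apply/funext => x.
  have bFx : bounded_measurable (F x) := bmeas_pair1 x bF.
  transitivity (mean Q (fun y => F x y ^+ 2 -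
      ((2 * H x) * F x y - H x ^+ 2))).
    by congr mean; apply/funext => y; ring.
  have b2 : bounded_measurable (fun y => 2 * H x * F x y).
    exact/bmeasM/bFx/bmeas_cst.
  rewrite meanB ?meanB ?mean_cst ?meanZ//; first by rewrite -/(H x); ring.
  - exact: bmeas_cst.
  - exact: bmeasX.
  - exact/bmeasB/bmeas_cst.
have -> : mean Q (fun y => mean P (fun x => F x y ^+ 2) - G y ^+ 2) =
    mean P (fun x => mean Q (fun y => F x y ^+ 2)) -
    mean Q (fun y => G y ^+ 2).
  rewrite meanB//; last 2 first.
  - exact: (@bmeas_mean2 _ _ _ _ _ P _ (bmeas_swap bF2)).
  - exact: bmeasX.
  congr (_ - _).
  by rewrite -(exchange_mean P Q bF2).
have -> : mean P (fun x => mean Q (fun y => F x y ^+ 2) - H x ^+ 2) =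
    mean P (fun x => mean Q (fun y => F x y ^+ 2)) -
    mean P (fun x => H x ^+ 2).
  rewrite meanB//; first exact: (@bmeas_mean2 _ _ _ _ _ Q _ bF2).
  exact: bmeasX.
rewrite -/c; move: jensen; rewrite L M; lra.
Qed.

End fubini_mean.

(** * Integration over i.i.d. samples *)

Section product_power_integral.
Local Open Scope ereal_scope.
Context d (T : measurableType d) (R : realType).
Variable mu : {sigma_finite_measure set T -> \bar R}.

Lemma integral_product_power0 (f : 0.-tuple T -> \bar R) :
  measurable_fun setT f ->
  \int[product_power mu 0]_t f t = f [tuple].
Proof. by move=> mf; rewrite /= integral_dirac// diracT mul1e. Qed.

Lemma integral_product_powerS n (f : n.+1.-tuple T -> \bar R) :
  measurable_fun setT f -> (forall t, 0 <= f t) ->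
  \int[product_power mu n.+1]_t f t =
  \int[mu]_x \int[product_power mu n]_t f (tuple_cons (x, t)).
Proof.
move=> mf f0; rewrite /= /cons_measure ge0_integral_pushforward//.
- rewrite preimage_setT fubini_tonelli1//.
  - exact: (measurableT_comp mf (@measurable_tuple_cons _ T n)).
  - by move=> x /=; exact: f0.
- exact: measurable_tuple_cons.
Qed.

End product_power_integral.

Section iid_mean.
Context d (T : measurableType d) (R : realType) (P : probability T R).

Lemma measurable_uncurry_cons n :
  measurable_fun [set: T * n.-tuple T]
    (fun p => tuple_cons (p.1, p.2)).
Proof.
rewrite (_ : (fun p => _) = @tuple_cons T n); first exact: measurable_tuple_cons.
by apply/funext => -[].
Qed.

Lemma mean_iid0 (f : 0.-tuple T -> R) : bounded_measurable f ->
  mean (iid_law P 0) f = f [tuple].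
Proof.
move=> [mf _]; rewrite /mean.
rewrite (@integral_product_power0 _ _ _ P (fun t => (f t)%:E))//.
by apply/measurable_EFinP.
Qed.

Lemma bmeas_cons n (f : n.+1.-tuple T -> R) : bounded_measurable f ->
  bounded_measurable (fun p : T * n.-tuple T => f (tuple_cons (p.1, p.2))).
Proof. exact: (bmeas_comp (@measurable_uncurry_cons n)). Qed.

Lemma mean_iidS n (f : n.+1.-tuple T -> R) : bounded_measurable f ->
  mean (iid_law P n.+1) f =
  mean P (fun x => mean (iid_law P n) (fun t => f (tuple_cons (x, t)))).
Proof.
move=> bf; have [mf [B fB]] := bf.
have bc : bounded_measurable (fun t : n.+1.-tuple T => f t + B).
  exact/bmeasD/bmeas_cst.
have bfx x : bounded_measurable (fun t : n.-tuple T => f (tuple_cons (x, t))).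
  exact: (bmeas_pair1 x (bmeas_cons bf)).
have bm : bounded_measurable
    (fun x => mean (iid_law P n) (fun t => f (tuple_cons (x, t)))).
  exact: (@bmeas_mean2 _ _ _ _ _ (iid_law P n) _ (bmeas_cons bf)).
suff : mean (iid_law P n.+1) (fun t => f t + B) =
    mean P (fun x => mean (iid_law P n) (fun t => f (tuple_cons (x, t)) + B)).
  rewrite (meanD _ bf (bmeas_cst B)) mean_cst.
  under eq_fun => x do rewrite (meanD _ (bfx x) (bmeas_cst B)) mean_cst.
  by rewrite (meanD _ bm (bmeas_cst B)) mean_cst => /addIr.
rewrite {1}/mean integral_product_powerS//.
- congr fine; apply: eq_integral => x _.
  exact: (mean_EFin (iid_law P n) (bmeasD (bfx x) (bmeas_cst B))).
- by apply/measurable_EFinP; have [] := bc.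
- by move=> t; rewrite lee_fin -lerBlDr sub0r lerNl (le_trans (ler_norm _))// normrN.
Qed.

End iid_mean.

Section sequence_functions.
Context d (T : measurableType d) (R : realType).
Implicit Types (P : probability T R) (f : seq T -> R).

(** Functions of lists can be evaluated at samples of every size, which is needed to add or remove a
    point and to randomize the number of points. The bound may depend on the length, as it does for
    [log Z]. *)
Definition seq_bmeas f :=
  forall n, bounded_measurable (fun t : n.-tuple T => f t).

Definition mean_seq P n f := mean (iid_law P n) (fun t : n.-tuple T => f t).

Lemma seq_bmeas_uncurry f n : seq_bmeas f ->
  bounded_measurable (fun p : T * n.-tuple T => f (p.1 :: p.2)).
Proof. by move=> bf; exact: (bmeas_cons (bf n.+1)). Qed.

Lemma seq_bmeas_cons f x : seq_bmeas f -> seq_bmeas (fun l => f (x :: l)).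
Proof. by move=> bf n; exact: (bmeas_pair1 x (seq_bmeas_uncurry n bf)). Qed.

Lemma bmeas_seq_cons f l : seq_bmeas f ->
  bounded_measurable (fun x => f (x :: l)).
Proof.
move=> bf.
exact: (bmeas_pair2 (in_tuple l) (seq_bmeas_uncurry (size l) bf)).
Qed.

Lemma seq_bmeas_mean P f : seq_bmeas f ->
  seq_bmeas (fun l => mean P (fun x => f (x :: l))).
Proof.
move=> bf n.
exact: (@bmeas_mean2 _ _ _ _ _ P _ (bmeas_swap (seq_bmeas_uncurry n bf))).
Qed.

Lemma bmeas_mean_seq P n f : seq_bmeas f ->
  bounded_measurable (fun x => mean_seq P n (fun l => f (x :: l))).
Proof.
by move=> bf; exact: (@bmeas_mean2 _ _ _ _ _ _ _ (seq_bmeas_uncurry n bf)).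
Qed.

Lemma mean_seq0 P f : seq_bmeas f -> mean_seq P 0 f = f [::].
Proof. by move=> bf; rewrite /mean_seq mean_iid0. Qed.

Lemma mean_seqS P n f : seq_bmeas f ->
  mean_seq P n.+1 f = mean P (fun x => mean_seq P n (fun l => f (x :: l))).
Proof. by move=> bf; rewrite /mean_seq mean_iidS. Qed.

Lemma exchange_mean_seq P Q n f : seq_bmeas f ->
  mean P (fun x => mean_seq Q n (fun l => f (x :: l))) =
  mean_seq Q n (fun l => mean P (fun x => f (x :: l))).
Proof. by move=> bf; apply: exchange_mean; exact: seq_bmeas_uncurry. Qed.

Lemma le_mean_seq P n f g : seq_bmeas f -> seq_bmeas g ->
  (forall l, size l = n -> f l <= g l) -> mean_seq P n f <= mean_seq P n g.
Proof. by move=> bf bg fg; apply: le_mean => // t; rewrite fg ?size_tuple. Qed.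

(** These moves generate all permutations; in this form any point can be brought to the front, where
    [mean_seqS] integrates it. *)
Definition symmetric_seq f := forall s x l, f (s ++ x :: l) = f (x :: s ++ l).

Lemma symmetric_seq_cons f x : symmetric_seq f ->
  symmetric_seq (fun l => f (x :: l)).
Proof.
by move=> sf s y l; rewrite -cat_cons sf cat_cons -(sf [:: x]).
Qed.

(** Points of law [P] are replaced by points of law [Q] one at a time. The assumption is made with
    all other points frozen, so it survives each replacement, and symmetry lets any point play the
    role of the first one. *)
Lemma le_mean_seq_law P Q n f : seq_bmeas f -> symmetric_seq f ->
  (forall l, mean P (fun x => f (x :: l)) <= mean Q (fun x => f (x :: l))) ->
  mean_seq P n f <= mean_seq Q n f.
Proof.
elim: n f => [|n IHn] f bf sf PQ; first by rewrite !mean_seq0.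
rewrite !mean_seqS//.
have bQ := bmeas_mean_seq Q n bf.
apply: (@le_trans _ _ (mean P (fun x => mean_seq Q n (fun l => f (x :: l))))).
  apply: le_mean => //; first exact: bmeas_mean_seq.
  move=> x; apply: IHn; [exact: seq_bmeas_cons|exact: symmetric_seq_cons|].
  move=> l; have /= PQx := PQ (x :: l); move: PQx.
  by congr (_ <= _); congr mean; apply/funext => y; rewrite -(sf [:: y]).
rewrite !exchange_mean_seq//; apply: le_mean_seq => //; exact: seq_bmeas_mean.
Qed.

Lemma variance_le P (g : T -> R) c : bounded_measurable g ->
  mean P (fun x => g x ^+ 2) - mean P g ^+ 2 <=
  mean P (fun x => (g x - c) ^+ 2).
Proof.
move=> bg; suff -> : mean P (fun x => (g x - c) ^+ 2) =
    mean P (fun x => g x ^+ 2) - (2 * c * mean P g - c ^+ 2).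
  by rewrite -subr_ge0; have := sqr_ge0 (mean P g - c); lra.
transitivity (mean P (fun x => g x ^+ 2 - ((2 * c) * g x - c ^+ 2))).
  by congr mean; apply/funext => x; ring.
have b2 : bounded_measurable (fun x => 2 * c * g x).
  exact/bmeasM/bg/bmeas_cst.
rewrite meanB ?meanB ?mean_cst ?meanZ//; first exact: bmeas_cst.
  exact: bmeasX.
exact/bmeasB/bmeas_cst.
Qed.

(* Efron-Stein for a symmetric function, with the value at the sample without
   its first point as the centering constant. *)
Lemma variance_symmetric P n f : seq_bmeas f -> symmetric_seq f ->
  mean_seq P n.+1 (fun l => f l ^+ 2) - mean_seq P n.+1 f ^+ 2 <=
  n.+1%:R * mean_seq P n (fun l => mean P (fun x => (f (x :: l) - f l) ^+ 2)).
Proof.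
have bX g : seq_bmeas g -> seq_bmeas (fun l => g l ^+ 2).
  by move=> bg m; exact/bmeasX/bg.
have bD g : seq_bmeas g -> seq_bmeas (fun l => (g l - g (behead l)) ^+ 2).
  move=> bg [|m]; apply/bmeasX/bmeasB; first exact: bg.
  - rewrite (_ : (fun _ => _) = fun=> g [::]); first exact: bmeas_cst.
    by apply/funext => t; rewrite tuple0.
  - exact: bg.
  - exact: (bmeas_comp (@measurable_behead _ T m) (bg m)).
have bV g : seq_bmeas g ->
    seq_bmeas (fun l => mean P (fun x => (g (x :: l) - g l) ^+ 2)).
  by move=> bg; exact: (seq_bmeas_mean P (bD _ bg)).
elim: n f => [|n IHn] f bf sf.
  rewrite mul1r (mean_seq0 _ (bV _ bf)) !mean_seqS ?mean_seq0//; last exact: bX.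
  have e0 g : seq_bmeas g ->
      (fun x => mean_seq P 0 (fun l => g (x :: l))) = (fun x => g [:: x]).
    by move=> bg; apply/funext => x; rewrite mean_seq0//; exact: seq_bmeas_cons.
  rewrite (e0 _ bf) (e0 _ (bX _ bf)).
  exact/variance_le/bmeas_seq_cons.
rewrite 2?mean_seqS//; last exact: bX.
apply: le_trans.
  exact: (variance_prod P (iid_law P n.+1) (seq_bmeas_uncurry n.+1 bf)).
rewrite [in leRHS]mulrS mulrDl mul1r; apply: lerD.
- apply: le_mean => [||t].
  + apply: bmeasB; last exact/bmeasX/(seq_bmeas_mean P bf n.+1).
    exact: (seq_bmeas_mean P (bX _ bf) n.+1).
  + exact: (bV _ bf n.+1).
  + exact/variance_le/bmeas_seq_cons.
- rewrite (mean_seqS _ _ (bV _ bf)) -meanZ; last exact: bmeas_mean_seq (bV _ bf).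
  apply: le_mean => [||x].
  + apply: bmeasB; first exact: (bmeas_mean_seq P n.+1 (bX _ bf)).
    exact/bmeasX/(bmeas_mean_seq P n.+1 bf).
  + exact/(bmeasM (bmeas_cst _))/(bmeas_mean_seq P n (bV _ bf)).
  + have := IHn _ (seq_bmeas_cons x bf) (symmetric_seq_cons x sf).
    congr (_ <= _ * mean_seq _ _ _); apply/funext => l; congr mean.
    by apply/funext => y; rewrite -(sf [:: x]).
Qed.

Lemma mean_seq_cst P n c : mean_seq P n (fun=> c) = c.
Proof. exact: mean_cst. Qed.

End sequence_functions.

Section bounded_differences.
Context d (T : measurableType d) (R : realType) (P : probability T R).

(** The Efron-Stein bound for the node potentials. No symmetry is available there, and the bound
    depends on the coordinate because the influence of a node grows with its degree. *)
Lemma variance_bounded_differences n (f : n.-tuple T -> R) (B : 'I_n -> R) :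
  bounded_measurable f ->
  (forall i t t', (forall j, j != i -> tnth t j = tnth t' j) ->
     `|f t - f t'| <= B i) ->
  mean (iid_law P n) (fun t => f t ^+ 2) - mean (iid_law P n) f ^+ 2 <=
  \sum_(i < n) B i ^+ 2.
Proof.
elim: n f B => [|n IHn] f B bf fB.
  by rewrite big_ord0 !mean_iid0 ?subrr//; exact: bmeasX.
rewrite 2?mean_iidS//; last exact: bmeasX.
apply: le_trans; first exact: (variance_prod P (iid_law P n) (bmeas_cons bf)).
rewrite big_ord_recl; apply: lerD.
- rewrite -[leRHS](mean_cst (iid_law P n)); apply: le_mean => [|//|t].
  + have b2 := bmeas_swap (bmeas_cons (bmeasX 2 bf)).
    apply: bmeasB; first exact: (@bmeas_mean2 _ _ _ _ _ P _ b2).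
    exact/bmeasX/(@bmeas_mean2 _ _ _ _ _ P _ (bmeas_swap (bmeas_cons bf))).
  + exact: bmeas_cst.
  + have bt : bounded_measurable (fun x => f (tuple_cons (x, t))).
      exact: (bmeas_pair2 t (bmeas_cons bf)).
    (* Any constant may serve as the center; here it is the value of [f] with an arbitrary first
       coordinate. *)
    apply: le_trans; first exact: (variance_le P (f (tuple_cons (point, t))) bt).
    rewrite -[leRHS](mean_cst P); apply: le_mean => [||x].
    * exact/bmeasX/bmeasB/bmeas_cst.
    * exact: bmeas_cst.
    * rewrite -real_normK ?num_real// lerXn2r ?nnegrE//.
        exact: le_trans (fB ord0 (tuple_cons (x, t)) _ _).
      apply: fB => j; case: (unliftP ord0 j) => [k -> _|-> /eqP//].
      by rewrite !tnthS.
- rewrite -[leRHS](mean_cst P); apply: le_mean => [||x].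
  + apply: bmeasB; first exact: (@bmeas_mean2 _ _ _ _ _ (iid_law P n) _ (bmeas_cons (bmeasX 2 bf))).
    exact/bmeasX/(@bmeas_mean2 _ _ _ _ _ (iid_law P n) _ (bmeas_cons bf)).
  + exact: bmeas_cst.
  + apply: (IHn (fun t => f (tuple_cons (x, t))) (fun i => B (lift ord0 i))).
      exact: (bmeas_pair1 x (bmeas_cons bf)).
    move=> i t t' tt'; apply: fB => j; case: (unliftP ord0 j) => [k ->|->//].
    by rewrite (inj_eq lift_inj) !tnthS; exact: tt'.
Qed.

End bounded_differences.

Section concatenation.
Context d (T : measurableType d) (R : realType).

Lemma measurable_tuple_cat d' (X : measurableType d') n m
    (u : X -> n.-tuple T) (v : X -> m.-tuple T) :
  measurable_fun setT u -> measurable_fun setT v ->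
  measurable_fun setT (fun x => [tuple of u x ++ v x]).
Proof.
move=> mu mv; apply/measurable_fun_tnthP => i /=.
have tnthu j : measurable_fun setT (fun x => tnth (u x) j).
  exact: (measurableT_comp (@measurable_tnth _ T n j) mu).
have tnthv j : measurable_fun setT (fun x => tnth (v x) j).
  exact: (measurableT_comp (@measurable_tnth _ T m j) mv).
case: (split_ordP i) => j ->; rewrite /comp.
  by rewrite (_ : (fun _ => _) = (fun x => tnth (u x) j))//;
    apply/funext => x; rewrite tnth_lshift.
by rewrite (_ : (fun _ => _) = (fun x => tnth (v x) j))//;
  apply/funext => x; rewrite tnth_rshift.
Qed.

Lemma cat_tuple_cons n m (x : T) (s : n.-tuple T) (t : m.-tuple T) :
  [tuple of tuple_cons (x, s) ++ t] =
  tuple_cons (x, [tuple of s ++ t]) :> (n.+1 + m).-tuple T.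
Proof. exact: val_inj. Qed.

Lemma integral_product_power_cat (mu : {sigma_finite_measure set T -> \bar R})
    m n (f : (m + n).-tuple T -> \bar R) :
  measurable_fun setT f -> (forall t, 0 <= f t)%E ->
  (\int[product_power mu (m + n)]_t f t =
   \int[product_power mu m]_s \int[product_power mu n]_t f [tuple of s ++ t])%E.
Proof.
have mcat k : measurable_fun [set: k.-tuple T * n.-tuple T]
    (fun p => [tuple of p.1 ++ p.2]).
  by apply: measurable_tuple_cat; [exact: measurable_fst|exact: measurable_snd].
have mint k (g : (k + n).-tuple T -> \bar R) : measurable_fun setT g ->
    (forall t, 0 <= g t)%E -> measurable_fun setT (fun s : k.-tuple T =>
      \int[product_power mu n]_t g [tuple of s ++ t])%E.
  move=> mg g0; exact: (@measurable_fun_fubini_tonelli_F _ _ _ _ _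
    (product_power mu n)
    (fun p : k.-tuple T * n.-tuple T => g [tuple of p.1 ++ p.2])
    (measurableT_comp mg (mcat k)) (fun p => g0 _)).
elim: m f => [|m IHm] f mf f0.
  rewrite integral_product_power0.
    by apply: eq_integral => t _; congr f; exact: val_inj.
  exact: mint.
rewrite (@integral_product_powerS _ _ _ mu (m + n) f mf f0).
rewrite integral_product_powerS.
- apply: eq_integral => x _.
  have mfx : measurable_fun setT (fun t : (m + n).-tuple T => f (tuple_cons (x, t))).
    apply: (measurableT_comp mf).
    exact: (measurable_fun_pair2 x (@measurable_uncurry_cons _ T (m + n))).
  have e := IHm (fun t => f (tuple_cons (x, t))) mfx (fun=> f0 _).
  apply: (etrans e).
  apply: eq_integral => s _.
  apply: eq_integral => t _.
  exact/esym/(congr1 f)/cat_tuple_cons.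
- exact: mint.
- by move=> t; exact: integral_ge0.
Qed.

Lemma mean_iid_cat (P : probability T R) m n (f : (m + n).-tuple T -> R) :
  bounded_measurable f ->
  mean (iid_law P (m + n)) f =
  mean (iid_law P m) (fun s =>
    mean (iid_law P n) (fun t => f [tuple of s ++ t])).
Proof.
move=> bf; have [mf [B fB]] := bf.
have mcat : measurable_fun [set: m.-tuple T * n.-tuple T]
    (fun p => [tuple of p.1 ++ p.2]).
  by apply: measurable_tuple_cat; [exact: measurable_fst|exact: measurable_snd].
have bcat := bmeas_comp mcat bf.
have bs (s : m.-tuple T) : bounded_measurable (fun t : n.-tuple T => f [tuple of s ++ t]).
  exact: (bmeas_pair1 s bcat).
have bm : bounded_measurable
    (fun s : m.-tuple T => mean (iid_law P n) (fun t => f [tuple of s ++ t])).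
  exact: (@bmeas_mean2 _ _ _ _ _ (iid_law P n) _ bcat).
suff : mean (iid_law P (m + n)) (fun t => f t + B) =
    mean (iid_law P m) (fun s : m.-tuple T =>
      mean (iid_law P n) (fun t => f [tuple of s ++ t] + B)).
  rewrite (meanD _ bf (bmeas_cst B)) mean_cst.
  under eq_fun => x do rewrite (meanD _ (bs x) (bmeas_cst B)) mean_cst.
  by rewrite (meanD _ bm (bmeas_cst B)) mean_cst => /addIr.
rewrite {1}/mean integral_product_power_cat.
- congr fine; apply: eq_integral => x _.
  exact: (mean_EFin (iid_law P n) (bmeasD (bs x) (bmeas_cst B))).
- by apply/measurable_EFinP; have [] := bmeasD bf (bmeas_cst B).
- by move=> t; rewrite lee_fin -lerBlDr sub0r lerNl (le_trans (ler_norm _))// normrN.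
Qed.

End concatenation.

Section zip.
Context d1 d2 (X : measurableType d1) (Y : measurableType d2) (R : realType).
Variables (P : probability X R) (Q : probability Y R).

Lemma measurable_zip n : measurable_fun [set: n.-tuple X * n.-tuple Y]
  (fun p => [tuple of zip p.1 p.2] : n.-tuple (X * Y)%type).
Proof.
apply/measurable_fun_tnthP => i.
rewrite (_ : _ \o _ = fun p : n.-tuple X * n.-tuple Y => (tnth p.1 i, tnth p.2 i)).
  apply: measurable_fun_pair.
    exact: (measurableT_comp (@measurable_tnth _ X n i) measurable_fst).
  exact: (measurableT_comp (@measurable_tnth _ Y n i) measurable_snd).
apply/funext => p /=; rewrite (tnth_nth (point, point)) /=.
by rewrite nth_zip ?size_tuple// -!tnth_nth.
Qed.

Lemma seq_bmeas_zip n (f : seq (X * Y) -> R) : seq_bmeas f ->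
  bounded_measurable (fun p : n.-tuple X * n.-tuple Y => f (zip p.1 p.2)).
Proof. by move=> bf; exact: (bmeas_comp (@measurable_zip n) (bf n)). Qed.

(** An instance draws the edges and their potentials separately, whereas the interpolation draws
    each edge together with its potential; zipping identifies the two laws. *)
Lemma mean_zip n (f : seq (X * Y) -> R) : seq_bmeas f ->
  mean (iid_law P n) (fun s => mean (iid_law Q n) (fun t => f (zip s t))) =
  mean_seq (P \x Q)%E n f.
Proof.
elim: n f => [|n IHn] f bf.
  rewrite mean_seq0// mean_iid0 ?mean_iid0//.
    rewrite (_ : (fun _ => _) = fun=> f [::]); first exact: bmeas_cst.
    by apply/funext => t; rewrite (tuple0 t).
  exact: (@bmeas_mean2 _ _ _ _ _ (iid_law Q 0) _ (seq_bmeas_zip 0 bf)).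
have bz := seq_bmeas_zip n.+1 bf.
rewrite mean_seqS// mean_prod; last exact: bmeas_mean_seq.
rewrite mean_iidS; last exact: (@bmeas_mean2 _ _ _ _ _ (iid_law Q n.+1) _ bz).
congr mean; apply/funext => x.
have bxy y : bounded_measurable (fun p : n.-tuple X * n.-tuple Y =>
    f ((x, y) :: zip p.1 p.2)).
  exact: (seq_bmeas_zip n (seq_bmeas_cons (x, y) bf)).
have bxs (s : n.-tuple X) : bounded_measurable (fun t : n.+1.-tuple Y =>
    f (zip (tuple_cons (x, s)) t)).
  exact: (bmeas_pair1 (tuple_cons (x, s)) bz).
transitivity (mean (iid_law P n) (fun s => mean Q (fun y =>
    mean (iid_law Q n) (fun t => f ((x, y) :: zip s t))))).
  by congr mean; apply/funext => s; rewrite mean_iidS.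
rewrite exchange_mean; last first.
  apply: (@bmeas_mean2 _ _ _ _ _ (iid_law Q n)
    (fun (p : n.-tuple X * Y) (t : n.-tuple Y) => f ((x, p.2) :: zip p.1 t))).
  pose phi (p : (n.-tuple X * Y) * n.-tuple Y) : n.+1.-tuple X * n.+1.-tuple Y :=
    ([tuple of x :: p.1.1], [tuple of p.1.2 :: p.2]).
  have mphi : measurable_fun setT phi.
    apply: measurable_fun_pair; apply: measurable_cons.
    - exact: measurable_cst.
    - exact: (measurableT_comp measurable_fst measurable_fst).
    - exact: (measurableT_comp measurable_snd measurable_fst).
    - exact: measurable_snd.
  exact: (bmeas_comp mphi bz).
congr mean; apply/funext => y; rewrite -IHn//; exact: seq_bmeas_cons.
Qed.

End zip.

(** * Mixtures and the split of an i.i.d. sample *)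

Section discrete.
Variables (n K : nat).

(** Tuples carry the product sigma-algebra; it is discrete here because singletons are finite
    intersections of coordinate events and there are finitely many tuples. *)
Lemma measurable_edges (A : set (K.-tuple 'I_n.+1)) : measurable A.
Proof.
rewrite (_ : A = \bigcup_(e in A) [set e]); last first.
  by apply/seteqP; split => [e Ae|e [e' Ae' ->]//]; exists e.
apply: fin_bigcup_measurable; first exact: finite_finset.
move=> e _; rewrite (_ : [set e] =
    \bigcap_(k in [set: 'I_K]) ((fun t : K.-tuple 'I_n.+1 => tnth t k) @^-1` [set tnth e k])).
  apply: fin_bigcap_measurable => // k _.
  by rewrite -[X in measurable X]setTI; exact: measurable_tnth.
apply/seteqP; split => [_ -> k _//|t te]; apply: eq_from_tnth => k; exact: te.
Qed.

Lemma measurable_fun_edges d (T : measurableType d) (f : K.-tuple 'I_n.+1 -> T) :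
  measurable_fun setT f.
Proof. by move=> _ B mB; exact: measurable_edges. Qed.

Lemma measurable_edge_pair d d' (T : measurableType d) (Y : measurableType d')
    (f : K.-tuple 'I_n.+1 -> T -> Y) :
  (forall e, measurable_fun setT (f e)) ->
  measurable_fun setT (fun p : K.-tuple 'I_n.+1 * T => f p.1 p.2).
Proof.
move=> mf _ B mB; rewrite setTI.
rewrite (_ : _ @^-1` _ = \bigcup_(e in [set: K.-tuple 'I_n.+1])
    ([set e] `*` (f e @^-1` B))); last first.
  by apply/seteqP; split => [[e t] /= Bet|[e t] [e' _ [/= -> //]]]; exists e.
apply: fin_bigcup_measurable; first exact: finite_finset.
move=> e _; apply: measurableX; first exact: measurable_edges.
by rewrite -[X in measurable X]setTI; exact: mf.
Qed.

End discrete.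

Section mixture.
Context d (T : measurableType d) (R : realType).
Variables (a b : {nonneg R}) (ab1 : a%:num + b%:num = 1).
Variables P Q : probability T R.

(** The proof that the weights sum to 1 is kept as an argument so that the probability structure can
    be attached to the term; [image_law] keeps its measurability proof for the same reason. *)
Definition mixture of a%:num + b%:num = 1 : set T -> \bar R :=
  measure_add (mscale a P) (mscale b Q).

HB.instance Definition _ := Measure.on (mixture ab1).

Let mixture_setT : mixture ab1 setT = 1%E.
Proof.
rewrite /mixture measure_addE.
transitivity (a%:num%:E * P setT + b%:num%:E * Q setT)%E; first exact: erefl.
by rewrite (probability_setT P) (probability_setT Q) !mule1 -EFinD ab1.
Qed.

HB.instance Definition _ := Measure_isProbability.Build _ _ _ (mixture ab1)
  mixture_setT.

Lemma mean_mixture f : bounded_measurable f ->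
  mean (mixture ab1) f = a%:num * mean P f + b%:num * mean Q f.
Proof.
move=> bf; have [mf [B fB]] := bf.
have bB := bmeasD bf (bmeas_cst B).
have fB0 x : (0 <= (f x + B)%:E)%E.
  by rewrite lee_fin -lerBlDr sub0r lerNl (le_trans (ler_norm _))// normrN.
have mB : measurable_fun setT (fun x => (f x + B)%:E).
  by apply/measurable_EFinP; have [] := bB.
suff : mean (mixture ab1) (fun x => f x + B) =
    a%:num * mean P (fun x => f x + B) + b%:num * mean Q (fun x => f x + B).
  rewrite !(meanD _ bf (bmeas_cst B)) !mean_cst => e.
  apply: (addIr B); rewrite e -[in RHS](mul1r B) -ab1; ring.
apply: EFin_inj; rewrite EFinD !EFinM -!mean_EFin//.
rewrite /mixture ge0_integral_measure_add//.
by rewrite !ge0_integral_mscale.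
Qed.

End mixture.

Section edge_law.
Variables (R : realType) (n K : nat).

Lemma bmeas_edges (f : K.-tuple 'I_n.+1 -> R) : bounded_measurable f.
Proof.
split; first exact: measurable_fun_edges.
exists (\sum_e `|f e|) => e.
by rewrite (bigD1 e)//= lerDl sumr_ge0.
Qed.

Lemma mean_edge_law (f : K.-tuple 'I_n.+1 -> R) :
  mean (edge_law R n K) f = (n.+1 ^ K)%:R^-1 * \sum_e f e.
Proof.
have bE (e : K.-tuple 'I_n.+1) : bounded_measurable (\1_[set e] : _ -> R).
  exact: bmeas_edges.
rewrite [in LHS](_ : f = fun x => \sum_e f e * \1_[set e] x); last first.
  apply/funext => x; rewrite (bigD1 x)//= indicE mem_set// mulr1.
  rewrite big1 ?addr0// => e ex; rewrite indicE memNset ?mulr0//=.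
  by apply/eqP; rewrite eq_sym.
rewrite mean_sum => [|e]; last exact: bmeas_edges.
rewrite mulr_sumr; apply: eq_bigr => e _.
rewrite meanZ// mulrC; congr (_ * _).
  rewrite /mean integral_indic//; last exact: measurable_edges.
  rewrite setIT.
  transitivity (fine ((#|{: K.-tuple 'I_n.+1}|%:R^-1)%:E *
    (counting [set e] : \bar R))%E); first exact: erefl.
  rewrite /counting asboolT; last exact: finite_set1.
  by rewrite fset_set1 finmap.cardfs1 mule1 /= card_tuple card_ord.
Qed.

End edge_law.

Section image_law.
Context d d' (X : measurableType d) (Y : measurableType d') (R : realType).
Variables (P : probability X R) (phi : X -> Y) (mphi : measurable_fun setT phi).

Definition image_law of measurable_fun setT phi : set Y -> \bar R :=
  pushforward P phi.

Let image_measure : {measure set Y -> \bar R} :=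
  measure_function_pushforward__canonical__measure_function_Measure P mphi.

HB.instance Definition _ := isMeasure.Build _ _ _ (image_law mphi)
  (measure0 image_measure) (measure_ge0 image_measure)
  (@measure_semi_sigma_additive _ _ _ image_measure).

Let image_law_setT : image_law mphi setT = 1%E.
Proof. by rewrite /image_law /pushforward preimage_setT probability_setT. Qed.

HB.instance Definition _ := Measure_isProbability.Build _ _ _ (image_law mphi)
  image_law_setT.

Lemma mean_image_law f : bounded_measurable f ->
  mean (image_law mphi) f = mean P (fun x => f (phi x)).
Proof.
move=> bf; have [mf [B fB]] := bf.
have bp : bounded_measurable (fun x => f (phi x)) by exact: bmeas_comp.
suff : mean (image_law mphi) (fun x => f x + B) =
    mean P (fun x => f (phi x) + B).
  rewrite (meanD _ bf (bmeas_cst B)) (meanD _ bp (bmeas_cst B)) !mean_cst.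
  exact: addIr.
rewrite /mean; congr fine; rewrite ge0_integral_pushforward//.
- by apply/measurable_EFinP; have [] := bmeasD bf (bmeas_cst B).
- by move=> y _; rewrite lee_fin -lerBlDr sub0r lerNl (le_trans (ler_norm _))// normrN.
Qed.

End image_law.

Section binomial_mean.
Context (R : realType).
Variables (a b : R).

(* The expectation of [phi j k] when [n] points fall independently into two
   classes of probabilities [a] and [b], [j] and [k] being the class sizes. *)
Fixpoint binomial_mean n (phi : nat -> nat -> R) : R :=
  match n with
  | 0 => phi 0%N 0%N
  | n'.+1 => a * binomial_mean n' (fun j k => phi j.+1 k) +
             b * binomial_mean n' (fun j k => phi j k.+1)
  end.

Lemma le_binomial_mean n phi psi : 0 <= a -> 0 <= b ->
  (forall j k, (j + k = n)%N -> phi j k <= psi j k) ->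
  binomial_mean n phi <= binomial_mean n psi.
Proof.
move=> a0 b0; elim: n phi psi => [|n IHn] phi psi le_phi; first exact: le_phi.
rewrite /= lerD// ler_wpM2l//; apply: IHn => j k jk; apply: le_phi.
  by rewrite addSn jk.
by rewrite addnS jk.
Qed.

Lemma binomial_meanD n phi psi :
  binomial_mean n (fun j k => phi j k + psi j k) =
  binomial_mean n phi + binomial_mean n psi.
Proof.
by elim: n phi psi => [//|n IHn] phi psi /=; rewrite !IHn; ring.
Qed.

Lemma binomial_meanZ n c phi :
  binomial_mean n (fun j k => c * phi j k) = c * binomial_mean n phi.
Proof. by elim: n phi => [//|n IHn] phi /=; rewrite !IHn; ring. Qed.

Hypothesis ab1 : a + b = 1.

Lemma binomial_mean_cst n c : binomial_mean n (fun _ _ => c) = c.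
Proof. by elim: n => [//|n /= ->]; rewrite -mulrDl ab1 mul1r. Qed.

(** Variance plus squared bias. The center [t] is general because a point of the first class moves
    it to [t - 1] in the induction. *)
Lemma binomial_mean_sqr n t :
  binomial_mean n (fun j _ => (j%:R - t) ^+ 2) =
  n%:R * a * b + (n%:R * a - t) ^+ 2.
Proof.
elim: n t => [|n IHn] t /=; first by ring.
have -> : (fun (j _ : nat) => (j.+1%:R - t) ^+ 2 : R) =
    (fun j _ => (j%:R - (t - 1)) ^+ 2).
  by apply/funext => j; apply/funext => _; rewrite -natr1; ring.
rewrite !IHn -natr1 (_ : b = 1 - a); last by rewrite -ab1; ring.
by ring.
Qed.

Lemma binomial_mean_mean d (T : measurableType d) (P : probability T R) n
    (phi : T -> nat -> nat -> R) :
  (forall j k, bounded_measurable (fun x => phi x j k)) ->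
  bounded_measurable (fun x => binomial_mean n (phi x)) /\
  mean P (fun x => binomial_mean n (phi x)) =
  binomial_mean n (fun j k => mean P (fun x => phi x j k)).
Proof.
elim: n phi => [|n IHn] phi bphi /=; first by split.
have [b1 e1] := IHn (fun x j k => phi x j.+1 k) (fun j k => bphi j.+1 k).
have [b2 e2] := IHn (fun x j k => phi x j k.+1) (fun j k => bphi j k.+1).
have c1 := bmeasM (bmeas_cst a) b1; have c2 := bmeasM (bmeas_cst b) b2.
split; first exact: bmeasD.
by rewrite (meanD _ c1 c2) (meanZ _ _ b1) (meanZ _ _ b2) e1 e2.
Qed.

End binomial_mean.

Section split_mixture.
Context d d1 d2 (T : measurableType d) (T1 : measurableType d1)
  (T2 : measurableType d2) (R : realType).
Variables (a b : {nonneg R}) (ab1 : a%:num + b%:num = 1).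
Variables (phi1 : T1 -> T) (phi2 : T2 -> T).
Hypotheses (mphi1 : measurable_fun setT phi1)
  (mphi2 : measurable_fun setT phi2).
Variables (P1 : probability T1 R) (P2 : probability T2 R).

Definition split_law : probability T R :=
  mixture (image_law P1 mphi1) (image_law P2 mphi2) ab1.

Definition lefts A B (s : seq (A + B)) : seq A :=
  pmap (fun x => if x is inl y then Some y else None) s.

Definition rights A B (s : seq (A + B)) : seq B :=
  pmap (fun x => if x is inr y then Some y else None) s.

Definition merge_split (x : T1 + T2) : T :=
  match x with inl y => phi1 y | inr y => phi2 y end.

(** A list over [T1 + T2] is a sample of the mixture together with the component of each point.
    Since [F] is a sum over the two components, only the class sizes remain once the points are
    averaged, and these are binomial. *)
Lemma mean_seq_split n (F : seq T -> R) (F1 : seq T1 -> R) (F2 : seq T2 -> R) :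
  seq_bmeas F -> seq_bmeas F1 -> seq_bmeas F2 ->
  (forall s, F (map merge_split s) = F1 (lefts s) + F2 (rights s)) ->
  mean_seq split_law n F = binomial_mean a%:num b%:num n
    (fun j k => mean_seq P1 j F1 + mean_seq P2 k F2).
Proof.
elim: n F F1 F2 => [|n IHn] F F1 F2 bF bF1 bF2 FE.
  by rewrite /= !mean_seq0//; exact: (FE [::]).
rewrite mean_seqS// /split_law mean_mixture; last exact: bmeas_mean_seq.
rewrite -/split_law !mean_image_law; [|exact: bmeas_mean_seq..].
congr (_ * _ + _ * _).
- transitivity (mean P1 (fun x => binomial_mean a%:num b%:num n
      (fun j k => mean_seq P1 j (fun l => F1 (x :: l)) + mean_seq P2 k F2))).
    congr mean; apply/funext => x; apply: IHn => //; try exact: seq_bmeas_cons.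
    by move=> s; have := FE (inl x :: s).
  have bj j k : bounded_measurable (fun x =>
      mean_seq P1 j (fun l => F1 (x :: l)) + mean_seq P2 k F2).
    exact: (bmeasD (bmeas_mean_seq P1 j bF1) (bmeas_cst _)).
  have [_ ->] := binomial_mean_mean a%:num b%:num P1 n bj.
  congr binomial_mean; apply/funext => j; apply/funext => k.
  by rewrite (meanD _ (bmeas_mean_seq P1 j bF1) (bmeas_cst _)) mean_cst -mean_seqS.
- transitivity (mean P2 (fun x => binomial_mean a%:num b%:num n
      (fun j k => mean_seq P1 j F1 + mean_seq P2 k (fun l => F2 (x :: l))))).
    congr mean; apply/funext => x; apply: IHn => //; try exact: seq_bmeas_cons.
    by move=> s; have := FE (inr x :: s).
  have bj j k : bounded_measurable (fun x =>
      mean_seq P1 j F1 + mean_seq P2 k (fun l => F2 (x :: l))).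
    exact: (bmeasD (bmeas_cst _) (bmeas_mean_seq P2 k bF2)).
  have [_ ->] := binomial_mean_mean a%:num b%:num P2 n bj.
  congr binomial_mean; apply/funext => j; apply/funext => k.
  by rewrite (meanD _ (bmeas_cst _) (bmeas_mean_seq P2 k bF2)) mean_cst -mean_seqS.
Qed.

End split_mixture.

Lemma mean_dist d (T : measurableType d) (R : realType) (P : probability T R)
    (f g : T -> R) C : bounded_measurable f -> bounded_measurable g ->
  (forall x, `|f x - g x| <= C) -> `|mean P f - mean P g| <= C.
Proof.
move=> bf bg fg; rewrite -meanB// ler_norml.
rewrite -(mean_cst P (- C)) -[X in _ && (_ <= X)](mean_cst P C).
have bfg := bmeasB bf bg.
by apply/andP; split; apply: le_mean => //; try exact: bmeas_cst;
  move=> x; have := fg x; rewrite ler_norml => /andP[].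
Qed.

(** * Logarithmic series, replicas and near-superadditive sequences *)

Section log_series.
Context (R : realType).

(** The Taylor polynomial of [- ln (1 - t)] at 0; the sign makes all coefficients non-negative. *)
Definition log_taylor n (t : R) : R := \sum_(r < n) r.+1%:R^-1 * t ^+ r.+1.

Lemma is_derive_log_taylor n (t : R) :
  is_derive t 1 (log_taylor n) (\sum_(r < n) t ^+ r).
Proof.
elim: n => [|n IHn].
  rewrite big_ord0 (_ : log_taylor 0 = cst 0); first exact: is_derive_cst.
  by apply/funext => x; rewrite /log_taylor big_ord0.
rewrite big_ord_recr (_ : log_taylor n.+1 =
    log_taylor n + n.+1%:R^-1 \*: (@id R ^+ n.+1)); last first.
  apply/funext => x; rewrite /log_taylor big_ord_recr/=; congr (_ + _ * _).
  by rewrite exprfctE.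
apply: is_deriveD; apply: is_derive_eq.
by rewrite /GRing.scale/= mulr1 mulKf// pnatr_eq0.
Qed.

(** By the geometric sum, the derivative of the left-hand function is [- t ^+ n / (1 - t)], and the
    mean value theorem applies on [0, t]. The bound is uniform on [0, q] and vanishes as [n]
    grows. *)
Lemma ln_taylor_le n (t q : R) : 0 <= t -> t <= q -> q < 1 ->
  `|ln (1 - t) + log_taylor n t| <= q ^+ n / (1 - q).
Proof.
move=> t0 tq q1.
pose f (x : R) := ln (1 - x) + log_taylor n x.
have dln (x : R) : x < 1 -> is_derive x 1 (fun y : R => ln (1 - y)) (- (1 - x)^-1).
  move=> x1; have x1' : 0 < 1 - x by lra.
  have l2 : is_derive x 1 (fun y : R => 1 - y) (0 - 1) by exact: is_deriveB.
  have := @is_derive1_comp _ (@ln R) (fun y : R => 1 - y) x _ _ (is_derive1_ln x1') l2.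
  by rewrite sub0r mulrN1.
have df (x : R) : x < 1 -> is_derive x 1 f (- (x ^+ n / (1 - x))).
  move=> x1.
  have -> : - (x ^+ n / (1 - x)) = - (1 - x)^-1 + \sum_(r < n) x ^+ r.
    have x1' : 1 - x != 0 by rewrite subr_eq0 gt_eqF.
    have := subrX1 x n; move: (\sum_(_ < _) _) => S e.
    apply: (mulIf x1'); rewrite mulrDl !mulNr mulVf// divfK//.
    by move: e; lra.
  exact: is_deriveD (dln _ x1) (is_derive_log_taylor n x).
have f0 : f 0 = 0.
  rewrite /f subr0 ln1 add0r /log_taylor big1// => r _.
  by rewrite expr0n mulr0.
have [c|c|c c0t fE] := @MVT_segment _ f (fun x => - (x ^+ n / (1 - x))) 0 t t0.
- by rewrite in_itv/= => /andP[_ ct]; apply: df; lra.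
- apply: derivable_within_continuous => x; rewrite in_itv/= => /andP[_ xt].
  by apply: (@ex_derive _ _ _ _ _ _ _ (df x _)); lra.
move: fE; rewrite f0 !subr0 -/(f t) => ->.
move: c0t; rewrite in_itv/= => /andP[c0 ct].
rewrite normrM normrN normrM normfV !ger0_norm ?exprn_ge0//; last by lra.
apply: (@le_trans _ _ (c ^+ n / (1 - c))).
  rewrite ler_piMr ?mulr_ge0 ?exprn_ge0 ?invr_ge0//; lra.
apply: ler_pM; rewrite ?exprn_ge0 ?invr_ge0//; first lra.
  by rewrite lerXn2r ?nnegrE//; lra.
by rewrite lef_pV2 ?posrE; lra.
Qed.

End log_series.

Section replicas.
Context d1 d2 (T : measurableType d1) (X : measurableType d2) (R : realType).
Variables (P : probability T R) (mu : {sigma_finite_measure set X -> \bar R}).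
Variables (E : finType) (c : E -> R) (V : X -> R) (good : set X).
Hypotheses (mV : measurable_fun setT V) (V0 : forall x, 0 <= V x).
Hypothesis V1 : (\int[mu]_x (V x)%:E = 1)%E.
Hypothesis V_good : forall x, ~ good x -> V x = 0.
Variables (G : E -> T -> X -> R) (alpha : R).
Hypothesis mG : forall e, measurable_fun setT (fun p : T * X => G e p.1 p.2).
Hypothesis G0 : forall e w x, 0 <= G e w x.
Hypothesis G_le : forall e w x, G e w x <= alpha.

(** In use, [e] is an edge, [V] is the Gibbs density, [G e w x] is the gap between [alpha] and the
    potential of [e] at the configuration [x], [c] are the signed weights of [split_defect], and
    [good] is the set of configurations inside [Omega], off which the density vanishes. *)
Definition gibbs_mean e w : R := fine (\int[mu]_x (G e w x * V x)%:E)%E.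

Let mGw e w : measurable_fun setT (G e w).
Proof. exact: (measurable_fun_pair2 w (mG e)). Qed.

Let GV_le e w : (\int[mu]_x (G e w x * V x)%:E <= alpha%:E)%E.
Proof.
have a0 : 0 <= alpha by exact: le_trans (G0 e w point) (G_le e w point).
rewrite -[leRHS]mule1 -V1 -ge0_integralZl//; first last.
- by move=> x _; rewrite lee_fin.
- exact/measurable_EFinP.
apply: ge0_le_integral => //.
- by move=> x _; rewrite lee_fin mulr_ge0.
- by apply/measurable_EFinP; exact: measurable_funM.
- by apply: measurable_funeM; exact/measurable_EFinP.
- by move=> x _; rewrite -EFinM lee_fin ler_wpM2r.
Qed.

Let GV_ge0 e w : (0 <= \int[mu]_x (G e w x * V x)%:E)%E.
Proof. by apply: integral_ge0 => x _; rewrite lee_fin mulr_ge0. Qed.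

Lemma gibbs_meanE e w :
  (\int[mu]_x (G e w x * V x)%:E)%E = (gibbs_mean e w)%:E.
Proof.
by rewrite fineK// ge0_fin_numE// (le_lt_trans (GV_le e w))// ltry.
Qed.

Lemma gibbs_mean_ge0 e w : 0 <= gibbs_mean e w.
Proof. exact: fine_ge0. Qed.

Lemma gibbs_mean_le e w : gibbs_mean e w <= alpha.
Proof. by rewrite -lee_fin -gibbs_meanE. Qed.

Lemma bmeas_gibbs_mean e : bounded_measurable (gibbs_mean e).
Proof.
split; last first.
  by exists alpha => w; rewrite ger0_norm ?gibbs_mean_ge0 ?gibbs_mean_le.
apply: (@measurableT_comp _ _ _ _ _ _ (@fine R)); first exact: fine_measurable.
apply: (@measurable_fun_fubini_tonelli_F _ _ _ _ _ mu
  (fun p : T * X => (G e p.1 p.2 * V p.2)%:E)).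
  apply/measurable_EFinP; apply: measurable_funM; first exact: mG.
  exact: (measurableT_comp mV measurable_snd).
by move=> p; rewrite lee_fin mulr_ge0.
Qed.

Let bG e x : bounded_measurable (fun w => G e w x).
Proof.
split; first exact: (measurable_fun_pair1 x (mG e)).
by exists alpha => w; rewrite ger0_norm.
Qed.

(** The weights [c] take both signs, so exchanging sum and integral relies on integrability rather
    than positivity. *)
Let weighted_integral_le0 (H : E -> X -> R) :
  (forall e, mu.-integrable setT (EFin \o H e)) ->
  (forall x, \sum_e c e * H e x <= 0) ->
  \sum_e c e * fine (\int[mu]_x (H e x)%:E)%E <= 0.
Proof.
move=> iH H0.
have S (s : seq E) :
    mu.-integrable setT (EFin \o (fun x => \sum_(e <- s) c e * H e x)) /\
    (\int[mu]_x (\sum_(e <- s) c e * H e x)%:E =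
     (\sum_(e <- s) c e * fine (\int[mu]_x (H e x)%:E))%:E)%E.
  elim: s => [|e s [iS eS]].
    split; last by rewrite big_nil integral0_eq// => x _; rewrite big_nil.
    rewrite (_ : _ \o _ = cst 0%E); first exact: integrable0.
    by apply/funext => x /=; rewrite big_nil.
  have ie : mu.-integrable setT (EFin \o (fun x => c e * H e x)).
    rewrite (_ : _ \o _ = (fun x => (c e)%:E * (H e x)%:E)%E).
      by apply: integrableZl; [exact: measurableT|exact: iH].
    by apply/funext => x /=; rewrite EFinM.
  split.
    have iD := integrableD measurableT ie iS.
    rewrite [X in mu.-integrable _ X](_ : _ = (fun x => (c e * H e x)%R%:E +
      (\sum_(e <- s) c e * H e x)%R%:E)%E)//.
    by apply/funext => x /=; rewrite big_cons EFinD.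
  transitivity (\int[mu]_x ((c e * H e x)%:E + (\sum_(e <- s) c e * H e x)%:E))%E.
    by apply: eq_integral => x _; rewrite big_cons EFinD.
  rewrite integralD// eS big_cons EFinD; congr (_ + _)%E.
  transitivity (\int[mu]_x ((c e)%:E * (H e x)%:E))%E; first by [].
  rewrite integralZl//; last exact: iH.
  by rewrite EFinM fineK//; exact: (integrable_fin_num _ (iH e)).
have [iS eS] := S (index_enum E).
rewrite -lee_fin -eS; apply: (@le_trans _ _ (\int[mu]_x cst 0 x)%E); last first.
  by rewrite integral0.
apply: le_integral => //.
  exact: integrable0.
by move=> x _; rewrite lee_fin.
Qed.

Hypothesis replicas : forall r (x : 'I_r -> X), (0 < r)%N ->
  (forall l, good (x l)) ->
  \sum_e c e * mean P (fun w => \prod_(l < r) G e w (x l)) <= 0.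

(* The powers of the Gibbs mean are traded for independent replicas, one
   integration over a replica at a time. *)
Lemma sum_gibbs_mean_le0 k : (0 < k)%N ->
  \sum_e c e * mean P (fun w => gibbs_mean e w ^+ k) <= 0.
Proof.
(* The induction is on [k] with [r] free: [r] replicas are already frozen at good configurations and
   [k] Gibbs means are still to be opened. The condition [0 < r + k] is preserved and becomes
   [0 < r] at the end. *)
move=> k0; suff : forall r (x : 'I_r -> X), (0 < r + k)%N ->
    (forall l, good (x l)) ->
    \sum_e c e * mean P (fun w =>
      (\prod_(l < r) G e w (x l)) * gibbs_mean e w ^+ k) <= 0.
  have no_replica : 'I_0 -> X by case.
  move=> /(_ 0%N no_replica k0) /= H.
  have <- : \sum_e c e * mean P (fun w =>
      (\prod_(l < 0) G e w (no_replica l)) * gibbs_mean e w ^+ k) =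
    \sum_e c e * mean P (fun w => gibbs_mean e w ^+ k).
    apply: eq_bigr => e _; congr (_ * mean _ _); apply/funext => w.
    by rewrite big_ord0 mul1r.
  by apply: H; case.
elim: k {k0} => [|k IHk] r x rk xg.
  rewrite addn0 in rk.
  have -> : \sum_e c e * mean P (fun w =>
      (\prod_(l < r) G e w (x l)) * gibbs_mean e w ^+ 0) =
    \sum_e c e * mean P (fun w => \prod_(l < r) G e w (x l)).
    apply: eq_bigr => e _; congr (_ * mean _ _); apply/funext => w.
    by rewrite expr0 mulr1.
  exact: replicas.
pose A e w := (\prod_(l < r) G e w (x l)) * gibbs_mean e w ^+ k.
have A0 e w : 0 <= A e w.
  by rewrite mulr_ge0 ?prodr_ge0// exprn_ge0// gibbs_mean_ge0.
have bA e : bounded_measurable (A e).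
  apply: bmeasM; last exact/bmeasX/bmeas_gibbs_mean.
  by apply: bmeas_prod => l; exact: bG.
pose H e y := mean P (fun w => A e w * G e w y) * V y.
have mAGV e : measurable_fun setT
    (fun p : T * X => (A e p.1 * (G e p.1 p.2 * V p.2))%:E).
  apply/measurable_EFinP; apply: measurable_funM.
    by have [mA _] := bA e; exact: (measurableT_comp mA measurable_fst).
  apply: measurable_funM; first exact: mG.
  exact: (measurableT_comp mV measurable_snd).
(* Tonelli takes the integral over the new replica [y] out of the expectation over [w]. *)
have eqH e : (\int[mu]_y (H e y)%:E =
    (mean P (fun w => A e w * gibbs_mean e w))%:E)%E.
  rewrite -mean_EFin; last exact: (bmeasM (bA e) (bmeas_gibbs_mean e)).
  transitivity (\int[P]_w \int[mu]_y (A e w * (G e w y * V y))%:E)%E; last first.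
    apply: eq_integral => w _; rewrite EFinM -gibbs_meanE -ge0_integralZl//.
    - by apply/measurable_EFinP; exact: measurable_funM.
    - by move=> y _; rewrite lee_fin mulr_ge0.
    - by rewrite lee_fin.
  rewrite (fubini_tonelli
    (fun p : T * X => (A e p.1 * (G e p.1 p.2 * V p.2))%:E) (mAGV e)); last first.
    by move=> p; rewrite lee_fin (mulr_ge0 (A0 _ _))// mulr_ge0.
  apply: eq_integral => y _; rewrite /H mulrC EFinM -mean_EFin; last exact: bmeasM.
  rewrite -ge0_integralZl//.
  - by apply: eq_integral => w _; rewrite -EFinM; congr EFin; rewrite /=; ring.
  - by apply/measurable_EFinP; have [] := bmeasM (bA e) (bG e y).
  - by move=> w _; rewrite lee_fin mulr_ge0.
  - by rewrite lee_fin.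
have H0 e y : 0 <= H e y.
  rewrite /H mulr_ge0// -(mean_cst P 0); apply: le_mean.
  - exact: bmeas_cst.
  - exact: bmeasM.
  - by move=> w; rewrite mulr_ge0.
have iH e : mu.-integrable setT (EFin \o H e).
  apply/integrableP; split.
    apply/measurable_EFinP; apply: measurable_funM => //.
    have bAG : bounded_measurable (fun p : T * X => A e p.1 * G e p.1 p.2).
      apply: bmeasM; first exact: (bmeas_comp measurable_fst (bA e)).
      by split; [exact: mG|exists alpha => p; rewrite ger0_norm].
    by have [] := @bmeas_mean2 _ _ _ _ _ P (fun y w => A e w * G e w y)
      (bmeas_swap bAG).
  under eq_integral do rewrite /= ger0_norm//.
  by rewrite eqH ltry.
have -> : \sum_e c e * mean P (fun w =>
    (\prod_(l < r) G e w (x l)) * gibbs_mean e w ^+ k.+1) =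
  \sum_e c e * fine (\int[mu]_y (H e y)%:E)%E.
  apply: eq_bigr => e _; rewrite eqH; congr (_ * mean _ _).
  by apply/funext => w; rewrite /A exprSr mulrA.
apply: weighted_integral_le0 => // y.
have [yg|ny] := pselect (good y); last first.
  by rewrite big1// => e _; rewrite /H V_good// !mulr0.
rewrite (eq_bigr (fun e => c e * mean P (fun w => A e w * G e w y) * V y)) => [|e _]; last first.
  by rewrite /H mulrA.
rewrite -mulr_suml; apply: mulr_le0_ge0 => //.
pose x' (i : 'I_r.+1) := if unlift ord0 i is Some j then x j else y.
have := IHk r.+1 x' isT; rewrite /x'.
have -> : \sum_e c e * mean P (fun w =>
    (\prod_(l < r.+1) G e w (x' l)) * gibbs_mean e w ^+ k) =
  \sum_e c e * mean P (fun w => A e w * G e w y).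
  apply: eq_bigr => e _; congr (_ * mean _ _); apply/funext => w.
  rewrite big_ord_recl /x' unlift_none /A mulrC mulrA mulrAC; congr (_ * _).
  rewrite mulrC; congr (_ * _).
  by apply: eq_bigr => l _; rewrite liftK.
by apply => l; rewrite /x'; case: (unliftP ord0 l).
Qed.

End replicas.

Section near_superadditive.
Context (R : realType) (a : nat -> R) (B C : R).
Hypothesis C_ge0 : 0 <= C.
Hypothesis superadd : forall m n, (m <= n)%N ->
  a m + a n - C * Num.sqrt m.+1%:R <= a (m + n.+1)%N.
Hypothesis a_le : forall n, a n <= B * n.+1%:R.

(** Index [k] stands for [k.+1] nodes, so blocks [m] and [n] join into [m + n.+1]. The net
    contribution of a block of [m.+1] nodes each time one is split off is [b m]. *)
Let b m : R := a m - C * Num.sqrt m.+1%:R.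

(** Blocks of [m.+1] nodes are split off as long as the remainder is at least as large, each
    contributing [b m]; this works from [(m.+1).*2] on. *)
Lemma superadditive_minorant m :
  exists E, forall n, n.+1%:R / m.+1%:R * b m - E <= a n.
Proof.
(* The sum dominates each of the finitely many initial discrepancies, which is the base of the
   induction. *)
pose E : R := \sum_(n < (m.+1).*2) `|n.+1%:R / m.+1%:R * b m - a n|.
exists E; elim/ltn_ind => n IHn.
have [nm|mn] := ltnP n (m.+1).*2.
  have : n.+1%:R / m.+1%:R * b m - a n <= E.
    rewrite /E (bigD1 (Ordinal nm))//=.
    by apply: (le_trans (ler_norm _)); rewrite lerDl sumr_ge0.
  by move=> h; rewrite lerBlDr addrC -lerBlDr.
pose k := (n - m.+1)%N.
have nE : n = (m + k.+1)%N by rewrite /k addnS -addSn subnKC//; rewrite -addnn in mn; lia.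
have mk : (m <= k)%N by rewrite /k; rewrite -addnn in mn; lia.
have kn : (k < n)%N by rewrite nE; lia.
apply: le_trans (_ : b m + a k <= _); last first.
  by rewrite [in leRHS]nE; have := superadd mk; rewrite /b; lra.
have := IHn k kn; set x := k.+1%:R / _ * _.
have -> : n.+1%:R / m.+1%:R * b m = b m + x.
  rewrite /x nE -addSn natrD mulrDl divff ?pnatr_eq0// mulrDl mul1r//.
lra.
Qed.

(** The limit is the supremum of [b m / m.+1%:R]. From above, [a n] exceeds [b n] by a term of order
    [sqrt n] only; from below, the minorant of a nearly optimal [m] loses its constant after
    division by [n.+1]. *)
Lemma near_superadditive_cvg :
  exists z : R, (fun n => n.+1%:R^-1 * a n) @ \oo --> z.
Proof.
pose S := [set b m / m.+1%:R | m in [set: nat]].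
have supS : has_sup S.
  split; first by exists (b 0 / 1%:R), 0%N.
  exists B => _ [m _ <-]; rewrite ler_pdivrMr//.
  by apply: le_trans (a_le m); rewrite /b gerBl mulr_ge0// sqrtr_ge0.
exists (sup S); apply/cvgrPdist_le => /= eps eps0.
have e2 : 0 < eps / 2 by rewrite divr_gt0.
have [_ [m _ <-] mS] := sup_adherent e2 supS.
have [E HE] := superadditive_minorant m.
near=> n.
have n0 : 0 < n.+1%:R :> R by [].
have upper : n.+1%:R^-1 * a n <= sup S + eps.
  have : b n / n.+1%:R <= sup S by apply: ub_le_sup; [exact: supS.2|exists n].
  have : C * Num.sqrt n.+1%:R / n.+1%:R <= eps.
    rewrite ler_pdivrMr// -{2}(sqr_sqrtr (ltW n0)) expr2 mulrA.
    apply: ler_wpM2r; first exact: sqrtr_ge0.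
    rewrite mulrC -ler_pdivrMr// -(ler_pXn2r (n := 2))// ?nnegrE ?sqrtr_ge0//.
      rewrite sqr_sqrtr// ltW//; apply: (@lt_trans _ _ n%:R); last by rewrite ltr_nat.
      by near: n; exact: nbhs_infty_gtr.
    by rewrite divr_ge0// ltW.
  rewrite /b mulrBl [n.+1%:R^-1 * _]mulrC => h1 h2.
  by rewrite -lerBlDr; apply: le_trans h2; rewrite lerD2l lerN2.
have lower : sup S - eps <= n.+1%:R^-1 * a n.
  have : n.+1%:R^-1 * (n.+1%:R / m.+1%:R * b m - E) <= n.+1%:R^-1 * a n.
    by apply: ler_wpM2l => //; rewrite invr_ge0.
  rewrite mulrBr mulrA mulrA mulVf// mul1r => h.
  have : n.+1%:R^-1 * E <= eps / 2.
    rewrite mulrC ler_pdivrMr// mulrC -ler_pdivrMr// ltW//.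
    apply: (@lt_trans _ _ n%:R); last by rewrite ltr_nat.
    by near: n; exact: nbhs_infty_gtr.
  rewrite [_^-1 * b m]mulrC in h => hE.
  rewrite (splitr eps) opprD addrA lerBlDr.
  apply: (le_trans (ltW mS)); rewrite -lerBlDr.
  by apply: le_trans h; rewrite lerD2l lerN2.
by rewrite ler_distlC lower upper.
Unshelve. all: by end_near.
Qed.

End near_superadditive.

(** * Null events, Chebyshev's inequality and integration over one coordinate *)

Section lne.
Context (R : realType).

Lemma measurable_lne : measurable_fun [set: \bar R] (@lne R).
Proof.
rewrite (_ : @lne R = fun x => if x == +oo%E then +oo%E else
    if fine x <= 0 then -oo%E else (ln (fine x))%:E); last first.
  by apply/funext => -[r| |] //=; rewrite lexx.
apply: measurable_fun_ifT.
- apply: (measurable_fun_bool true); rewrite setTI.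
  rewrite (_ : _ @^-1` _ = [set +oo%E]); first exact: emeasurable_set1.
  by apply/seteqP; split => x /= /eqP.
- exact: measurable_cst.
apply: measurable_fun_ifT.
- by apply: measurable_fun_ler; [exact: fine_measurable|exact: measurable_cst].
- exact: measurable_cst.
apply/measurable_EFinP; apply: measurableT_comp; first exact: measurable_ln.
exact: fine_measurable.
Qed.

End lne.

Section null_coordinates.
Context d (T : measurableType d) (R : realType) (P : probability T R).

Lemma iid_law_null (N : set T) n : measurable N -> P N = 0%E ->
  measurable [set t : n.-tuple T | exists i, N (tnth t i)] /\
  iid_law P n [set t : n.-tuple T | exists i, N (tnth t i)] = 0%E.
Proof.
move=> mN PN.
have mB (i : 'I_n) : measurable [set t : n.-tuple T | N (tnth t i)].
  by rewrite -[X in measurable X]setTI; exact: (@measurable_tnth _ T n i).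
have UE : [set t : n.-tuple T | exists i, N (tnth t i)] =
    ~` [set t : n.-tuple T | forall i, (~` N) (tnth t i)].
  apply/seteqP; split => t /= => [[i Ni] /(_ i)//|].
  by move=> /existsNP[i /contrapT Ni]; exists i.
have mG : measurable [set t : n.-tuple T | forall i, (~` N) (tnth t i)].
  rewrite (_ : [set _ | _] = \bigcap_(i in [set: 'I_n]) ~` [set t : n.-tuple T | N (tnth t i)]).
    by apply: fin_bigcap_measurable => // i _; exact: measurableC.
  by apply/seteqP; split => t /= => [H i _|H i]; [exact: H|exact: (H i I)].
split; first by rewrite UE; exact: measurableC.
rewrite UE (probability_setC (iid_law P n) mG).
have mNC : measurable (~` N) by exact: measurableC.
have := @product_powerE _ T R P n (fun=> ~` N) (fun=> mNC).
have PNC : P (~` N) = 1%E.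
  by have := probability_setC P mN; rewrite PN sube0.
rewrite big1 => [e|i _]; last exact: PNC.
transitivity (1 - 1 : \bar R)%E; last exact: subee.
by congr (_ - _)%E; exact: e.
Qed.

End null_coordinates.

Section chebyshev.
Context d (T : measurableType d) (R : realType) (P : probability T R).

Lemma measurable_deviation (X : T -> R) (z t : R) :
  measurable_fun [set: T] X -> measurable [set w | t < `|X w - z|].
Proof.
move=> mX; rewrite -[X in measurable X]setTI.
have mf : measurable_fun [set: T] (fun w => `|X w - z|).
  by apply: measurableT_comp => //; exact: measurable_funB.
have := measurable_fun_ltr (@measurable_cst _ _ T (measurableTypeR R) setT t) mf.
by move=> /(_ measurableT [set true] I); exact.
Qed.

(** The center [z] is only known to be within [t] of the mean: a deviation of [2 * t] from [z]
    forces one of at least [t] from the mean. *)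
Lemma chebyshev_near (X : T -> R) (z t : R) : bounded_measurable X -> 0 < t ->
  `|mean P X - z| <= t ->
  (P [set w | (2 * t < `|X w - z|)%R] <=
   (t ^- 2 * (mean P (fun w => X w ^+ 2) - mean P X ^+ 2))%:E)%E.
Proof.
move=> bX t0 Xz; set A := [set w | _].
have mA : measurable A by apply: measurable_deviation; case: bX.
have bA : bounded_measurable (\1_A : T -> R).
  split; first exact: measurable_indic.
  by exists 1 => w; rewrite indicE normr_nat lern1 leq_b1.
have -> : P A = (mean P \1_A)%:E.
  by rewrite -mean_EFin// integral_indic// setIT.
set a := mean P X in Xz *.
have b2 : bounded_measurable (fun w => t ^- 2 * (X w - a) ^+ 2).
  exact: (bmeasM (bmeas_cst _) (bmeasX 2 (bmeasB bX (bmeas_cst a)))).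
have -> : t ^- 2 * (mean P (fun w => X w ^+ 2) - a ^+ 2) =
    mean P (fun w => t ^- 2 * (X w - a) ^+ 2).
  rewrite (meanZ _ _ (bmeasX 2 (bmeasB bX (bmeas_cst a)))); congr (_ * _).
  rewrite (_ : (fun w => (X w - a) ^+ 2) =
      fun w => X w ^+ 2 - ((2 * a) * X w - a ^+ 2)); last first.
    by apply/funext => w; ring.
  rewrite (meanB _ (bmeasX 2 bX)); last first.
    exact: (bmeasB (bmeasM (bmeas_cst _) bX) (bmeas_cst _)).
  rewrite (meanB _ (bmeasM (bmeas_cst _) bX) (bmeas_cst _)) meanZ// mean_cst.
  by rewrite -/a; ring.
rewrite lee_fin; apply: le_mean => // w; rewrite indicE.
case: (boolP (w \in A)) => [|_] /=; last by rewrite mulr_ge0 ?sqr_ge0// invr_ge0 sqr_ge0.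
rewrite inE /A /= => Aw.
have tX : t <= `|X w - a|.
  have := ler_distD a (X w) z; rewrite -/a; lra.
rewrite mulrC ler_pdivlMr ?exprn_gt0// mul1r -[leRHS]real_normK ?num_real//.
by apply: lerXn2r => //; rewrite nnegrE ltW.
Qed.

End chebyshev.

Section coordinatewise.
Context d (T : measurableType d) (R : realType).
Variable mu : {sigma_finite_measure set T -> \bar R}.

Definition set_coord n (u : 'I_n) (y : T) (x : n.-tuple T) : n.-tuple T :=
  [tuple if v == u then y else tnth x v | v < n].

Lemma tnth_set_coord n (u : 'I_n) y x v :
  tnth (set_coord u y x) v = if v == u then y else tnth x v.
Proof. by rewrite tnth_mktuple. Qed.

Lemma set_coord0 n y x (t : n.-tuple T) :
  set_coord ord0 y (tuple_cons (x, t)) = tuple_cons (y, t).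
Proof.
apply: eq_from_tnth => v; rewrite tnth_set_coord.
by case: (unliftP ord0 v) => [w ->|->]; rewrite ?tnthS ?tnth0 ?eqxx.
Qed.

Lemma set_coordS n (u : 'I_n) y x (t : n.-tuple T) :
  set_coord (lift ord0 u) y (tuple_cons (x, t)) =
  tuple_cons (x, set_coord u y t).
Proof.
apply: eq_from_tnth => v; rewrite tnth_set_coord.
case: (unliftP ord0 v) => [w ->|->]; last by rewrite !tnth0.
by rewrite (inj_eq lift_inj) !tnthS tnth_set_coord.
Qed.

Local Open Scope ereal_scope.

(** By Tonelli the coordinate [u] can be integrated with all others frozen; this reduces bounds on
    the partition function to one-dimensional integrals. *)
Lemma le_integral_coord n (u : 'I_n) (c : R) (F G : n.-tuple T -> \bar R) :
  (0 <= c)%R -> measurable_fun setT F -> measurable_fun setT G ->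
  (forall x, 0 <= F x) -> (forall x, 0 <= G x) ->
  (forall x, \int[mu]_y F (set_coord u y x) <=
             c%:E * \int[mu]_y G (set_coord u y x)) ->
  \int[product_power mu n]_x F x <= c%:E * \int[product_power mu n]_x G x.
Proof.
move=> c0; elim: n u F G => [[//]|n IHn] u F G mF mG F0 G0 FG.
rewrite !integral_product_powerS//.
have mcons (H : n.+1.-tuple T -> \bar R) : measurable_fun setT H ->
    measurable_fun setT (fun p : T * n.-tuple T => H (tuple_cons (p.1, p.2))).
  move=> mH; exact: (measurableT_comp mH (@measurable_uncurry_cons _ T n)).
have mint (H : n.+1.-tuple T -> \bar R) : measurable_fun setT H ->
    (forall x, 0 <= H x) ->
    measurable_fun setT (fun x => \int[product_power mu n]_t H (tuple_cons (x, t))).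
  by move=> mH H0; exact: (@measurable_fun_fubini_tonelli_F _ _ _ _ _
    (product_power mu n) (fun p => H (tuple_cons (p.1, p.2))) (mcons _ mH)).
case: (unliftP ord0 u) FG => [v ->|->] FG.
- rewrite -ge0_integralZl//; last first.
  + by move=> x _; exact: integral_ge0.
  + exact: mint.
  apply: ge0_le_integral => //.
  + by move=> x _; exact: integral_ge0.
  + exact: mint.
  + exact/measurable_funeM/mint.
  move=> x _; apply: (IHn v) => //.
  + exact: (measurable_fun_pair2 x (mcons _ mF)).
  + exact: (measurable_fun_pair2 x (mcons _ mG)).
  move=> t; have := FG (tuple_cons (x, t)).
  by under eq_integral do rewrite set_coordS;
    under [X in _ <= _ * X -> _]eq_integral do rewrite set_coordS.
- rewrite (fubini_tonelli (fun p : T * n.-tuple T => F (tuple_cons (p.1, p.2))) (mcons _ mF))//.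
  rewrite (fubini_tonelli (fun p : T * n.-tuple T => G (tuple_cons (p.1, p.2))) (mcons _ mG))//.
  have mint2 (H : n.+1.-tuple T -> \bar R) : measurable_fun setT H ->
      (forall x, 0 <= H x) ->
      measurable_fun setT (fun t => \int[mu]_x H (tuple_cons (x, t))).
    by move=> mH H0; exact: (@measurable_fun_fubini_tonelli_G _ _ _ _ _
      mu (fun p => H (tuple_cons (p.1, p.2))) (mcons _ mH)).
  rewrite -ge0_integralZl//; last first.
  + by move=> x _; exact: integral_ge0.
  + exact: mint2.
  apply: ge0_le_integral => //.
  + by move=> x _; exact: integral_ge0.
  + exact: mint2.
  + exact: (measurable_funeM _ (mint2 _ mG G0)).
  (* The value [point] is irrelevant: [set_coord] overwrites the first coordinate. *)
  move=> t _; have := FG (tuple_cons (point, t)).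
  by under eq_integral do rewrite set_coord0;
    under [X in _ <= _ * X -> _]eq_integral do rewrite set_coord0.
Qed.

Lemma integral_product_power_prod n (f : 'I_n -> T -> \bar R) :
  (forall i, measurable_fun setT (f i)) -> (forall i x, 0 <= f i x) ->
  \int[product_power mu n]_x \prod_(i < n) f i (tnth x i) =
  \prod_(i < n) \int[mu]_x f i x.
Proof.
have mp m (g : 'I_m -> T -> \bar R) : (forall i, measurable_fun setT (g i)) ->
    measurable_fun setT (fun x : m.-tuple T => \prod_(i < m) g i (tnth x i)).
  move=> mg; elim: (index_enum _) => [|i s IHs].
    by under eq_fun do rewrite big_nil; exact: measurable_cst.
  under eq_fun do rewrite big_cons; apply: emeasurable_funM => //.
  exact: (measurableT_comp (mg i) (@measurable_tnth _ T m i)).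
elim: n f => [|n IHn] f mf f0.
  by rewrite integral_product_power0 ?big_ord0//; exact: mp.
rewrite integral_product_powerS//; last 2 first.
- exact: mp.
- by move=> t; exact: prode_ge0.
rewrite big_ord_recl -IHn//.
have I0 : 0 <= \int[product_power mu n]_x
    \prod_(i < n) f (lift ord0 i) (tnth x i).
  by apply: integral_ge0 => x _; exact: prode_ge0.
transitivity (\int[mu]_x (f ord0 x * \int[product_power mu n]_t
    \prod_(i < n) f (lift ord0 i) (tnth t i))).
  apply: eq_integral => x _; rewrite -ge0_integralZl//.
  - apply: eq_integral => t _; rewrite big_ord_recl tnth0; congr (_ * _).
    by apply: eq_bigr => i _; rewrite tnthS.
  - by apply: (mp n (fun i => f (lift ord0 i))).
  - by move=> t _; exact: prode_ge0.
under eq_integral do rewrite muleC.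
rewrite ge0_integralZl//; first by rewrite muleC.
Qed.

End coordinatewise.

(** * The partition function and its interpolation *)

Section model.
Context (R : realType) (K : nat) (dh dJ : measure_display).
Context (Th : measurableType dh) (TJ : measurableType dJ).
Variables (h : Th -> R -> R) (J : TJ -> K.-tuple R -> R).
Hypotheses (random_h : random_node_potential h)
  (random_J : random_edge_potential J).

Local Notation mR := (measurableTypeR R).
Local Notation edge n := (K.-tuple 'I_n.+1).

(** The graph is a list of edges, each with the randomness of its potential, so that adding an edge
    is a cons. *)
Definition edge_weight N (l : seq (K.-tuple 'I_N * TJ)) (x : N.-tuple mR) : R :=
  \prod_(p <- l) J p.2 [tuple of map (tnth x) p.1].

Definition node_weight N (wh : N.-tuple Th) (x : N.-tuple mR) : R :=
  \prod_(u < N) h (tnth wh u) (tnth x u).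

Definition weight N (wh : N.-tuple Th) l (x : N.-tuple mR) : R :=
  node_weight wh x * edge_weight l x.

Definition sample_partition N (wh : N.-tuple Th) l : \bar R :=
  (\int[lebesgue_measure_tuple R N]_x (weight wh l x)%:E)%E.

Lemma h_ge0 w x : 0 <= h w x. Proof. by have [+ _] := random_h. Qed.

Lemma J_ge0 w x : 0 <= J w x. Proof. by have [+ _] := random_J. Qed.

Lemma edge_weight_ge0 N l (x : N.-tuple mR) : 0 <= edge_weight l x.
Proof. by apply: prodr_ge0 => p _; exact: J_ge0. Qed.

Lemma node_weight_ge0 N (wh : N.-tuple Th) x : 0 <= node_weight wh x.
Proof. by apply: prodr_ge0 => p _; exact: h_ge0. Qed.

Lemma weight_ge0 N (wh : N.-tuple Th) l x : 0 <= weight wh l x.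
Proof. by rewrite mulr_ge0 ?node_weight_ge0 ?edge_weight_ge0. Qed.

Lemma measurable_gather N (e : K.-tuple 'I_N) :
  measurable_fun setT (fun x : N.-tuple mR => [tuple of map (tnth x) e] : K.-tuple mR).
Proof.
apply/measurable_fun_tnthP => k.
rewrite (_ : _ \o _ = fun x : N.-tuple mR => tnth x (tnth e k)).
  exact: measurable_tnth.
by apply/funext => x /=; rewrite tnth_map.
Qed.

Lemma measurable_edge_potential n :
  measurable_fun setT (fun p : (edge n * TJ) * (n.+1).-tuple mR =>
    J p.1.2 [tuple of map (tnth p.2) p.1.1]).
Proof.
have [_ mJ] := random_J.
have mJe (e : edge n) : measurable_fun setT (fun p : TJ * (n.+1).-tuple mR =>
    J p.1 [tuple of map (tnth p.2) e]).
  apply: (@measurableT_comp _ _ _ _ _ _ (fun p : TJ * K.-tuple mR => J p.1 p.2)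
    _ (fun p : TJ * (n.+1).-tuple mR => (p.1, [tuple of map (tnth p.2) e] : K.-tuple mR))).
    exact: mJ.
  apply: measurable_fun_pair; first exact: measurable_fst.
  exact: (measurableT_comp (measurable_gather e) measurable_snd).
apply: (@measurableT_comp _ _ _ _ _ _
  (fun q : edge n * (TJ * (n.+1).-tuple mR) =>
    J q.2.1 [tuple of map (tnth q.2.2) q.1])
  _ (fun p : (edge n * TJ) * (n.+1).-tuple mR => (p.1.1, (p.1.2, p.2)))).
  exact: (measurable_edge_pair mJe).
apply: measurable_fun_pair.
  exact: (measurableT_comp measurable_fst measurable_fst).
apply: measurable_fun_pair; last exact: measurable_snd.
exact: (measurableT_comp measurable_snd measurable_fst).
Qed.

Lemma measurable_edge_weight n m :
  measurable_fun setT (fun p : m.-tuple (edge n * TJ) * (n.+1).-tuple mR =>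
    edge_weight p.1 p.2).
Proof.
rewrite (_ : (fun _ => _) = (fun p : m.-tuple (edge n * TJ) * (n.+1).-tuple mR =>
    \prod_(i < m) J (tnth p.1 i).2 [tuple of map (tnth p.2) (tnth p.1 i).1])); last first.
  by apply/funext => p; rewrite /edge_weight big_tuple.
apply: measurable_prod => i _.
apply: (measurableT_comp (@measurable_edge_potential n)
  (g := fun p : m.-tuple (edge n * TJ) * (n.+1).-tuple mR => (tnth p.1 i, p.2))).
apply: measurable_fun_pair; last exact: measurable_snd.
exact: (measurableT_comp (@measurable_tnth _ _ m i) measurable_fst).
Qed.

Lemma measurable_node_weight N :
  measurable_fun setT (fun p : N.-tuple Th * N.-tuple mR => node_weight p.1 p.2).
Proof.
have [_ mh] := random_h.
apply: measurable_prod => i _.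
apply: (measurableT_comp mh
  (g := fun p : N.-tuple Th * N.-tuple mR => (tnth p.1 i, tnth p.2 i))).
apply: measurable_fun_pair.
  exact: (measurableT_comp (@measurable_tnth _ _ N i) measurable_fst).
exact: (measurableT_comp (@measurable_tnth _ _ N i) measurable_snd).
Qed.

Lemma measurable_weight3 n m :
  measurable_fun setT (fun p : ((n.+1).-tuple Th * m.-tuple (edge n * TJ)) *
    (n.+1).-tuple mR => weight p.1.1 p.1.2 p.2).
Proof.
apply: measurable_funM.
  apply: (measurableT_comp (@measurable_node_weight n.+1)
    (g := fun p : ((n.+1).-tuple Th * m.-tuple (edge n * TJ)) *
      (n.+1).-tuple mR => (p.1.1, p.2))).
  apply: measurable_fun_pair; last exact: measurable_snd.
  exact: (measurableT_comp measurable_fst measurable_fst).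
apply: (measurableT_comp (@measurable_edge_weight n m)
  (g := fun p : ((n.+1).-tuple Th * m.-tuple (edge n * TJ)) *
    (n.+1).-tuple mR => (p.1.2, p.2))).
apply: measurable_fun_pair; last exact: measurable_snd.
exact: (measurableT_comp measurable_snd measurable_fst).
Qed.

Lemma measurable_weight n (wh : (n.+1).-tuple Th) (l : seq (edge n * TJ)) :
  measurable_fun setT (fun x : (n.+1).-tuple mR => weight wh l x).
Proof. exact: (measurable_fun_pair2 (wh, in_tuple l) (@measurable_weight3 n (size l))). Qed.

Lemma measurable_sample_partition n m :
  measurable_fun setT (fun p : (n.+1).-tuple Th * m.-tuple (edge n * TJ) =>
    sample_partition p.1 p.2).
Proof.
apply: (@measurable_fun_fubini_tonelli_F _ _ _ _ _ (lebesgue_measure_tuple R n.+1)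
  (fun p : ((n.+1).-tuple Th * m.-tuple (edge n * TJ)) * (n.+1).-tuple mR =>
    (weight p.1.1 p.1.2 p.2)%:E)).
  by apply/measurable_EFinP; exact: measurable_weight3.
by move=> p; rewrite lee_fin weight_ge0.
Qed.

(** * Effect of one node or one edge, under hypotheses that hold surely *)

Variables (kappa rho_min rho_max : R) (Omega : set R).
Hypotheses (rho_min_gt0 : 0 < rho_min) (rho_min_le : rho_min <= rho_max).
Hypothesis Omega_itv : forall x, x \in `[0, kappa[ -> Omega x.
Hypothesis h_support : forall w x, ~ Omega x -> h w x = 0.
Hypothesis h_mass_ge : forall w, (rho_min%:E <=
  \int[@lebesgue_measure R]_x (h w x * (x \in `[0, kappa[)%:R)%:E)%E.
Hypothesis h_mass_le : forall w,
  (\int[@lebesgue_measure R]_x (h w x)%:E <= rho_max%:E)%E.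
Hypothesis J_le : forall w x, J w x <= rho_max.
Hypothesis J_ge : forall (i : 'I_K) w x, tnth x i \in `[0, kappa[ ->
  (forall k, Omega (tnth x k)) -> rho_min <= J w x.

(** An edge visiting [u] several times counts once, since it contributes a single factor [J]. *)
Definition degree n (l : seq (edge n * TJ)) (u : 'I_n.+1) : nat :=
  count (fun p => u \in p.1) l.

Let rho_max_gt0 : 0 < rho_max. Proof. exact: lt_le_trans rho_min_le. Qed.

Let ratio := rho_max / rho_min.

Let ratio_ge1 : 1 <= ratio. Proof. by rewrite ler_pdivlMr// mul1r. Qed.

Definition edge_weight_off n (u : 'I_n.+1) (l : seq (edge n * TJ))
    (x : (n.+1).-tuple mR) : R :=
  \prod_(p <- l | u \notin p.1) J p.2 [tuple of map (tnth x) p.1].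

Lemma map_set_coord_off n (u : 'I_n.+1) y (x : (n.+1).-tuple mR) (e : edge n) :
  u \notin e -> [tuple of map (tnth (set_coord u y x)) e] =
                [tuple of map (tnth x) e].
Proof.
move=> ue; apply: eq_from_tnth => k; rewrite [LHS]tnth_map [RHS]tnth_map tnth_set_coord ifN//.
by apply: contraNneq ue => <-; exact: mem_tnth.
Qed.

Lemma edge_weight_set_coord_le n (u : 'I_n.+1) y x (l : seq (edge n * TJ)) :
  edge_weight l (set_coord u y x) <=
  edge_weight_off u l x * rho_max ^+ degree l u.
Proof.
rewrite /edge_weight /edge_weight_off; elim: l => [|p l IHl].
  by rewrite !big_nil mul1r.
rewrite !big_cons /=; have [up|up] := boolP (u \in p.1) => /=.
  rewrite add1n exprSr mulrA [leRHS]mulrC.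
  by apply: ler_pM => //; [exact: J_ge0|exact: (edge_weight_ge0 l)].
rewrite add0n -mulrA map_set_coord_off//; apply: ler_wpM2l => //; exact: J_ge0.
Qed.

Lemma edge_weight_set_coord_ge n (u : 'I_n.+1) y x (l : seq (edge n * TJ)) :
  y \in `[0, kappa[ -> (forall v, v != u -> Omega (tnth x v)) ->
  edge_weight_off u l x * rho_min ^+ degree l u <=
  edge_weight l (set_coord u y x).
Proof.
move=> yk xO; rewrite /edge_weight /edge_weight_off; elim: l => [|p l IHl].
  by rewrite !big_nil mul1r.
have off0 : 0 <= \prod_(q <- l | u \notin q.1) J q.2 [tuple of map (tnth x) q.1].
  by apply: prodr_ge0 => q _; exact: J_ge0.
rewrite !big_cons /=; have [up|up] := boolP (u \in p.1) => /=.
  rewrite add1n exprSr mulrA [leLHS]mulrC; apply: ler_pM => //.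
  - exact: ltW.
  - by rewrite mulr_ge0// exprn_ge0// ltW.
  - have /tnthP[k ek] := up.
    apply: (J_ge (i := k)); first by rewrite tnth_map -ek tnth_set_coord eqxx.
    move=> j; rewrite tnth_map tnth_set_coord; case: ifPn => [_|]; last exact: xO.
    exact: Omega_itv.
rewrite add0n -mulrA map_set_coord_off//; apply: ler_wpM2l => //; exact: J_ge0.
Qed.

Lemma node_weight_set_coord N (u : 'I_N) (wh : N.-tuple Th) y x :
  node_weight wh (set_coord u y x) =
  h (tnth wh u) y * \prod_(v < N | v != u) h (tnth wh v) (tnth x v).
Proof.
rewrite /node_weight (bigD1 u)//= tnth_set_coord eqxx; congr (_ * _).
by apply: eq_bigr => v vu; rewrite tnth_set_coord (negbTE vu).
Qed.

Lemma measurable_h w : measurable_fun [set: mR] (h w).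
Proof. by have [_ mh] := random_h; exact: (measurable_fun_pair2 w mh). Qed.

Lemma measurable_near0 : measurable_fun [set: mR] (fun x : mR => (x \in `[0, kappa[)%:R : R).
Proof.
rewrite (_ : (fun _ => _) = \1_(`[0, kappa[%classic : set mR)).
  by apply: measurable_indic; exact: measurable_itv.
by apply/funext => x; rewrite indicE mem_setE.
Qed.

Lemma measurable_weight_near0 n (u : 'I_n.+1) wh (l : seq (edge n * TJ)) :
  measurable_fun setT (fun x : (n.+1).-tuple mR =>
    weight wh l x * (tnth x u \in `[0, kappa[)%:R).
Proof.
apply: measurable_funM; first exact: measurable_weight.
exact: (measurableT_comp measurable_near0 (@measurable_tnth _ _ n.+1 u)).
Qed.

(* Conditionally on the other coordinates, the density of the coordinate of a
   node of degree [d] integrates to at most [rho_max ^+ d.+1] and, on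
   [0, kappa[ alone, to at least [rho_min ^+ d.+1], up to a common factor. *)
Lemma sample_partition_le_near0 n (u : 'I_n.+1) (wh wh' : (n.+1).-tuple Th) l :
  (forall v, v != u -> tnth wh v = tnth wh' v) ->
  (sample_partition wh l <= (ratio ^+ (degree l u).+1)%:E *
    \int[lebesgue_measure_tuple R n.+1]_x
      (weight wh' l x * (tnth x u \in `[0, kappa[)%:R)%:E)%E.
Proof.
move=> whwh'; apply: (@le_integral_coord _ _ _ _ _ u).
- by rewrite exprn_ge0// (le_trans ler01).
- by apply/measurable_EFinP; exact: measurable_weight.
- by apply/measurable_EFinP; exact: measurable_weight_near0.
- by move=> x; rewrite lee_fin weight_ge0.
- by move=> x; rewrite lee_fin mulr_ge0// weight_ge0.
move=> x; pose N' := \prod_(v < n.+1 | v != u) h (tnth wh v) (tnth x v).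
have N'E : \prod_(v < n.+1 | v != u) h (tnth wh' v) (tnth x v) = N'.
  by apply: eq_bigr => v vu; rewrite whwh'.
have N'0 : 0 <= N' by apply: prodr_ge0 => v _; exact: h_ge0.
(* If another coordinate leaves [Omega], its node potential kills both integrands; otherwise the
   lower bound on [J] holds for all edges through [u] once its coordinate is in [0, kappa[. *)
have [xO|] := pselect (forall v, v != u -> Omega (tnth x v)); last first.
  move=> /existsNP[v /not_implyP[vu xv]].
  have N'z : N' = 0 by rewrite /N' (bigD1 v)//= h_support ?mul0r.
  have W0 wh0 y : (\prod_(v < n.+1 | v != u) h (tnth wh0 v) (tnth x v)) = N' ->
      weight wh0 l (set_coord u y x) = 0.
    by move=> e; rewrite /weight node_weight_set_coord e N'z mulr0 mul0r.
  rewrite integral0_eq; last by move=> y _; rewrite W0.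
  by rewrite integral0_eq ?mule0// => y _; rewrite W0 ?mul0r.
set D := degree l u; pose C := N' * edge_weight_off u l x.
have C0 : 0 <= C by rewrite mulr_ge0// prodr_ge0// => p _; exact: J_ge0.
apply: (@le_trans _ _ (C * rho_max ^+ D.+1)%:E).
  apply: (@le_trans _ _ (\int[@lebesgue_measure R]_y
      ((C * rho_max ^+ D)%:E * (h (tnth wh u) y)%:E))%E).
    apply: ge0_le_integral => //.
    - by move=> y _; rewrite lee_fin weight_ge0.
    - apply/measurable_EFinP.
      apply: (measurableT_comp (f := fun z => weight wh l z)
        (g := fun y => set_coord u y x)); first exact: measurable_weight.
      apply/measurable_fun_tnthP => v.
      rewrite (_ : _ \o _ = fun y => if v == u then y else tnth x v).
        by case: (v == u); [exact: measurable_id|exact: measurable_cst].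
      by apply/funext => y /=; rewrite tnth_set_coord.
    - by apply: measurable_funeM; apply/measurable_EFinP; exact: measurable_h.
    - move=> y _; rewrite -EFinM lee_fin /weight node_weight_set_coord -/N'.
      rewrite [leRHS](_ : _ = h (tnth wh u) y * N' *
        (edge_weight_off u l x * rho_max ^+ D)); last by rewrite /C; ring.
      apply: ler_wpM2l; first by rewrite mulr_ge0// h_ge0.
      exact: edge_weight_set_coord_le.
  rewrite ge0_integralZl//; last first.
  - by rewrite lee_fin mulr_ge0// exprn_ge0// ltW.
  - by move=> y _; rewrite lee_fin h_ge0.
  - by apply/measurable_EFinP; exact: measurable_h.
  rewrite exprSr mulrA (EFinM (C * rho_max ^+ D)); apply: lee_wpmul2l => //.
  by rewrite lee_fin mulr_ge0// exprn_ge0// ltW.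
rewrite [X in (X%:E <= _)%E](_ : _ = ratio ^+ D.+1 * (C * rho_min ^+ D.+1)); last first.
  by rewrite /ratio expr_div_n mulrCA divfK// expf_neq0// gt_eqF.
rewrite EFinM; apply: lee_wpmul2l.
  by rewrite lee_fin exprn_ge0// (le_trans ler01).
apply: (@le_trans _ _ (\int[@lebesgue_measure R]_y
  ((C * rho_min ^+ D)%:E * (h (tnth wh' u) y * (y \in `[0, kappa[)%:R)%:E))%E).
  rewrite ge0_integralZl//; last first.
  - by rewrite lee_fin mulr_ge0// exprn_ge0// ltW.
  - by move=> y _; rewrite lee_fin mulr_ge0// h_ge0.
  - apply/measurable_EFinP; apply: measurable_funM; first exact: measurable_h.
    exact: measurable_near0.
  rewrite exprSr mulrA (EFinM (C * rho_min ^+ D)); apply: lee_wpmul2l => //.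
  by rewrite lee_fin mulr_ge0// exprn_ge0// ltW.
apply: ge0_le_integral => //.
- move=> y _; apply: mule_ge0; rewrite lee_fin mulr_ge0//; last exact: h_ge0.
  by rewrite exprn_ge0// ltW.
- apply: measurable_funeM; apply/measurable_EFinP; apply: measurable_funM.
    exact: measurable_h.
  exact: measurable_near0.
- apply/measurable_EFinP.
  apply: (measurableT_comp
    (f := fun z => weight wh' l z * (tnth z u \in `[0, kappa[)%:R)
    (g := fun y => set_coord u y x)); first exact: measurable_weight_near0.
  apply/measurable_fun_tnthP => v.
  rewrite (_ : _ \o _ = fun y => if v == u then y else tnth x v).
    by case: (v == u); [exact: measurable_id|exact: measurable_cst].
  by apply/funext => y /=; rewrite tnth_set_coord.
- move=> y _; rewrite -EFinM lee_fin /weight node_weight_set_coord N'E.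
  rewrite tnth_set_coord eqxx.
  have [yk|_] := boolP (y \in `[0, kappa[); last by rewrite !mulr0.
  rewrite !mulr1 [leLHS](_ : _ = h (tnth wh' u) y * N' *
    (edge_weight_off u l x * rho_min ^+ D)); last by rewrite /C; ring.
  apply: ler_wpM2l; first by rewrite mulr_ge0// h_ge0.
  exact: edge_weight_set_coord_ge.
Qed.

(** A fixed position, which exists as K >= 1: a new edge is controlled through its node at this
    position. *)
Variable i0 : 'I_K.

Lemma sample_partition_ge0 N (wh : N.-tuple Th) l :
  (0 <= sample_partition wh l)%E.
Proof. by apply: integral_ge0 => x _; rewrite lee_fin weight_ge0. Qed.

Lemma sample_partition_nil N (wh : N.-tuple Th) :
  sample_partition wh [::] =
  (\prod_(u < N) \int[@lebesgue_measure R]_x (h (tnth wh u) x)%:E)%E.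
Proof.
rewrite -integral_product_power_prod.
- apply: eq_integral => x _; rewrite prodEFin; congr EFin.
  by rewrite /weight /edge_weight big_nil mulr1.
- by move=> i; apply/measurable_EFinP; exact: measurable_h.
- by move=> i x; rewrite lee_fin h_ge0.
Qed.

Lemma h_mass_bounds w :
  (rho_min%:E <= \int[@lebesgue_measure R]_x (h w x)%:E <= rho_max%:E)%E.
Proof.
rewrite h_mass_le andbT; apply: (le_trans (h_mass_ge w)).
apply: ge0_le_integral => //.
- by move=> x _; rewrite lee_fin mulr_ge0// h_ge0.
- apply/measurable_EFinP; apply: measurable_funM; first exact: measurable_h.
  exact: measurable_near0.
- by apply/measurable_EFinP; exact: measurable_h.
- by move=> x _; rewrite lee_fin ler_piMr// ?h_ge0// lern1; case: (_ \in _).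
Qed.

Lemma prode_bounds N (f : 'I_N -> \bar R) (a b : R) : 0 <= a ->
  (forall u, (a%:E <= f u <= b%:E)%E) ->
  ((a ^+ N)%:E <= \prod_(u < N) f u <= (b ^+ N)%:E)%E.
Proof.
move=> a0; elim: N f => [|N IHN] f fab; first by rewrite !big_ord0 !expr0 lexx.
have /andP[p1 p2] := IHN _ (fun u => fab (lift ord0 u)).
have /andP[f1 f2] := fab ord0.
have f0 : (0 <= f ord0)%E by apply: le_trans f1; rewrite lee_fin.
have p0 : (0 <= \prod_(u < N) f (lift ord0 u))%E.
  by apply: le_trans p1; rewrite lee_fin exprn_ge0.
rewrite big_ord_recl !exprS !EFinM; apply/andP; split; apply: lee_pmul => //.
by rewrite lee_fin exprn_ge0.
Qed.

Lemma sample_partition_nil_bounds N (wh : N.-tuple Th) :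
  ((rho_min ^+ N)%:E <= sample_partition wh [::] <= (rho_max ^+ N)%:E)%E.
Proof.
rewrite sample_partition_nil.
by apply: prode_bounds => [|u]; [exact: ltW|exact: h_mass_bounds].
Qed.

Lemma weight_cons N (wh : N.-tuple Th) p l x :
  weight wh (p :: l) x = J p.2 [tuple of map (tnth x) p.1] * weight wh l x.
Proof. by rewrite /weight /edge_weight big_cons mulrCA. Qed.

Lemma sample_partition_cons_le n (wh : (n.+1).-tuple Th) (p : edge n * TJ) l :
  (sample_partition wh (p :: l) <= rho_max%:E * sample_partition wh l)%E.
Proof.
rewrite -ge0_integralZl//; last first.
- by rewrite lee_fin ltW.
- by move=> x _; rewrite lee_fin weight_ge0.
- by apply/measurable_EFinP; exact: measurable_weight.
apply: ge0_le_integral => //.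
- by move=> x _; rewrite lee_fin weight_ge0.
- by apply/measurable_EFinP; exact: measurable_weight.
- by apply: measurable_funeM; apply/measurable_EFinP; exact: measurable_weight.
- move=> x _; rewrite -EFinM lee_fin weight_cons.
  by apply: ler_wpM2r; [exact: weight_ge0|exact: J_le].
Qed.

Lemma weight_off_support N (wh : N.-tuple Th) l x u :
  ~ Omega (tnth x u) -> weight wh l x = 0.
Proof.
by move=> xu; rewrite /weight /node_weight (bigD1 u)//= h_support// !mul0r.
Qed.

(** Confining the node of [p] at position [i0] to [0, kappa[ costs a power of [ratio], and there the
    new potential is at least [rho_min]. *)
Lemma sample_partition_cons_ge n (wh : (n.+1).-tuple Th) (p : edge n * TJ) l :
  (sample_partition wh l <=
   (ratio ^+ (degree l (tnth p.1 i0)).+1 / rho_min)%:E *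
     sample_partition wh (p :: l))%E.
Proof.
apply: (le_trans (sample_partition_le_near0 (u := tnth p.1 i0) l (fun _ _ => erefl))).
rewrite EFinM -muleA; apply: lee_wpmul2l.
  by rewrite lee_fin exprn_ge0// (le_trans ler01).
rewrite -ge0_integralZl//; last first.
- by rewrite lee_fin invr_ge0 ltW.
- by move=> x _; rewrite lee_fin weight_ge0.
- by apply/measurable_EFinP; exact: measurable_weight.
apply: ge0_le_integral => //.
- by move=> x _; rewrite lee_fin mulr_ge0// weight_ge0.
- by apply/measurable_EFinP; exact: measurable_weight_near0.
- by apply: measurable_funeM; apply/measurable_EFinP; exact: measurable_weight.
- move=> x _; rewrite -EFinM lee_fin weight_cons.
  have [xO|/existsNP[v xv]] := pselect (forall v, Omega (tnth x v)); last first.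
    by rewrite (weight_off_support _ _ xv) mul0r !mulr0.
  have [xk|_] := boolP (_ \in `[0, kappa[); last first.
    rewrite mulr0 mulr_ge0 ?invr_ge0 ?(ltW rho_min_gt0)//.
    by apply: mulr_ge0; [exact: J_ge0|exact: weight_ge0].
  rewrite mulr1 mulrA; apply: ler_peMl; first exact: weight_ge0.
  rewrite mulrC ler_pdivlMr// mul1r; apply: (J_ge (i := i0)).
    by rewrite tnth_map.
  by move=> k; rewrite tnth_map.
Qed.

(** This is why the bound near 0 compares two node samples: it remains to drop the confinement on
    the right. *)
Lemma sample_partition_resample n (u : 'I_n.+1) (wh wh' : (n.+1).-tuple Th) l :
  (forall v, v != u -> tnth wh v = tnth wh' v) ->
  (sample_partition wh l <=
   (ratio ^+ (degree l u).+1)%:E * sample_partition wh' l)%E.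
Proof.
move=> e; apply: (le_trans (sample_partition_le_near0 l e)).
apply: lee_wpmul2l; first by rewrite lee_fin exprn_ge0// (le_trans ler01).
apply: ge0_le_integral => //.
- by move=> x _; rewrite lee_fin mulr_ge0// weight_ge0.
- by apply/measurable_EFinP; exact: measurable_weight_near0.
- by apply/measurable_EFinP; exact: measurable_weight.
- move=> x _; rewrite lee_fin ler_piMr// ?weight_ge0//.
  by rewrite lern1; case: (_ \in _).
Qed.

Definition log_partition N (wh : N.-tuple Th) (l : seq (K.-tuple 'I_N * TJ)) : R :=
  ln (fine (sample_partition wh l)).

(** The partition function is positive and finite: this holds without edges by the mass bounds, and
    each edge changes it by a factor between two positive constants. Hence the default values of
    [fine] and [ln] never occur. *)
Lemma sample_partition_fin n (wh : (n.+1).-tuple Th) (l : seq (edge n * TJ)) :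
  sample_partition wh l = (expR (log_partition wh l))%:E.
Proof.
suff /andP[Z0 Zoo] : (0%E < sample_partition wh l < +oo)%E.
  by rewrite lnK ?fineK// ?posrE ?fine_gt0 ?Z0// ge0_fin_numE// ltW.
elim: l => [|p l /andP[Z0 Zoo]].
  have /andP[Z1 Z2] := sample_partition_nil_bounds wh.
  rewrite (lt_le_trans _ Z1) ?lte_fin ?exprn_gt0//=.
  by rewrite (le_lt_trans Z2)// ltry.
apply/andP; split; last first.
  apply: le_lt_trans (sample_partition_cons_le wh p l) _.
  by rewrite -(@fineK _ (sample_partition wh l)) ?ge0_fin_numE ?ltW// -EFinM ltry.
rewrite lt_neqAle sample_partition_ge0 andbT; apply/eqP => Ze.
have := sample_partition_cons_ge wh p l.
by rewrite -Ze mule0 leNgt Z0.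
Qed.

Lemma log_partition_nil_bounds n (wh : (n.+1).-tuple Th) :
  n.+1%:R * ln rho_min <= log_partition wh [::] <= n.+1%:R * ln rho_max.
Proof.
have := sample_partition_nil_bounds wh.
rewrite sample_partition_fin !lee_fin => /andP[Z1 Z2].
rewrite !mulr_natl -!lnXn// -(expRK (log_partition _ _)).
by rewrite !ler_ln ?posrE ?exprn_gt0 ?expR_gt0// Z1.
Qed.

Lemma log_partition_cons_le n (wh : (n.+1).-tuple Th) (p : edge n * TJ) l :
  log_partition wh (p :: l) <= ln rho_max + log_partition wh l.
Proof.
have := sample_partition_cons_le wh p l.
rewrite !sample_partition_fin -EFinM lee_fin.
by rewrite -{1}(lnK rho_max_gt0) -expRD ler_expR.
Qed.

(** One constant for both signs of the change: [ln ratio] for the confinement, per unit of degree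
    plus one, and the absolute values for the bounds on the new potential itself. *)
Definition log_ratio := ln ratio + `|ln rho_min| + `|ln rho_max|.

Let ln_ratio_ge0 : 0 <= ln ratio. Proof. exact: ln_ge0. Qed.

Lemma log_ratio_ge0 : 0 <= log_ratio.
Proof. by rewrite /log_ratio !addr_ge0. Qed.

Lemma log_partition_cons n (wh : (n.+1).-tuple Th) (p : edge n * TJ) l :
  `|log_partition wh (p :: l) - log_partition wh l| <=
  log_ratio * (degree l (tnth p.1 i0)).+1%:R.
Proof.
have r0 : 0 < ratio by exact: lt_le_trans ratio_ge1.
have := sample_partition_cons_ge wh p l.
rewrite !sample_partition_fin -EFinM lee_fin; set D := (degree _ _).+1.
rewrite (_ : _ / _ * _ =
    expR (D%:R * ln ratio - ln rho_min + log_partition wh (p :: l))); last first.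
  by rewrite !expRD expRN expRM_natl (lnK r0) (lnK rho_min_gt0).
rewrite ler_expR => lo; have up := log_partition_cons_le wh p l.
have D1 : 1 <= D%:R :> R by rewrite ler1n.
have m1 : `|ln rho_min| <= `|ln rho_min| * D%:R by rewrite ler_peMr.
have m2 : `|ln rho_max| <= `|ln rho_max| * D%:R by rewrite ler_peMr.
have m3 : 0 <= ln ratio * D%:R by rewrite mulr_ge0.
have n1 := ler_norm (- ln rho_min); have n2 := ler_norm (ln rho_max).
rewrite normrN in n1; rewrite mulrC in lo.
have p1 := normr_ge0 (ln rho_min); have p2 := normr_ge0 (ln rho_max).
rewrite /log_ratio !mulrDl ler_norml; apply/andP; split; lra.
Qed.

Lemma log_partition_resample n (u : 'I_n.+1) (wh wh' : (n.+1).-tuple Th)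
    (l : seq (edge n * TJ)) :
  (forall v, v != u -> tnth wh v = tnth wh' v) ->
  `|log_partition wh l - log_partition wh' l| <=
  log_ratio * (degree l u).+1%:R.
Proof.
move=> e; have r0 : 0 < ratio by exact: lt_le_trans ratio_ge1.
have e' v : v != u -> tnth wh' v = tnth wh v by move/e.
have one a b : (forall v, v != u -> tnth a v = tnth b v) ->
    log_partition a l - log_partition b l <= log_ratio * (degree l u).+1%:R.
  move=> /(sample_partition_resample l).
  rewrite !sample_partition_fin -EFinM lee_fin.
  rewrite -{1}(lnK r0) -expRM_natl -expRD ler_expR -lerBlDr.
  move=> /le_trans; apply.
  by rewrite mulrC ler_wpM2r// /log_ratio -addrA lerDl addr_ge0.
by rewrite ler_norml one// lerNl opprB one.
Qed.

Lemma degree_le_size n (l : seq (edge n * TJ)) u : (degree l u <= size l)%N.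
Proof. exact: count_size. Qed.

Lemma log_partition_le n (wh : (n.+1).-tuple Th) (l : seq (edge n * TJ)) :
  log_partition wh l <= (n.+1%:R + (size l)%:R) * ln rho_max.
Proof.
elim: l => [|p l IHl].
  by rewrite addr0; have /andP[] := log_partition_nil_bounds wh.
apply: le_trans (log_partition_cons_le wh p l) _.
apply: (@le_trans _ _ (ln rho_max + (n.+1%:R + (size l)%:R) * ln rho_max)).
  by rewrite lerD2l.
by rewrite /= -(natr1 (size l)) le_eqVlt; apply/orP; left; apply/eqP; ring.
Qed.

(** A crude bound, quadratic in the number of edges, that only serves integrability. *)
Lemma log_partition_bounded n m : exists B, forall (wh : (n.+1).-tuple Th)
  (l : seq (edge n * TJ)), size l = m -> `|log_partition wh l| <= B.
Proof.
elim: m => [|m [B HB]].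
  exists (`|n.+1%:R * ln rho_min| + `|n.+1%:R * ln rho_max|) => wh l /size0nil ->.
  have /andP[b1 b2] := log_partition_nil_bounds wh.
  rewrite ler_norml; move: (ler_norm (n.+1%:R * ln rho_max)).
  move: (ler_norm (- (n.+1%:R * ln rho_min))); rewrite normrN.
  move: (normr_ge0 (n.+1%:R * ln rho_min)) (normr_ge0 (n.+1%:R * ln rho_max)).
  by move=> ????; apply/andP; split; lra.
exists (B + log_ratio * m.+1%:R) => wh [//|p l] [lm].
have := log_partition_cons wh p l.
have : log_ratio * (degree l (tnth p.1 i0)).+1%:R <= log_ratio * m.+1%:R.
  by rewrite ler_wpM2l ?log_ratio_ge0// ler_nat ltnS -lm degree_le_size.
have := ler_normD (log_partition wh (p :: l) - log_partition wh l) (log_partition wh l).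
by rewrite subrK; have := HB wh l lm; lra.
Qed.

Lemma bmeas_log_partition n m :
  bounded_measurable (fun p : (n.+1).-tuple Th * m.-tuple (edge n * TJ) =>
    log_partition p.1 p.2).
Proof.
split; last first.
  have [B HB] := log_partition_bounded n m.
  by exists B => -[wh t] /=; apply: HB; rewrite size_tuple.
apply: (measurableT_comp (@measurable_ln R)).
apply: (@measurableT_comp _ _ _ _ _ _ (@fine R)); first exact: fine_measurable.
exact: measurable_sample_partition.
Qed.

Lemma seq_bmeas_log_partition n (wh : (n.+1).-tuple Th) :
  seq_bmeas (fun l : seq (edge n * TJ) => log_partition wh l).
Proof. by move=> m; exact: (bmeas_pair1 wh (bmeas_log_partition n m)). Qed.

Lemma symmetric_log_partition n (wh : (n.+1).-tuple Th) :
  symmetric_seq (fun l : seq (edge n * TJ) => log_partition wh l).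
Proof.
move=> s p l; rewrite /log_partition; congr (ln (fine _)).
apply: eq_integral => x _; congr EFin; rewrite /weight; congr (_ * _).
by rewrite /edge_weight /= !big_cat !big_cons /= mulrCA big_cat.
Qed.

(** * Random edges: moments of the degrees and the variance of log Z *)

Variables (Ph : probability Th R) (PJ : probability TJ R).

Definition edge_sample n : probability (edge n * TJ)%type R :=
  (edge_law R n K \x PJ)%E.

Lemma sum_tuple_prod (I : finType) (F : 'I_K -> I -> R) :
  \sum_(e : K.-tuple I) \prod_(k < K) F k (tnth e k) =
  \prod_(k < K) \sum_(u : I) F k u.
Proof.
rewrite bigA_distr_bigA/=.
rewrite (reindex_onto (fun f : {ffun 'I_K -> I} => [tuple f k | k < K])
  (fun e => [ffun k => tnth e k])) /=; last first.
  by move=> e _; apply: eq_from_tnth => k; rewrite tnth_mktuple ffunE.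
apply: eq_big => [f|f _].
  by apply/eqP/ffunP => k; rewrite ffunE tnth_mktuple.
by apply: eq_bigr => k _; rewrite tnth_mktuple.
Qed.

Lemma mean_edge_sample_fst n (f : edge n -> R) :
  mean (edge_sample n) (fun p => f p.1) = (n.+1 ^ K)%:R^-1 * \sum_e f e.
Proof.
rewrite mean_prod; last exact: (bmeas_comp measurable_fst (bmeas_edges f)).
rewrite -mean_edge_law; congr mean; apply/funext => e /=.
exact: mean_cst.
Qed.

Lemma mean_edge_coord n k (f : 'I_n.+1 -> R) :
  mean (edge_sample n) (fun p => f (tnth p.1 k)) = n.+1%:R^-1 * \sum_u f u.
Proof.
rewrite (mean_edge_sample_fst (fun e => f (tnth e k))).
have -> : \sum_(e : edge n) f (tnth e k) = (n.+1 ^ K.-1)%:R * \sum_u f u.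
  transitivity (\sum_(e : edge n) \prod_(j < K)
      (if j == k then f (tnth e j) else 1)).
    apply: eq_bigr => e _; rewrite (bigD1 k)//= eqxx big1 ?mulr1// => j jk.
    by rewrite (negbTE jk).
  rewrite (sum_tuple_prod (fun j u => if j == k then f u else 1)).
  rewrite (bigD1 k)//= eqxx mulrC; congr (_ * _).
  rewrite (eq_bigr (fun=> n.+1%:R)) => [|j /negbTE ->]; last first.
    by rewrite sumr_const card_ord.
  by rewrite prodr_const cardC1 card_ord natrX.
have K0 : (0 < K)%N by case: (K) k => [[]|].
rewrite -{1}(prednK K0) expnS natrM invfM -mulrA mulKf//.
Qed.

Lemma bmeas_edge_fst n (f : edge n -> R) :
  bounded_measurable (fun p : edge n * TJ => f p.1).
Proof. exact: (bmeas_comp measurable_fst (bmeas_edges f)). Qed.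

Lemma mean_edge_mem n (u : 'I_n.+1) :
  mean (edge_sample n) (fun p => (u \in p.1)%:R) <= K%:R / n.+1%:R.
Proof.
apply: (@le_trans _ _ (mean (edge_sample n)
    (fun p => \sum_(k < K) (tnth p.1 k == u)%:R))).
  apply: le_mean.
  - exact: (bmeas_edge_fst (fun e => (u \in e)%:R)).
  - exact: (bmeas_edge_fst (fun e => \sum_(k < K) (tnth e k == u)%:R)).
  - move=> p; have [/tnthP[k ->]|_] := boolP (u \in p.1); last exact: sumr_ge0.
    by rewrite (bigD1 k)//= eqxx lerDl sumr_ge0.
rewrite mean_sum => [|k]; last exact: (bmeas_edge_fst (fun e => (tnth e k == u)%:R)).
rewrite (eq_bigr (fun=> n.+1%:R^-1)) => [|k _].
  by rewrite sumr_const card_ord -[leLHS]mulr_natl.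
rewrite (mean_edge_coord k (fun v => (v == u)%:R)) (bigD1 u)//= eqxx.
by rewrite big1 ?addr0 ?mulr1// => v /negbTE ->.
Qed.

Lemma seq_bmeas_degree n (u : 'I_n.+1) :
  seq_bmeas (fun l : seq (edge n * TJ) => (degree l u)%:R : R).
Proof.
move=> m; rewrite (_ : (fun _ => _) =
    (fun t : m.-tuple (edge n * TJ) => \sum_(i < m) (u \in (tnth t i).1)%:R)).
  apply: bmeas_sum => i.
  exact: (bmeas_comp (@measurable_tnth _ _ m i) (bmeas_edge_fst (fun e => (u \in e)%:R))).
apply/funext => t; rewrite /degree -sum1_count natr_sum big_mkcond.
rewrite (big_tuple _ _ t xpredT)/=.
by apply: eq_bigr => i _; case: (u \in _).
Qed.

Lemma sum_mem_edge n (e : edge n) : (\sum_(u < n.+1) (u \in e) <= K)%N.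
Proof.
rewrite (eq_bigr (fun u => if u \in e then 1%N else 0%N)) => [|u _]; last first.
  by case: (u \in e).
rewrite -big_mkcond sum1_card.
by apply: leq_trans (card_size _) _; rewrite size_tuple.
Qed.

Lemma sum_degree n (l : seq (edge n * TJ)) :
  (\sum_(u < n.+1) degree l u <= K * size l)%N.
Proof.
elim: l => [|p l IHl]; first by rewrite muln0 big1.
rewrite /degree /= big_split/= mulnS leq_add//; exact: sum_mem_edge.
Qed.

(** The degree in the bound for one edge can be large, but the node at position [i0] of a random
    edge is uniform, and the average degree is at most [K * size l / n.+1]. *)
Lemma mean_log_partition_cons n (wh : (n.+1).-tuple Th) (l : seq (edge n * TJ)) :
  `|mean (edge_sample n) (fun p => log_partition wh (p :: l)) -
    log_partition wh l| <= log_ratio * (1 + (K * size l)%:R / n.+1%:R).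
Proof.
have bl := bmeas_seq_cons l (seq_bmeas_log_partition wh).
pose g (u : 'I_n.+1) : R := log_ratio * (degree l u).+1%:R.
have bg : bounded_measurable (fun p : edge n * TJ => g (tnth p.1 i0)).
  exact: (bmeas_edge_fst (fun e => g (tnth e i0))).
have mg : mean (edge_sample n) (fun p => g (tnth p.1 i0)) <=
    log_ratio * (1 + (K * size l)%:R / n.+1%:R).
  rewrite (mean_edge_coord i0 g) -mulr_sumr mulrCA.
  apply: ler_wpM2l; first exact: log_ratio_ge0.
  rewrite -natr_sum (eq_bigr (fun u => (degree l u + 1)%N)) => [|u _]; last first.
    by rewrite addn1.
  rewrite big_split/= sum_nat_const card_ord muln1 natrD mulrDr addrC mulVf ?pnatr_eq0//.
  rewrite lerD2l mulrC; apply: ler_wpM2r; first by rewrite invr_ge0.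
  by rewrite ler_nat sum_degree.
rewrite ler_norml; apply/andP; split.
- rewrite lerBrDr -[X in _ + X](mean_cst (edge_sample n)).
  apply: (@le_trans _ _ (mean (edge_sample n)
      (fun p => log_partition wh l - g (tnth p.1 i0)))).
    by rewrite (meanB _ (bmeas_cst _) bg) addrC mean_cst lerB.
  apply: le_mean => //; first exact: (bmeasB (bmeas_cst _) bg).
  move=> p; have := log_partition_cons wh p l.
  by rewrite ler_norml => /andP[+ _]; rewrite -/(g _); lra.
- rewrite lerBlDr -[X in _ + X](mean_cst (edge_sample n)).
  apply: (@le_trans _ _ (mean (edge_sample n)
      (fun p => log_partition wh l + g (tnth p.1 i0)))).
    apply: le_mean => //; first exact: (bmeasD (bmeas_cst _) bg).
    move=> p; have := log_partition_cons wh p l.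
    by rewrite ler_norml => /andP[_]; rewrite -/(g _); lra.
  by rewrite (meanD _ (bmeas_cst _) bg) addrC mean_cst lerD2r.
Qed.

(** Up to [log_ratio ^+ 2], this bounds the variance over the node potentials and, divided by
    [n.+1], the mean squared effect of a random new edge. *)
Definition degree_energy n (l : seq (edge n * TJ)) : R :=
  \sum_(u < n.+1) (degree l u).+1%:R ^+ 2.

Lemma seq_bmeas_degreeS n (u : 'I_n.+1) :
  seq_bmeas (fun l : seq (edge n * TJ) => (degree l u).+1%:R : R).
Proof.
move=> m; rewrite (_ : (fun _ => _) =
    (fun t : m.-tuple (edge n * TJ) => (degree t u)%:R + 1)).
  exact: (bmeasD (seq_bmeas_degree u m) (bmeas_cst 1)).
by apply/funext => t; rewrite natr1.
Qed.

Lemma seq_bmeas_degree_energy n :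
  seq_bmeas (fun l : seq (edge n * TJ) => degree_energy l).
Proof.
by move=> m; apply: bmeas_sum => u; exact: (bmeasX 2 (seq_bmeas_degreeS u m)).
Qed.

(** An edge through a node of degree [d] turns [(d + 1) ^ 2] into [(d + 2) ^ 2], an increase of
    [2 (d + 1) + 1 <= 3 (d + 1)]: whence the factor 3. *)
Lemma mean_degree_energy_cons n (l : seq (edge n * TJ)) :
  mean (edge_sample n) (fun p => degree_energy (p :: l)) <=
  degree_energy l + 3 * K%:R * ((K * size l)%:R / n.+1%:R + 1).
Proof.
have bm u : bounded_measurable (fun p : edge n * TJ => (u \in p.1)%:R : R).
  exact: (bmeas_edge_fst (fun e => (u \in e)%:R)).
have bd u : bounded_measurable
    (fun p : edge n * TJ => (degree l u).+1%:R * (u \in p.1)%:R : R).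
  exact: (bmeasM (bmeas_cst _) (bm u)).
have bs : bounded_measurable (fun p : edge n * TJ =>
    \sum_(u < n.+1) (degree l u).+1%:R * (u \in p.1)%:R : R).
  exact: bmeas_sum.
apply: (@le_trans _ _ (mean (edge_sample n) (fun p => degree_energy l +
    3 * \sum_(u < n.+1) (degree l u).+1%:R * (u \in p.1)%:R))).
  apply: le_mean.
  - exact: (bmeas_seq_cons l (@seq_bmeas_degree_energy n)).
  - exact: (bmeasD (bmeas_cst _) (bmeasM (bmeas_cst 3) bs)).
  - move=> p; rewrite /degree_energy mulr_sumr -big_split/=.
    apply: ler_sum => u _; case: (u \in p.1) => /=.
      rewrite mulr1 -[(1 + _).+1]add1n add1n -[in leLHS]natr1.
      have : 1 <= (degree l u).+1%:R :> R by rewrite ler1n.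
      by rewrite /degree add1n; move: _%:R => z; nra.
    by rewrite !mulr0 addr0 add0n.
rewrite (meanD _ (bmeas_cst _) (bmeasM (bmeas_cst 3) bs)) mean_cst.
rewrite (meanZ _ _ bs) lerD2l -mulrA; apply: ler_wpM2l => //.
rewrite mean_sum//.
apply: (@le_trans _ _ (\sum_(u < n.+1) (degree l u).+1%:R * (K%:R / n.+1%:R))).
  apply: ler_sum => u _; rewrite (meanZ _ _ (bm u)).
  by apply: ler_wpM2l => //; exact: mean_edge_mem.
rewrite -mulr_suml -natr_sum (eq_bigr (fun u => (degree l u + 1)%N)) => [|u _]; last first.
  by rewrite addn1.
rewrite big_split/= sum_nat_const card_ord muln1 natrD mulrCA.
apply: ler_wpM2l => //; rewrite mulrDl divff ?pnatr_eq0// lerD2r.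
by apply: ler_wpM2r; rewrite ?invr_ge0// ler_nat sum_degree.
Qed.

Lemma mean_degree_energy n m :
  mean_seq (edge_sample n) m (@degree_energy n) <=
  n.+1%:R + m%:R * (3 * K%:R * ((K * m)%:R / n.+1%:R + 1)).
Proof.
pose C := 3 * K%:R * ((K * m)%:R / n.+1%:R + 1) : R.
suff : forall j, (j <= m)%N -> mean_seq (edge_sample n) j (@degree_energy n) <=
    n.+1%:R + j%:R * C by apply.
elim=> [_|j IHj jm].
  rewrite mean_seq0; last exact: seq_bmeas_degree_energy.
  rewrite /degree_energy (eq_bigr (fun=> 1)) => [|u _]; last by rewrite expr1n.
  by rewrite sumr_const card_ord mul0r addr0.
rewrite mean_seqS; last exact: seq_bmeas_degree_energy.
rewrite exchange_mean_seq; last exact: seq_bmeas_degree_energy.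
have bD := @seq_bmeas_degree_energy n.
apply: (@le_trans _ _ (mean_seq (edge_sample n) j
    (fun l => degree_energy l + C))).
  apply: le_mean_seq.
  - exact: seq_bmeas_mean.
  - by move=> i; exact: (bmeasD (bD i) (bmeas_cst C)).
  move=> l lj; apply: le_trans (mean_degree_energy_cons l) _.
  rewrite lerD2l; apply: ler_wpM2l; first by rewrite mulr_ge0.
  rewrite lerD2r; apply: ler_wpM2r; first by rewrite invr_ge0.
  by rewrite ler_nat leq_mul2l lj (ltnW jm) orbT.
rewrite /mean_seq (meanD _ (bD j) (bmeas_cst C)) mean_cst.
rewrite -[j.+1%:R]natr1 mulrDl mul1r addrA lerD2r; exact: IHj (ltnW jm).
Qed.

Lemma variance_edges n m (wh : (n.+1).-tuple Th) :
  mean_seq (edge_sample n) m.+1 (fun l => log_partition wh l ^+ 2) -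
  mean_seq (edge_sample n) m.+1 (fun l => log_partition wh l) ^+ 2 <=
  m.+1%:R / n.+1%:R * log_ratio ^+ 2 *
  mean_seq (edge_sample n) m (@degree_energy n).
Proof.
have bl := seq_bmeas_log_partition wh.
apply: le_trans.
  exact: (variance_symmetric (edge_sample n) m bl (@symmetric_log_partition n wh)).
have bE := @seq_bmeas_degree_energy n.
rewrite [leRHS](_ : _ = m.+1%:R * mean_seq (edge_sample n) m
    (fun l => (n.+1%:R^-1 * log_ratio ^+ 2) * degree_energy l)); last first.
  by rewrite /mean_seq (meanZ _ _ (bE m)); ring.
apply: ler_wpM2l => //; apply: le_mean_seq.
- move=> i; have bb : bounded_measurable (fun p : (edge n * TJ) * i.-tuple (edge n * TJ) =>
      (log_partition wh (p.1 :: p.2) - log_partition wh p.2) ^+ 2).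
    apply/bmeasX/bmeasB; first exact: (seq_bmeas_uncurry i bl).
    exact: (bmeas_comp measurable_snd (bl i)).
  exact: (@bmeas_mean2 _ _ _ _ _ (edge_sample n) _ (bmeas_swap bb)).
- by move=> i; exact: (bmeasM (bmeas_cst _) (bE i)).
move=> l _; pose g (u : 'I_n.+1) : R := log_ratio ^+ 2 * (degree l u).+1%:R ^+ 2.
apply: (@le_trans _ _ (mean (edge_sample n) (fun p => g (tnth p.1 i0)))).
  apply: le_mean.
  - exact/bmeasX/bmeasB/bmeas_cst/bmeas_seq_cons.
  - exact: (bmeas_edge_fst (fun e => g (tnth e i0))).
  - move=> p; rewrite /g -exprMn -real_normK ?num_real//.
    rewrite lerXn2r ?nnegrE//; last exact: log_partition_cons.
    by rewrite mulr_ge0// log_ratio_ge0.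
by rewrite (mean_edge_coord i0 g) -mulr_sumr mulrA.
Qed.

Lemma variance_nodes n (l : seq (edge n * TJ)) :
  mean (iid_law Ph n.+1) (fun wh => log_partition wh l ^+ 2) -
  mean (iid_law Ph n.+1) (fun wh => log_partition wh l) ^+ 2 <=
  log_ratio ^+ 2 * degree_energy l.
Proof.
apply: le_trans.
  apply: (variance_bounded_differences Ph
    (B := fun u => log_ratio * (degree l u).+1%:R)).
    exact: (bmeas_pair2 (in_tuple l) (bmeas_log_partition n (size l))).
  by move=> u wh wh' e; exact: log_partition_resample.
rewrite /degree_energy mulr_sumr; apply: ler_sum => u _.
by rewrite exprMn.
Qed.

Definition mean_log_partition n m : R :=
  mean (iid_law Ph n.+1) (fun wh =>
    mean_seq (edge_sample n) m (fun l => log_partition wh l)).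

(** In the constant, the last factor bounds the mean degree energy per node; in [1 + c], the [1]
    comes from the node potentials and the [c] from the edges. *)
Lemma variance_log_partition n m (c : R) : 0 < c -> m%:R <= c * n.+1%:R ->
  mean (iid_law Ph n.+1) (fun wh =>
    mean_seq (edge_sample n) m (fun l => log_partition wh l ^+ 2)) -
  mean_log_partition n m ^+ 2 <=
  log_ratio ^+ 2 * (1 + c) * (1 + c * (3 * K%:R * (K%:R * c + 1))) * n.+1%:R.
Proof.
move=> c0 mc.
have bL := bmeas_log_partition n m.
have bE := @seq_bmeas_degree_energy n.
have r0 : 0 <= log_ratio ^+ 2 by exact: sqr_ge0.
pose A : R := 1 + c * (3 * K%:R * (K%:R * c + 1)).
have A0 : 0 <= A.
  have cK : 0 <= K%:R * c + 1 by rewrite addr_ge0// mulr_ge0// ltW.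
  by rewrite /A addr_ge0// (mulr_ge0 (ltW c0))// mulr_ge0.
have energy j : (j <= m)%N -> mean_seq (edge_sample n) j (@degree_energy n) <= A * n.+1%:R.
  move=> jm; apply: le_trans (mean_degree_energy n j) _.
  have jc : j%:R <= c * n.+1%:R by apply: le_trans mc; rewrite ler_nat.
  rewrite [leRHS](_ : _ = n.+1%:R + (c * n.+1%:R) * (3 * K%:R * (K%:R * c + 1))); last first.
    by rewrite /A; ring.
  rewrite lerD2l; apply: ler_pM => //.
  apply: ler_wpM2l; first by rewrite mulr_ge0.
  by rewrite lerD2r natrM -mulrA ler_wpM2l// ler_pdivrMr.
apply: le_trans; first exact: (variance_prod (iid_law Ph n.+1) (iid_law (edge_sample n) m) bL).
rewrite -/A [leRHS](_ : _ = log_ratio ^+ 2 * (A * n.+1%:R) +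
  c * log_ratio ^+ 2 * (A * n.+1%:R)); last by ring.
apply: lerD.
- apply: (@le_trans _ _ (mean_seq (edge_sample n) m
      (fun l => log_ratio ^+ 2 * degree_energy l))).
    apply: le_mean.
    + apply: bmeasB.
        exact: (@bmeas_mean2 _ _ _ _ _ (iid_law Ph n.+1) _ (bmeas_swap (bmeasX 2 bL))).
      exact/bmeasX/(@bmeas_mean2 _ _ _ _ _ (iid_law Ph n.+1) _ (bmeas_swap bL)).
    + exact: (bmeasM (bmeas_cst _) (bE m)).
    + by move=> l; exact: variance_nodes.
  rewrite /mean_seq meanZ; last exact: bE.
  by apply: ler_wpM2l => //; exact: energy.
- rewrite -[leRHS](mean_cst (iid_law Ph n.+1)); apply: le_mean => [||wh].
  + apply: bmeasB.
      exact: (@bmeas_mean2 _ _ _ _ _ (iid_law (edge_sample n) m) _ (bmeasX 2 bL)).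
    exact/bmeasX/(@bmeas_mean2 _ _ _ _ _ (iid_law (edge_sample n) m) _ bL).
  + exact: bmeas_cst.
  (* Without edges there is nothing to resample and the variance is 0; [variance_edges] needs at
     least one edge. *)
  + case: m mc bL energy => [|m] mc bL energy.
      have bl := seq_bmeas_log_partition wh.
      have bl2 : seq_bmeas (fun l : seq (edge n * TJ) => log_partition wh l ^+ 2).
        by move=> i; exact: (bmeasX 2 (bl i)).
      have e1 := mean_seq0 (edge_sample n) bl.
      have e2 := mean_seq0 (edge_sample n) bl2.
      rewrite /mean_seq in e1 e2; rewrite e1 e2 subrr.
      by apply: mulr_ge0; [exact: mulr_ge0 (ltW c0) _|exact: mulr_ge0].
    apply: le_trans (variance_edges m wh) _.
    have mc' : m.+1%:R / n.+1%:R <= c by rewrite ler_pdivrMr.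
    apply: ler_pM => //.
    * by rewrite mulr_ge0// divr_ge0.
    * rewrite -(mean_seq_cst (edge_sample n) m 0); apply: le_mean_seq => //.
        by move=> i; exact: bmeas_cst.
      by move=> l _; apply: sumr_ge0 => u _; exact: sqr_ge0.
    * exact: ler_wpM2r.
    * exact: energy.
Qed.

Lemma mean_seq_step n (wh : (n.+1).-tuple Th) j :
  `|mean_seq (edge_sample n) j.+1 (fun l => log_partition wh l) -
    mean_seq (edge_sample n) j (fun l => log_partition wh l)| <=
  log_ratio * (1 + (K * j)%:R / n.+1%:R).
Proof.
have bl := seq_bmeas_log_partition wh.
set C := log_ratio * _.
rewrite mean_seqS// exchange_mean_seq//.
have bm := seq_bmeas_mean (edge_sample n) bl.
have step l : size l = j ->
    `|mean (edge_sample n) (fun p => log_partition wh (p :: l)) -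
      log_partition wh l| <= C.
  by move=> lj; have := mean_log_partition_cons wh l; rewrite lj.
apply: mean_dist => [||t]; [exact: bm|exact: bl|].
by apply: step; rewrite size_tuple.
Qed.

Lemma mean_seq_steps n (wh : (n.+1).-tuple Th) i k :
  `|mean_seq (edge_sample n) (i + k) (fun l => log_partition wh l) -
    mean_seq (edge_sample n) i (fun l => log_partition wh l)| <=
  log_ratio * k%:R * (1 + (K * (i + k))%:R / n.+1%:R).
Proof.
elim: k => [|k IHk]; first by rewrite addn0 subrr normr0 mulr0 mul0r.
have st := mean_seq_step wh (i + k); rewrite -addnS in st.
rewrite -(subrK (mean_seq (edge_sample n) (i + k) (fun l => log_partition wh l))
  (mean_seq _ (i + k.+1) _)) -addrA (le_trans (ler_normD _ _))//.
have mono : 1 + (K * (i + k))%:R / n.+1%:R <= 1 + (K * (i + k.+1))%:R / n.+1%:R :> R.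
  rewrite lerD2l; apply: ler_wpM2r; first by rewrite invr_ge0.
  by rewrite ler_nat leq_mul2l addnS leqnSn orbT.
apply: (@le_trans _ _ (log_ratio * (1 + (K * (i + k.+1))%:R / n.+1%:R) +
    log_ratio * k%:R * (1 + (K * (i + k.+1))%:R / n.+1%:R))).
  apply: lerD; [apply: le_trans st _|apply: le_trans IHk _];
    apply: ler_wpM2l => //; rewrite ?mulr_ge0// log_ratio_ge0//.
by rewrite -[k.+1%:R]natr1 le_eqVlt; apply/orP; left; apply/eqP; ring.
Qed.

(* The deviation is bounded by a quadratic, |j - i| <= s + (j - i) ^ 2 / s, so
   that its binomial mean only involves the variance. *)
Lemma mean_seq_near n (wh : (n.+1).-tuple Th) i j (c s : R) :
  0 < c -> 1 <= s -> s ^+ 2 <= n.+1%:R -> i%:R <= c * n.+1%:R ->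
  mean_seq (edge_sample n) i (fun l => log_partition wh l) -
    log_ratio * (1 + K%:R * c + K%:R) * (s + (j%:R - i%:R) ^+ 2 / s) <=
  mean_seq (edge_sample n) j (fun l => log_partition wh l).
Proof.
move=> c0 s1 sn ic.
have s0 : 0 < s by exact: lt_le_trans s1.
set a := mean_seq _ j _; set b := mean_seq _ i _.
pose d : R := `|j%:R - i%:R|.
have N0 : 0 < n.+1%:R :> R by [].
have : `|a - b| <= log_ratio * d * (1 + K%:R * (i%:R + d) / n.+1%:R).
  have [ij|/ltnW ji] := leqP i j.
    have dE : d = (j - i)%:R.
      by rewrite /d -natrB// ger0_norm.
    rewrite dE -natrD -natrM.
    by have := mean_seq_steps wh i (j - i); rewrite subnKC.
  have dE : d = (i - j)%:R.
    by rewrite /d distrC -natrB// ger0_norm.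
  rewrite distrC dE.
  have := mean_seq_steps wh j (i - j); rewrite subnKC// => /le_trans; apply.
  apply: ler_wpM2l; first by rewrite mulr_ge0// log_ratio_ge0.
  rewrite lerD2l; apply: ler_wpM2r; first by rewrite invr_ge0.
  by rewrite -natrD -natrM ler_nat leq_mul2l leq_addr orbT.
rewrite -[(_ - _) ^+ 2]real_normK ?num_real// -/d.
have d0 : 0 <= d by exact: normr_ge0.
move=> /ler_normlP[ab _].
suff : d * (1 + K%:R * (i%:R + d) / n.+1%:R) <=
    (1 + K%:R * c + K%:R) * (s + d ^+ 2 / s).
  move=> /(ler_wpM2l log_ratio_ge0); move: ab; rewrite -!(mulrA log_ratio).
  by move: (log_ratio * _) (log_ratio * _) => X Y; lra.
have d1 : d <= s + d ^+ 2 / s.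
  rewrite -(ler_pM2r s0) mulrDl divfK ?gt_eqF//.
  have := sqr_ge0 (d - s); nra.
(* As [1 <= s], one has [s <= s ^+ 2 <= n.+1%:R]. *)
have d2 : d * (d / n.+1%:R) <= s + d ^+ 2 / s.
  apply: (@le_trans _ _ (d ^+ 2 / s)); last by rewrite lerDr ltW.
  rewrite mulrA -expr2; apply: ler_wpM2l; first exact: sqr_ge0.
  rewrite lef_pV2 ?posrE//; apply: le_trans sn.
  by rewrite expr2 ler_peMl// ltW.
have ic' : i%:R / n.+1%:R <= c by rewrite ler_pdivrMr.
apply: (@le_trans _ _ ((1 + K%:R * c) * d + K%:R * (d * (d / n.+1%:R)))).
  rewrite [leLHS](_ : _ = (1 + K%:R * (i%:R / n.+1%:R)) * d +
    K%:R * (d * (d / n.+1%:R))); last by ring.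
  rewrite lerD2r; apply: ler_wpM2r => //.
  by rewrite lerD2l; apply: ler_wpM2l.
rewrite [leRHS]mulrDl; apply: lerD; apply: ler_wpM2l => //.
by rewrite addr_ge0// mulr_ge0// ltW.
Qed.

(** * Splitting the nodes into two blocks and replacing one edge *)

Definition lshift_edge m n (e : edge m) : edge (m + n.+1) :=
  [tuple of map (fun u => @lshift m.+1 n.+1 u : 'I_(m + n.+1).+1) e].

Definition rshift_edge m n (e : edge n) : edge (m + n.+1) :=
  [tuple of map (fun u => @rshift m.+1 n.+1 u : 'I_(m + n.+1).+1) e].

Definition left_sample m n (p : edge m * TJ) : edge (m + n.+1) * TJ :=
  (lshift_edge n p.1, p.2).

Definition right_sample m n (p : edge n * TJ) : edge (m + n.+1) * TJ :=
  (rshift_edge m p.1, p.2).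

Lemma measurable_left_sample m n : measurable_fun setT (@left_sample m n).
Proof.
apply: measurable_fun_pair; last exact: measurable_snd.
exact: (measurableT_comp (measurable_fun_edges (@lshift_edge m n)) measurable_fst).
Qed.

Lemma measurable_right_sample m n : measurable_fun setT (@right_sample m n).
Proof.
apply: measurable_fun_pair; last exact: measurable_snd.
exact: (measurableT_comp (measurable_fun_edges (@rshift_edge m n)) measurable_fst).
Qed.

Lemma weight_split m n (wh1 : (m.+1).-tuple Th) (wh2 : (n.+1).-tuple Th)
    (s : seq (edge m * TJ + edge n * TJ)) (x1 : (m.+1).-tuple mR) (x2 : (n.+1).-tuple mR) :
  weight [tuple of wh1 ++ wh2]
    (map (merge_split (@left_sample m n) (@right_sample m n)) s)
    [tuple of x1 ++ x2] =
  weight wh1 (lefts s) x1 * weight wh2 (rights s) x2.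
Proof.
have nw : node_weight [tuple of wh1 ++ wh2] [tuple of x1 ++ x2] =
    node_weight wh1 x1 * node_weight wh2 x2.
  rewrite /node_weight big_split_ord/=; congr (_ * _); apply: eq_bigr => u _.
    by rewrite !tnth_lshift.
  by rewrite !tnth_rshift.
have ew : edge_weight (map (merge_split (@left_sample m n) (@right_sample m n)) s)
    [tuple of x1 ++ x2] = edge_weight (lefts s) x1 * edge_weight (rights s) x2.
  rewrite /edge_weight; elim: s => [|[p|p] s IHs]; first by rewrite !big_nil mulr1.
    rewrite /= !big_cons IHs mulrA; congr (J _ _ * _ * _).
    apply: eq_from_tnth => k; rewrite [LHS]tnth_map [RHS]tnth_map.
    have -> : tnth (left_sample n p).1 k = @lshift m.+1 n.+1 (tnth p.1 k).
      exact: tnth_map.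
    by rewrite (tnth_nth 0) [RHS](tnth_nth 0)/= nth_cat size_tuple ltn_ord.
  rewrite /= !big_cons IHs mulrCA; congr (_ * (J _ _ * _)).
  apply: eq_from_tnth => k; rewrite [LHS]tnth_map [RHS]tnth_map.
  have -> : tnth (right_sample m p).1 k = @rshift m.+1 n.+1 (tnth p.1 k).
    exact: tnth_map.
  rewrite (tnth_nth 0) [RHS](tnth_nth 0)/= nth_cat size_tuple.
  by rewrite ltnNge leq_addr/= addKn.
by rewrite /weight nw ew mulrACA.
Qed.

Lemma log_partition_split m n (wh1 : (m.+1).-tuple Th) (wh2 : (n.+1).-tuple Th)
    (s : seq (edge m * TJ + edge n * TJ)) :
  log_partition [tuple of wh1 ++ wh2]
    (map (merge_split (@left_sample m n) (@right_sample m n)) s) =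
  log_partition wh1 (lefts s) + log_partition wh2 (rights s).
Proof.
set l := map _ s; pose wh : (m + n.+1).+1.-tuple Th := [tuple of wh1 ++ wh2].
have mw : measurable_fun setT (fun x : (m + n.+1).+1.-tuple mR => (weight wh l x)%:E).
  by apply/measurable_EFinP; exact: (@measurable_weight (m + n.+1) wh l).
have e : sample_partition wh l =
    (sample_partition wh1 (lefts s) * sample_partition wh2 (rights s))%E.
  transitivity (\int[lebesgue_measure_tuple R m.+1]_x1
      \int[lebesgue_measure_tuple R n.+1]_x2
        (weight wh l [tuple of x1 ++ x2])%:E)%E.
    apply: (@integral_product_power_cat _ mR R (@lebesgue_measure R) m.+1 n.+1) => //.
    by move=> t; rewrite lee_fin weight_ge0.
  transitivity (\int[lebesgue_measure_tuple R m.+1]_x1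
      (sample_partition wh2 (rights s) * (weight wh1 (lefts s) x1)%:E))%E.
    apply: eq_integral => x1 _; rewrite muleC -ge0_integralZl//; last first.
    - by rewrite lee_fin weight_ge0.
    - by move=> x _; rewrite lee_fin weight_ge0.
    - by apply/measurable_EFinP; exact: measurable_weight.
    by apply: eq_integral => x2 _; rewrite -EFinM; congr EFin; exact: weight_split.
  rewrite ge0_integralZl//; first by rewrite muleC.
  - by apply/measurable_EFinP; exact: measurable_weight.
  - by move=> x _; rewrite lee_fin weight_ge0.
  - exact: sample_partition_ge0.
rewrite -[LHS]/(ln (fine (sample_partition wh l))) e !sample_partition_fin.
by rewrite /= -expRD expRK.
Qed.

Definition node_fraction m n : R := m.+1%:R / (m.+1 + n.+1)%:R.

Lemma node_fraction_ge0 m n : 0 <= node_fraction m n.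
Proof. by rewrite divr_ge0. Qed.

Lemma node_fraction1 m n :
  (NngNum (node_fraction_ge0 m n))%:num + (NngNum (node_fraction_ge0 n m))%:num = 1.
Proof.
rewrite /= /node_fraction [(n.+1 + m.+1)%N]addnC -mulrDl -natrD divff//.
Qed.

Definition split_sample m n : probability (edge (m + n.+1) * TJ)%type R :=
  split_law (node_fraction1 m n) (@measurable_left_sample m n)
    (@measurable_right_sample m n) (edge_sample m) (edge_sample n).

(** The left side is the polynomial of the array [g] at the push-forward by [phi] of the weights
    [c]; once the product is expanded, only tuples in the image of [phi] remain. *)
Lemma sum_tuple_push (I I' : finType) (phi : I -> I') (c : I -> R) (g : K.-tuple I' -> R) :
  \sum_(i : K.-tuple I')
    (\prod_(k < K) \sum_(u : I) c u * (tnth i k == phi u)%:R) * g i =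
  \sum_(e : K.-tuple I) (\prod_(k < K) c (tnth e k)) * g [tuple of map phi e].
Proof.
transitivity (\sum_(i : K.-tuple I') \sum_(e : K.-tuple I)
    (\prod_(k < K) c (tnth e k)) * (i == [tuple of map phi e])%:R * g i).
  apply: eq_bigr => i _.
  rewrite -(sum_tuple_prod (fun k u => c u * (tnth i k == phi u)%:R)) mulr_suml.
  apply: eq_bigr => e _; rewrite big_split/=; congr (_ * _ * _).
  have [->|ie] := eqVneq i [tuple of map phi e].
    by rewrite big1// => k _; rewrite tnth_map eqxx.
  have [k ik] : exists k, tnth i k != phi (tnth e k).
    apply/existsP; apply: contraNT ie; rewrite negb_exists => /forallP H.
    apply/eqP/eq_from_tnth => k; rewrite tnth_map.
    by have := H k; rewrite negbK => /eqP.
  by rewrite (bigD1 k)//= (negbTE ik) mul0r.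
rewrite exchange_big/=; apply: eq_bigr => e _.
rewrite (bigD1 [tuple of map phi e])//= eqxx mulr1.
rewrite [X in _ + X]big1 ?addr0// => i /negbTE ->; by rewrite mulr0 mul0r.
Qed.

Variable alpha : R.
Hypothesis J_le_alpha : forall w x, J w x <= alpha.
Hypothesis convexity : forall n r : nat, (1 <= n)%N -> (1 <= r)%N ->
  forall x : 'I_r -> n.-tuple R,
  (forall (l : 'I_r) (i : 'I_n), Omega (tnth (x l) i)) ->
  convex_over (nonneg_orthant R (r.-tuple 'I_n))
    (expected_array PJ (fun w => tensor_product (fun l =>
       (fun i => alpha - J w [tuple of map (tnth (x l)) i])))).

(* The average of [g] over the edges of the whole graph, minus its average over
   the edges of the two-component one. *)
Definition split_defect m n (g : edge (m + n.+1) -> R) : R :=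
  ((m + n.+1).+1 ^ K)%:R^-1 * \sum_e g e -
  (node_fraction m n * ((m.+1 ^ K)%:R^-1 * \sum_e g (lshift_edge n e)) +
   node_fraction n m * ((n.+1 ^ K)%:R^-1 * \sum_e g (rshift_edge m e))).

(* Convexity is used at the two vectors putting uniform mass on the constant
   r-tuples [(u, ..., u)], [u] ranging over one of the two blocks of nodes. *)
Lemma convex_split_defect m n r (x : 'I_r -> (m + n.+1).+1.-tuple R) :
  (0 < r)%N -> (forall l i, Omega (tnth (x l) i)) ->
  split_defect (fun e : edge (m + n.+1) => mean PJ (fun w =>
    \prod_(l < r) (alpha - J w [tuple of map (tnth (x l)) e]))) <= 0.
Proof.
move=> r0 xO; set N := (m + n.+1).+1.
pose diag (u : 'I_N) : r.-tuple 'I_N := [tuple of nseq r u].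
have dg u l : tnth (diag u) l = u by rewrite (tnth_nth u)/= nth_nseq ltn_ord.
pose vec (I : finType) (phi : I -> 'I_N) : {ffun r.-tuple 'I_N -> R^o} :=
  [ffun j => \sum_(u : I) #|I|%:R^-1 * (j == diag (phi u))%:R].
pose yN := vec _ (@id 'I_N).
pose y1 := vec _ (fun u => @lshift m.+1 n.+1 u : 'I_N).
pose y2 := vec _ (fun u => @rshift m.+1 n.+1 u : 'I_N).
pose a := expected_array PJ (fun w => tensor_product (fun l =>
  (fun i : K.-tuple 'I_N => alpha - J w [tuple of map (tnth (x l)) i]))).
pose g (e : K.-tuple 'I_N) := mean PJ (fun w =>
  \prod_(l < r) (alpha - J w [tuple of map (tnth (x l)) e])).
have vec0 (I : finType) (phi : I -> 'I_N) : vec _ phi \in nonneg_orthant R (r.-tuple 'I_N).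
  rewrite inE => j; rewrite ffunE; apply: sumr_ge0 => u _.
  by rewrite mulr_ge0 ?invr_ge0.
(* At constant r-tuples all factors of the tensor product read the same edge [e], each in its own
   replica [x l]. *)
have aE (e : K.-tuple 'I_N) : a [tuple of map diag e] = g e.
  rewrite /a /g /expected_array unlock /mean; congr fine.
  apply: eq_integral => w _; congr EFin; apply: eq_bigr => l _.
  congr (alpha - J w _); apply: eq_from_tnth => k.
  rewrite ![LHS]tnth_map [RHS]tnth_map; congr (tnth (x l) _).
  by rewrite 2!tnth_map dg.
have fE (I : finType) (phi : I -> 'I_N) :
    \sum_(i : K.-tuple (r.-tuple 'I_N)) (\prod_(k < K) vec _ phi (tnth i k)) * a i =
    (#|I| ^ K)%:R^-1 * \sum_(e : K.-tuple I) g [tuple of map phi e].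
  transitivity (\sum_(i : K.-tuple (r.-tuple 'I_N))
      (\prod_(k < K) \sum_(u : I) #|I|%:R^-1 * (tnth i k == diag (phi u))%:R) * a i).
    by apply: eq_bigr => i _; congr (_ * _); apply: eq_bigr => k _; rewrite ffunE.
  rewrite (sum_tuple_push (diag \o phi)) mulr_sumr; apply: eq_bigr => e _.
  rewrite prodr_const card_ord natrX exprVn -aE; congr (_ * a _).
  by apply: eq_from_tnth => k; rewrite !tnth_map.
have t1 : node_fraction m n <= 1.
  by rewrite ler_pdivrMr// mul1r ler_nat leq_addr.
pose t : {i01 R} := Itv01 (node_fraction_ge0 m n) t1.
have tE : 1 - t%:num = node_fraction n m.
  by have /= <- := node_fraction1 m n; rewrite addrAC subrr add0r.
have yE : yN = t%:num *: y1 + (1 - t%:num) *: y2.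
  have inv_scale (p q : nat) : node_fraction p q / p.+1%:R = (p.+1 + q.+1)%:R^-1.
    by rewrite /node_fraction mulrAC divff// mul1r.
  apply/ffunP => j; rewrite !ffunE tE /= /GRing.scale/= !mulr_sumr.
  rewrite (@big_split_ord _ _ _ m.+1 n.+1)/=; congr (_ + _);
    apply: eq_bigr => u _; rewrite !card_ord mulrA inv_scale//.
  by rewrite [(n.+1 + m.+1)%N]addnC.
have := @convexity N r isT r0 x xO t y1 y2 (vec0 _ _) (vec0 _ _).
rewrite convRE.
have -> : conv t (y1 : convex_lmodType {ffun r.-tuple 'I_N -> R^o}) y2 = yN.
  by rewrite yE.
rewrite -subr_le0; congr (_ <= 0).
rewrite /split_defect !fE !card_ord; congr (_ * _ - (_ * (_ * _) + _ * (_ * _))) => //.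
apply: eq_bigr => e _; rewrite -/(g e); congr g.
by apply: eq_from_tnth => k; rewrite tnth_map.
Qed.

(** This is the form required by the replica argument: fixed signed weights on the edges of the
    whole graph. *)
Lemma split_defect_linear m n : exists c : edge (m + n.+1) -> R,
  forall g, split_defect g = \sum_e c e * g e.
Proof.
pose push k (phi : edge k -> edge (m + n.+1)) e : R :=
  (k.+1 ^ K)%:R^-1 * \sum_e1 (e == phi e1)%:R.
have pushE k (phi : edge k -> edge (m + n.+1)) g :
    (k.+1 ^ K)%:R^-1 * \sum_e1 g (phi e1) = \sum_e push _ phi e * g e.
  under [RHS]eq_bigr do rewrite /push -mulrA mulr_suml.
  rewrite -mulr_sumr exchange_big/=; congr (_ * _).
  apply: eq_bigr => e1 _; rewrite (bigD1 (phi e1))//= eqxx mul1r.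
  by rewrite big1 ?addr0// => e /negbTE ->; rewrite mul0r.
exists (fun e => ((m + n.+1).+1 ^ K)%:R^-1 -
  (node_fraction m n * push _ (@lshift_edge m n) e +
   node_fraction n m * push _ (@rshift_edge m n) e)) => g.
under eq_bigr do rewrite mulrBl mulrDl -(mulrA (node_fraction m n))
  -(mulrA (node_fraction n m)).
by rewrite sumrB big_split/= -!mulr_sumr -!pushE.
Qed.

(** The weights thus sum to 0, so the part of [log Z] that does not depend on the new edge drops
    out. *)
Lemma split_defect_cst m n x : split_defect (fun _ : edge (m + n.+1) => x) = 0.
Proof.
have avg k : (k.+1 ^ K)%:R^-1 * (\sum_(e : edge k) x) = x.
  rewrite sumr_const card_tuple card_ord -[x *+ _]mulr_natl mulKf//.
rewrite /split_defect (avg (m + n.+1)%N) (avg m) (avg n) -mulrDl.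
by have /= -> := node_fraction1 m n; rewrite mul1r subrr.
Qed.

Lemma mean_split_defect m n (f : edge (m + n.+1) * TJ -> R) :
  bounded_measurable f ->
  mean (edge_sample (m + n.+1)) f - mean (split_sample m n) f =
  split_defect (fun e => mean PJ (fun w => f (e, w))).
Proof.
move=> bf.
have bl : bounded_measurable (fun p : edge m * TJ => f (left_sample n p)).
  exact: (bmeas_comp (@measurable_left_sample m n) bf).
have br : bounded_measurable (fun p : edge n * TJ => f (right_sample m p)).
  exact: (bmeas_comp (@measurable_right_sample m n) bf).
rewrite /split_sample /split_law mean_mixture// !mean_image_law//.
by rewrite /edge_sample !mean_prod// !mean_edge_law.
Qed.

Lemma gibbs_weight_integral n (wh : (n.+1).-tuple Th) (l : seq (edge n * TJ)) :
  (\int[lebesgue_measure_tuple R n.+1]_x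
    (weight wh l x / expR (log_partition wh l))%:E = 1)%E.
Proof.
under eq_integral do rewrite mulrC EFinM.
rewrite ge0_integralZl//.
- rewrite -[X in (_ * X)%E]/(sample_partition wh l) sample_partition_fin.
  by rewrite -EFinM mulVf// gt_eqF// expR_gt0.
- by apply/measurable_EFinP; exact: measurable_weight.
- by move=> x _; rewrite lee_fin weight_ge0.
Qed.

Lemma measurable_gibbs_weight n (wh : (n.+1).-tuple Th) (l : seq (edge n * TJ)) :
  measurable_fun setT (fun x : (n.+1).-tuple mR =>
    weight wh l x / expR (log_partition wh l)).
Proof. by apply: measurable_funM; [exact: measurable_weight|exact: measurable_cst]. Qed.

Lemma gibbs_weight_ge0 n (wh : (n.+1).-tuple Th) (l : seq (edge n * TJ)) x :
  0 <= weight wh l x / expR (log_partition wh l).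
Proof. by rewrite divr_ge0 ?expR_ge0// weight_ge0. Qed.

Lemma measurable_potential_gap n (e : edge n) :
  measurable_fun setT (fun p : TJ * (n.+1).-tuple mR =>
    alpha - J p.1 [tuple of map (tnth p.2) e]).
Proof.
apply: measurable_funB; first exact: measurable_cst.
apply: (measurableT_comp (@measurable_edge_potential n)
  (g := fun p : TJ * (n.+1).-tuple mR => ((e, p.1), p.2))).
apply: measurable_fun_pair; last exact: measurable_snd.
by apply: measurable_fun_pair; [exact: measurable_cst|exact: measurable_fst].
Qed.

Lemma potential_gap_ge0 w x : 0 <= alpha - J w x.
Proof. by rewrite subr_ge0. Qed.

Lemma potential_gap_le w x : alpha - J w x <= alpha.
Proof. by rewrite gerBl J_ge0. Qed.

Definition gap_mean n (wh : (n.+1).-tuple Th) (l : seq (edge n * TJ)) :=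
  gibbs_mean (lebesgue_measure_tuple R n.+1)
    (fun x => weight wh l x / expR (log_partition wh l))
    (fun (e : edge n) w x => alpha - J w [tuple of map (tnth x) e]).

(** The Gibbs average of [J] is the ratio of the partition functions with and without the edge. *)
Lemma gap_meanE n (wh : (n.+1).-tuple Th) (l : seq (edge n * TJ)) e w :
  gap_mean wh l e w =
  alpha - expR (log_partition wh ((e, w) :: l) - log_partition wh l).
Proof.
have mV := measurable_gibbs_weight wh l.
have V0 := gibbs_weight_ge0 wh l.
have mG := measurable_potential_gap e.
have a0 : 0 <= alpha by exact: le_trans (J_ge0 w [tuple of nseq K 0]) (J_le_alpha _ _).
have [mGw mJw] : measurable_fun setT (fun x : (n.+1).-tuple mR =>
      alpha - J w [tuple of map (tnth x) e]) /\
    measurable_fun setT (fun x : (n.+1).-tuple mR =>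
      J w [tuple of map (tnth x) e]).
  split; first exact: (measurable_fun_pair2 w mG).
  exact: (measurable_fun_pair2 (e, w) (@measurable_edge_potential n)).
apply: EFin_inj; rewrite EFinB -(gibbs_meanE mV V0 (gibbs_weight_integral wh l)
  (G := fun (e : edge n) w x => alpha - J w [tuple of map (tnth x) e])
  (@measurable_potential_gap n) (fun _ _ _ => potential_gap_ge0 _ _)
  (fun _ _ _ => potential_gap_le _ _)).
have -> : (expR (log_partition wh ((e, w) :: l) - log_partition wh l))%:E =
    (\int[lebesgue_measure_tuple R n.+1]_x (J w [tuple of map (tnth x) e] *
       (weight wh l x / expR (log_partition wh l)))%:E)%E.
  rewrite expRD expRN mulrC EFinM -sample_partition_fin -ge0_integralZl//.
  - apply: eq_integral => x _; rewrite weight_cons /= -EFinM; congr EFin.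
    by ring.
  - by apply/measurable_EFinP; exact: measurable_weight.
  - by move=> x _; rewrite lee_fin weight_ge0.
set b := (X in (_ = alpha%:E - X)%E).
set a := (X in (X = _)%E).
(* Subtracting integrals needs finiteness, so the two non-negative ones are first added; their
   finite sum then shows [b] finite. *)
have ab : (a + b = alpha%:E)%E.
  rewrite /a /b -ge0_integralD//.
  - rewrite -[RHS]mule1 -(gibbs_weight_integral wh l) -ge0_integralZl//.
    + by apply: eq_integral => x _; rewrite -EFinD -EFinM; congr EFin; ring.
    + exact/measurable_EFinP.
    + by move=> x _; rewrite lee_fin.
  - by move=> x _; rewrite lee_fin mulr_ge0// potential_gap_ge0.
  - by apply/measurable_EFinP; exact: measurable_funM.
  - by move=> x _; rewrite lee_fin mulr_ge0// J_ge0.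
  - by apply/measurable_EFinP; exact: measurable_funM.
have bfin : b \is a fin_num.
  have a0' : (0 <= a)%E.
    by apply: integral_ge0 => x _; rewrite lee_fin mulr_ge0// potential_gap_ge0.
  have b0 : (0 <= b)%E.
    by apply: integral_ge0 => x _; rewrite lee_fin mulr_ge0// J_ge0.
  rewrite ge0_fin_numE//; apply: (@le_lt_trans _ _ (a + b)%E).
    by rewrite leeDr.
  by rewrite ab ltry.
by rewrite -ab addeK.
Qed.

(** The logarithmic series is cut at order [k]: each power contributes with the favorable sign, and
    the uniform remainder vanishes as [k] grows. Its rate [q] depends on [l], which is harmless
    because [l] is fixed. *)
Lemma interpolation_step m n (wh : (m + n.+1).+1.-tuple Th)
    (l : seq (edge (m + n.+1) * TJ)) :
  mean (split_sample m n) (fun p => log_partition wh (p :: l)) <=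
  mean (edge_sample (m + n.+1)) (fun p => log_partition wh (p :: l)).
Proof.
rewrite -subr_ge0 mean_split_defect; last first.
  exact: (bmeas_seq_cons l (seq_bmeas_log_partition wh)).
have [c cE] := split_defect_linear m n.
have c0 : \sum_e c e = 0.
  rewrite -[RHS](split_defect_cst m n 1) cE.
  by apply: eq_bigr => e _; rewrite mulr1.
pose T := gap_mean wh l.
have bT e : bounded_measurable (T e).
  exact: (bmeas_gibbs_mean (measurable_gibbs_weight wh l) (gibbs_weight_ge0 wh l)
    (gibbs_weight_integral wh l)
    (@measurable_potential_gap (m + n.+1)%N) (fun _ _ _ => potential_gap_ge0 _ _)
    (fun _ _ _ => potential_gap_le _ _)).
have T0 e w : 0 <= T e w.
  rewrite /T /gap_mean; apply: gibbs_mean_ge0 => *; first exact: gibbs_weight_ge0.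
  exact: potential_gap_ge0.
have powers k : (0 < k)%N -> \sum_e c e * mean PJ (fun w => T e w ^+ k) <= 0.
  move=> k0; rewrite /T /gap_mean.
  apply: (sum_gibbs_mean_le0 (good := [set x : (m + n.+1).+1.-tuple mR |
    forall i, Omega (tnth x i)]) (measurable_gibbs_weight wh l)
    (gibbs_weight_ge0 wh l) (gibbs_weight_integral wh l) _
    (@measurable_potential_gap (m + n.+1)%N) (fun _ _ _ => potential_gap_ge0 _ _)
    (fun _ _ _ => potential_gap_le _ _)) => //.
    by move=> x /existsNP[i xi]; rewrite (weight_off_support _ _ xi) mul0r.
  by move=> r x r0 xO; rewrite -cE; exact: convex_split_defect.
(* A lower bound on the ratio of partition functions, from the one-edge bound and the fact that a
   degree is at most the number of edges; it keeps [1 - T e w / alpha] away from 0. *)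
pose delta := expR (- (log_ratio * (size l).+1%:R)).
have T_le e w : T e w <= alpha - delta.
  rewrite /T gap_meanE lerD2l lerN2 /delta ler_expR.
  have /ler_normlP[+ _] := log_partition_cons wh (e, w) l.
  rewrite -lerN2 opprK => /(le_trans _); apply; rewrite lerN2.
  by rewrite ler_wpM2l ?log_ratio_ge0// ler_nat ltnS degree_le_size.
have alpha_gt0 : 0 < alpha.
  pose e : edge (m + n.+1) := [tuple of nseq K ord0].
  have := gap_meanE wh l e point; have := T0 e point; rewrite -/T.
  by have := expR_gt0 (log_partition wh ((e, point) :: l) - log_partition wh l); lra.
pose q := 1 - delta / alpha.
have q1 : q < 1 by rewrite /q ltrBlDr ltrDl divr_gt0// expR_gt0.
have Tq e w : T e w / alpha <= q.
  rewrite /q ler_pdivrMr// mulrBl mul1r divfK ?gt_eqF//.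
have Ta0 e w : 0 <= T e w / alpha by rewrite divr_ge0// ltW.
have q0 : 0 <= q by exact: le_trans (Ta0 [tuple of nseq K ord0] point) (Tq _ _).
pose f e w := log_partition wh ((e, w) :: l).
have bf e : bounded_measurable (f e).
  exact: (bmeas_pair1 e (bmeas_seq_cons l (seq_bmeas_log_partition wh))).
pose f0 := log_partition wh l + ln alpha.
have fE e w : f e w = f0 + ln (1 - T e w / alpha).
  have Tl : 0 < 1 - T e w / alpha.
    by rewrite subr_gt0 (le_lt_trans (Tq e w)).
  rewrite /f0 -addrA -lnM ?posrE// mulrBr mulr1 mulrCA divff ?gt_eqF// mulr1.
  by rewrite /T gap_meanE subKr expRK addrC subrK.
have bt k e : bounded_measurable (fun w => log_taylor k (T e w / alpha)).
  apply: bmeas_sum => r; apply: (bmeasM (bmeas_cst _)); apply: bmeasX.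
  exact: (bmeasM (bT e) (bmeas_cst _)).
have taylor_le0 k :
    \sum_e c e * mean PJ (fun w => log_taylor k (T e w / alpha)) <= 0.
  have -> : \sum_e c e * mean PJ (fun w => log_taylor k (T e w / alpha)) =
      \sum_(r < k) (r.+1%:R^-1 / alpha ^+ r.+1) *
        \sum_e c e * mean PJ (fun w => T e w ^+ r.+1).
    under [RHS]eq_bigr do rewrite mulr_sumr.
    rewrite [RHS]exchange_big/=; apply: eq_bigr => e _.
    have -> : (fun w => log_taylor k (T e w / alpha)) =
        (fun w => \sum_(r < k) (r.+1%:R^-1 / alpha ^+ r.+1) * T e w ^+ r.+1).
      apply/funext => w; apply: eq_bigr => r _.
      by rewrite expr_div_n mulrCA mulrC.
    rewrite mean_sum => [|r]; last exact: (bmeasM (bmeas_cst _) (bmeasX _ (bT e))).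
    rewrite mulr_sumr; apply: eq_bigr => r _.
    by rewrite (meanZ _ _ (bmeasX _ (bT e))) mulrCA.
  apply: sumr_le0 => r _; apply: mulr_ge0_le0; last exact: powers.
  by rewrite divr_ge0// exprn_ge0// ltW.
pose B := \sum_e `|c e|.
(* The constant [f0] cancels since the weights sum to 0, and the Taylor part, which enters with a
   minus sign, can only help. *)
have lower k : - (B / (1 - q)) * q ^+ k <= \sum_e c e * mean PJ (f e).
  have -> : \sum_e c e * mean PJ (f e) =
      \sum_e c e * (mean PJ (f e) -
        mean PJ (fun w => f0 - log_taylor k (T e w / alpha))) -
      \sum_e c e * mean PJ (fun w => log_taylor k (T e w / alpha)).
    transitivity (\sum_e (c e * (mean PJ (f e) -
        mean PJ (fun w => f0 - log_taylor k (T e w / alpha))) -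
      c e * mean PJ (fun w => log_taylor k (T e w / alpha)) + c e * f0)).
      apply: eq_bigr => e _; rewrite (meanB _ (bmeas_cst _) (bt k e)) mean_cst; ring.
    by rewrite big_split/= sumrB -mulr_suml c0 mul0r addr0.
  have dist e : `|mean PJ (f e) -
      mean PJ (fun w => f0 - log_taylor k (T e w / alpha))| <= q ^+ k / (1 - q).
    apply: mean_dist => [||w]; first exact: bf.
      exact: (bmeasB (bmeas_cst _) (bt k e)).
    have -> : f e w - (f0 - log_taylor k (T e w / alpha)) =
        ln (1 - T e w / alpha) + log_taylor k (T e w / alpha).
      by rewrite fE; ring.
    exact: ln_taylor_le.
  have : - (B * (q ^+ k / (1 - q))) <= \sum_e c e * (mean PJ (f e) -
      mean PJ (fun w => f0 - log_taylor k (T e w / alpha))).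
    rewrite /B mulr_suml -sumrN; apply: ler_sum => e _.
    rewrite lerNl -mulrN; apply: (le_trans (ler_norm _)).
    by rewrite normrM normrN ler_wpM2l.
  by have := taylor_le0 k; rewrite mulNr mulrAC mulrA; lra.
have lim : (fun k => - (B / (1 - q)) * q ^+ k) @ \oo --> (0 : R).
  rewrite -[X in _ --> X](mulr0 (- (B / (1 - q)))); apply: cvgMr.
  by apply: cvg_expr; rewrite ger0_norm.
rewrite cE; apply: (cvgr_to_le lim); apply: nearW; exact: lower.
Qed.

Lemma bmeas_mean_log_partition n m :
  bounded_measurable (fun wh : (n.+1).-tuple Th =>
    mean_seq (edge_sample n) m (fun l => log_partition wh l)).
Proof.
exact: (@bmeas_mean2 _ _ _ _ _ (iid_law (edge_sample n) m) _ (bmeas_log_partition n m)).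
Qed.

(** * Near-superadditivity, and convergence under sure hypotheses *)

Variable c : R.
Hypothesis c_gt0 : 0 < c.

(** With [D] the product of the first two factors and [s] the square root of the smaller size, the
    two blocks lose in mean at most [D * (2 s + 2 / s) + (3 D / s) * (c s ^ 2 + 1)], and
    [1 / s <= s] turns this into [(3 c + 7) * D * s]. *)
Definition interpolation_error : R :=
  log_ratio * (1 + K%:R * c + K%:R) * (3 * c + 7).

Lemma nb_edges_bounds k : (nb_edges c k)%:R <= c * k%:R < (nb_edges c k)%:R + 1.
Proof.
have /truncn_itv/andP[lo up] : 0 <= c * k%:R by rewrite mulr_ge0// ltW.
by rewrite lo natr1 up.
Qed.

Lemma superadditive_quenched m n (wh1 : (m.+1).-tuple Th) (wh2 : (n.+1).-tuple Th) :
  (m <= n)%N ->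
  mean_seq (edge_sample m) (nb_edges c m.+1) (fun l => log_partition wh1 l) +
  mean_seq (edge_sample n) (nb_edges c n.+1) (fun l => log_partition wh2 l) -
  interpolation_error * Num.sqrt m.+1%:R <=
  mean_seq (edge_sample (m + n.+1)) (nb_edges c (m + n.+1).+1)
    (fun l => log_partition ([tuple of wh1 ++ wh2] : (m + n.+1).+1.-tuple Th) l).
Proof.
move=> mn; set wh : (m + n.+1).+1.-tuple Th := [tuple of wh1 ++ wh2].
set M := nb_edges c (m + n.+1).+1; set i1 := nb_edges c m.+1; set i2 := nb_edges c n.+1.
set A := mean_seq (edge_sample m) i1 _; set B := mean_seq (edge_sample n) i2 _.
(* The scale of the binomial fluctuations of the edge count in the smaller block; since [m <= n],
   its square is at most either block size. *)
pose s : R := Num.sqrt m.+1%:R; rewrite -/s.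
have s2 : s ^+ 2 = m.+1%:R by rewrite sqr_sqrtr.
have s1 : 1 <= s by rewrite -sqrtr1 ler_wsqrtr// ler1n.
have s0 : 0 < s by exact: lt_le_trans s1.
pose D := log_ratio * (1 + K%:R * c + K%:R).
have D0 : 0 <= D.
  by rewrite mulr_ge0 ?log_ratio_ge0// addr_ge0// addr_ge0// mulr_ge0// ltW.
have [/andP[M1 M2] /andP[a1 a2] /andP[b1 b2]] :=
  And3 (nb_edges_bounds (m + n.+1).+1) (nb_edges_bounds m.+1) (nb_edges_bounds n.+1).
rewrite -/M in M1 M2; rewrite -/i1 in a1 a2; rewrite -/i2 in b1 b2.
have NE : (m + n.+1).+1%:R = m.+1%:R + n.+1%:R :> R by rewrite -addSn natrD.
(* The floor of a sum exceeds the sum of the floors by at most 1. *)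
have MN : -1 <= (M%:R - i1%:R - i2%:R : R) <= 1.
  have cN : c * (m + n.+1).+1%:R = c * m.+1%:R + c * n.+1%:R by rewrite NE mulrDr.
  have iM : (i1 + i2 <= M)%N.
    rewrite -ltnS -(ltr_nat R) -natr1 natrD; lra.
  have Mi : (M < i1 + i2 + 2)%N.
    rewrite -(ltr_nat R) !natrD; lra.
  have : (i1 + i2)%:R <= M%:R :> R by rewrite ler_nat.
  have : M%:R <= (i1 + i2 + 1)%:R :> R by rewrite ler_nat -ltnS -addnS.
  rewrite !natrD; lra.
pose a := node_fraction m n; pose b := node_fraction n m.
have ab : a + b = 1 by exact: node_fraction1.
have a0 : 0 <= a by exact: node_fraction_ge0.
have b0 : 0 <= b by exact: node_fraction_ge0.
have aN : a * (m + n.+1).+1%:R = m.+1%:R.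
  by rewrite /a /node_fraction divfK// pnatr_eq0 addSn.
apply: (@le_trans _ _ (mean_seq (split_sample m n) M (fun l => log_partition wh l))); last first.
  apply: le_mean_seq_law.
  - exact: seq_bmeas_log_partition.
  - exact: symmetric_log_partition.
  - by move=> l; exact: interpolation_step.
rewrite (mean_seq_split _ _ _ _ _ _ (seq_bmeas_log_partition wh)
  (seq_bmeas_log_partition wh1) (seq_bmeas_log_partition wh2)); last first.
  by move=> l; exact: log_partition_split.
apply: (@le_trans _ _ (binomial_mean a b M (fun j _ =>
    (A + B - D * (2 * s + 2 / s)) + (- (3 * D / s)) * (j%:R - i1%:R) ^+ 2))); last first.
  apply: le_binomial_mean => // j k jk.
  have sm : s ^+ 2 <= m.+1%:R by rewrite s2.
  have lA := @mean_seq_near _ wh1 i1 j c s c_gt0 s1 sm a1.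
  have sn : s ^+ 2 <= n.+1%:R by rewrite s2 ler_nat.
  have lB := @mean_seq_near _ wh2 i2 k c s c_gt0 s1 sn b1.
  (* As [j + k = M], the two deviations are opposite up to the rounding term [M - i1 - i2], so that
     of the larger block is controlled by that of the smaller one. *)
  have k2 : (k%:R - i2%:R) ^+ 2 <= 2 + 2 * (j%:R - i1%:R) ^+ 2 :> R.
    have -> : k%:R = M%:R - j%:R :> R by rewrite -jk natrD addrAC subrr add0r.
    move: MN; move: (M%:R : R) (j%:R : R) (i1%:R : R) (i2%:R : R) => x1 x2 x3 x4.
    move=> /andP[u1 u2].
    have -> : x1 - x2 - x4 = (x1 - x3 - x4) - (x2 - x3) by ring.
    move: u1 u2; move: (x1 - x3 - x4) (x2 - x3) => u v u1 u2.
    have := sqr_ge0 (u + v); nra.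
  rewrite -/D -/A -/B in lA lB.
  have sV : 0 < s^-1 by rewrite invr_gt0.
  have : D * ((k%:R - i2%:R) ^+ 2 / s) <= D * ((2 + 2 * (j%:R - i1%:R) ^+ 2) / s).
    by apply: ler_wpM2l => //; apply: ler_wpM2r => //; exact: ltW.
  move: lA lB; rewrite -/A -/B !mulrDr.
  move: (mean_seq _ j _) (mean_seq _ k _) => X Y lA lB lk.
  move: lk; rewrite mulrDl mulrDr; nra.
rewrite binomial_meanD binomial_mean_cst// binomial_meanZ binomial_mean_sqr//.
(* The bias is at most 1 because [M * a] and [i1] both lie between [c * m.+1 - 1] and [c * m.+1]. *)
have var : M%:R * a * b + (M%:R * a - i1%:R) ^+ 2 <= c * s ^+ 2 + 1.
  have Ma1 : M%:R * a <= c * s ^+ 2.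
    by rewrite s2 -aN [leRHS]mulrCA [leLHS]mulrC; apply: ler_wpM2l.
  have Ma2 : c * s ^+ 2 - 1 <= M%:R * a.
    have : c * (m + n.+1).+1%:R * a <= (M%:R + 1) * a.
      by apply: ler_wpM2r => //; exact: ltW.
    rewrite -[_ * _ * a]mulrA [_ * a in leLHS]mulrC aN -s2 mulrDl mul1r; lra.
  have Mab : M%:R * a * b <= c * s ^+ 2.
    by apply: le_trans Ma1; rewrite ler_piMr ?mulr_ge0//; lra.
  rewrite s2 in Ma1 Ma2 Mab *.
  have : (M%:R * a - i1%:R) ^+ 2 <= 1.
    move: (M%:R * a) Ma1 Ma2 => z z1 z2.
    have : -1 <= z - i1%:R <= 1 by apply/andP; split; lra.
    by move: (z - _) => v /andP[v1 v2]; nra.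
  lra.
have sV : s^-1 <= s.
  by apply: (le_trans _ s1); rewrite invf_le1.
have sV0 : 0 <= s^-1 by rewrite invr_ge0 ltW.
have lv : 3 * D / s * (M%:R * a * b + (M%:R * a - i1%:R) ^+ 2) <=
    3 * D / s * (c * s ^+ 2 + 1).
  by apply: ler_wpM2l => //; rewrite divr_ge0 ?(ltW s0)// mulr_ge0.
have e1 : 3 * D / s * (c * s ^+ 2 + 1) = 3 * c * (D * s) + 3 * (D * s^-1).
  by field; rewrite gt_eqF.
have e2 : D * s^-1 <= D * s by apply: ler_wpM2l.
have e3 : D * (2 * s + 2 / s) = 2 * (D * s) + 2 * (D * s^-1) by ring.
have e4 : interpolation_error * s = 3 * c * (D * s) + 7 * (D * s).
  by rewrite /interpolation_error -/D; ring.
rewrite e4 e3 mulNr; lra.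
Qed.

Definition mean_log_instance k : R := mean_log_partition k (nb_edges c k.+1).

Lemma superadditive_annealed m n : (m <= n)%N ->
  mean_log_instance m + mean_log_instance n -
    interpolation_error * Num.sqrt m.+1%:R <=
  mean_log_instance (m + n.+1).
Proof.
move=> mn; set C := interpolation_error * _.
pose Fm := fun wh : (m.+1).-tuple Th =>
  mean_seq (edge_sample m) (nb_edges c m.+1) (fun l => log_partition wh l).
pose Fn := fun wh : (n.+1).-tuple Th =>
  mean_seq (edge_sample n) (nb_edges c n.+1) (fun l => log_partition wh l).
have bm : bounded_measurable Fm by exact: bmeas_mean_log_partition.
have bn : bounded_measurable Fn by exact: bmeas_mean_log_partition.
have bN := bmeas_mean_log_partition (m + n.+1) (nb_edges c (m + n.+1).+1).
rewrite /mean_log_instance [leRHS](@mean_iid_cat _ _ _ Ph m.+1 n.+1 _ bN).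
have bNc : bounded_measurable (fun p : (m.+1).-tuple Th * (n.+1).-tuple Th =>
    mean_seq (edge_sample (m + n.+1)) (nb_edges c (m + n.+1).+1)
      (fun l => log_partition ([tuple of p.1 ++ p.2] : (m + n.+1).+1.-tuple Th) l)).
  have mcat := @measurable_tuple_cat _ Th _ _ m.+1 n.+1 _ _
    (@measurable_fst _ _ ((m.+1).-tuple Th) ((n.+1).-tuple Th)) measurable_snd.
  exact: (bmeas_comp mcat bN).
have b1 wh1 : bounded_measurable (fun wh2 => Fm wh1 + Fn wh2 - C).
  exact: (bmeasB (bmeasD (bmeas_cst (Fm wh1)) bn) (bmeas_cst C)).
have -> : mean_log_partition m (nb_edges c m.+1) +
    mean_log_partition n (nb_edges c n.+1) - C =
    mean (iid_law Ph m.+1) (fun wh1 =>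
      mean (iid_law Ph n.+1) (fun wh2 => Fm wh1 + Fn wh2 - C)).
  have -> : (fun wh1 => mean (iid_law Ph n.+1) (fun wh2 => Fm wh1 + Fn wh2 - C)) =
      (fun wh1 => Fm wh1 + (mean (iid_law Ph n.+1) Fn - C)).
    apply/funext => wh1; rewrite (meanB _ _ (bmeas_cst C)) ?mean_cst.
      by rewrite (meanD _ (bmeas_cst _) bn) mean_cst addrA.
    exact: (bmeasD (bmeas_cst _) bn).
  by rewrite (meanD _ bm (bmeas_cst _)) mean_cst addrA.
apply: le_mean => [||wh1].
- apply: (@bmeas_mean2 _ _ _ _ _ (iid_law Ph n.+1)
    (fun wh1 wh2 => Fm wh1 + Fn wh2 - C)).
  apply: bmeasB; last exact: bmeas_cst.
  apply: bmeasD; first exact: (bmeas_comp measurable_fst bm).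
  exact: (bmeas_comp measurable_snd bn).
- exact: (@bmeas_mean2 _ _ _ _ _ (iid_law Ph n.+1) _ bNc).
- apply: le_mean => [||wh2].
  + exact: b1.
  + exact: (bmeas_pair1 wh1 bNc).
  + exact: superadditive_quenched.
Qed.

Lemma mean_log_instance_le k :
  mean_log_instance k <= (1 + c) * `|ln rho_max| * k.+1%:R.
Proof.
rewrite -[leRHS](mean_cst (iid_law Ph k.+1)); apply: le_mean => [||wh].
- exact: bmeas_mean_log_partition.
- exact: bmeas_cst.
rewrite -[leRHS](mean_seq_cst (edge_sample k) (nb_edges c k.+1)).
apply: le_mean_seq => [||l sl].
- exact: seq_bmeas_log_partition.
- by move=> j; exact: bmeas_cst.
apply: (le_trans (log_partition_le wh l)); rewrite sl.
have /andP[lo _] := nb_edges_bounds k.+1.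
apply: (@le_trans _ _ ((k.+1%:R + (nb_edges c k.+1)%:R) * `|ln rho_max|)).
  by apply: ler_wpM2l; rewrite ?ler_norm// addr_ge0.
rewrite [leRHS]mulrAC; apply: ler_wpM2r => //; lra.
Qed.

Lemma instance_partition_functionE n m (w : instance_space K Th TJ n m) :
  instance_partition_function h J w =
  sample_partition w.2.1 (zip w.1 w.2.2 : seq (edge n * TJ)).
Proof.
apply: eq_integral => x _; congr EFin; congr (_ * _).
rewrite /edge_weight (big_tuple _ _ [tuple of zip w.1 w.2.2] xpredT)/=.
apply: eq_bigr => i _.
have -> : tnth [tuple of zip w.1 w.2.2] i = (tnth w.1 i, tnth w.2.2 i).
  pose x0 := (tnth w.1 i, tnth w.2.2 i).
  rewrite (tnth_nth x0)/= nth_zip ?size_tuple//.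
  by rewrite -!tnth_nth.
by [].
Qed.

Definition instance_prob n m : probability
    (m.-tuple (edge n) * ((n.+1).-tuple Th * m.-tuple TJ))%type R :=
  (iid_law (edge_law R n K) m \x (iid_law Ph n.+1 \x iid_law PJ m))%E.

Lemma measurable_instance_zip n m : measurable_fun setT
  (fun w : m.-tuple (edge n) * ((n.+1).-tuple Th * m.-tuple TJ) =>
    (w.2.1, [tuple of zip w.1 w.2.2] : m.-tuple (edge n * TJ)%type)).
Proof.
apply: measurable_fun_pair.
  exact: (measurableT_comp measurable_fst measurable_snd).
apply: (@measurableT_comp _ _ _ _ _ _ (fun p : m.-tuple (edge n) * m.-tuple TJ =>
  [tuple of zip p.1 p.2] : m.-tuple (edge n * TJ)%type) _
  (fun w : m.-tuple (edge n) * ((n.+1).-tuple Th * m.-tuple TJ) => (w.1, w.2.2))).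
  exact: measurable_zip.
apply: measurable_fun_pair; first exact: measurable_fst.
exact: (measurableT_comp measurable_snd measurable_snd).
Qed.

Lemma mean_instance n m (F : (n.+1).-tuple Th -> seq (edge n * TJ) -> R) :
  bounded_measurable (fun p : (n.+1).-tuple Th * m.-tuple (edge n * TJ) =>
    F p.1 p.2) ->
  (forall wh, seq_bmeas (F wh)) ->
  mean (instance_prob n m) (fun w => F w.2.1 (zip w.1 w.2.2)) =
  mean (iid_law Ph n.+1) (fun wh => mean_seq (edge_sample n) m (F wh)).
Proof.
move=> bF bFs.
have bZ := bmeas_comp (@measurable_instance_zip n m) bF.
rewrite /instance_prob (mean_prod _ _ bZ) /=.
transitivity (mean (iid_law (edge_law R n K) m) (fun g =>
  mean (iid_law Ph n.+1) (fun wh => mean (iid_law PJ m) (fun wj =>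
    F wh (zip g wj))))).
  congr mean; apply/funext => g.
  exact: (mean_prod _ _ (bmeas_pair1 g bZ)).
rewrite exchange_mean; last first.
  apply: (@bmeas_mean2 _ _ _ _ _ (iid_law PJ m)
    (fun (p : m.-tuple (edge n) * (n.+1).-tuple Th) wj => F p.2 (zip p.1 wj))).
  have mr : measurable_fun setT (fun p : (m.-tuple (edge n) * (n.+1).-tuple Th) *
      m.-tuple TJ => (p.1.1, (p.1.2, p.2))).
    apply: measurable_fun_pair.
      exact: (measurableT_comp measurable_fst measurable_fst).
    apply: measurable_fun_pair; last exact: measurable_snd.
    exact: (measurableT_comp measurable_snd measurable_fst).
  exact: (bmeas_comp mr bZ).
by congr mean; apply/funext => wh; rewrite mean_zip.
Qed.

Lemma lne_instance_partition_function n m (w : instance_space K Th TJ n m) :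
  lne (instance_partition_function h J w) =
  (log_partition w.2.1 (zip w.1 w.2.2 : seq (edge n * TJ)))%:E.
Proof.
by rewrite instance_partition_functionE sample_partition_fin lne_EFin ?expR_gt0// expRK.
Qed.

Definition instance_log n
    (w : (nb_edges c n.+1).-tuple (edge n) *
      ((n.+1).-tuple Th * (nb_edges c n.+1).-tuple TJ)) : R :=
  log_partition w.2.1 (zip w.1 w.2.2 : seq (edge n * TJ)).

Lemma bmeas_instance_log n : bounded_measurable (@instance_log n).
Proof.
exact: (bmeas_comp (@measurable_instance_zip n _) (bmeas_log_partition n _)).
Qed.

Lemma mean_instance_log n :
  mean (instance_prob n (nb_edges c n.+1)) (@instance_log n) = mean_log_instance n.
Proof.
rewrite /instance_log mean_instance//; first exact: bmeas_log_partition.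
by move=> wh; exact: seq_bmeas_log_partition.
Qed.

Definition variance_rate : R :=
  log_ratio ^+ 2 * (1 + c) * (1 + c * (3 * K%:R * (K%:R * c + 1))).

Lemma variance_instance_log n :
  mean (instance_prob n (nb_edges c n.+1)) (fun w => instance_log w ^+ 2) -
  mean (instance_prob n (nb_edges c n.+1)) (@instance_log n) ^+ 2 <=
  variance_rate * n.+1%:R.
Proof.
have bL := bmeas_log_partition n (nb_edges c n.+1).
rewrite mean_instance_log /instance_log
  (mean_instance (F := fun wh l => log_partition wh l ^+ 2)).
- apply: variance_log_partition => //.
  by have /andP[] := nb_edges_bounds n.+1.
- exact: (bmeasX 2 bL).
- by move=> wh k; apply: bmeasX; exact: seq_bmeas_log_partition.
Qed.

Lemma interpolation_error_ge0 : 0 <= interpolation_error.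
Proof.
have c0 := ltW c_gt0.
by rewrite !mulr_ge0 ?log_ratio_ge0// !addr_ge0// mulr_ge0.
Qed.

Lemma right_converging_everywhere : right_converging Ph PJ h J c.
Proof.
have [z az] := near_superadditive_cvg interpolation_error_ge0
  superadditive_annealed mean_log_instance_le.
exists z => eps eps0; have eps2 : 0 < eps / 2 by rewrite divr_gt0.
apply: (@squeeze_cvge _ _ _ _ (cst 0%E) _
  (fun n => ((4 * variance_rate / eps ^+ 2) * n.+1%:R^-1)%:E)).
- move/cvgrPdist_le: az => /(_ _ eps2); apply: filterS => n nz.
  apply/andP; split; first exact: (measure_ge0 (instance_prob n _)).
  have N0 : 0 < n.+1%:R :> R by rewrite ltr0Sn.
  have N1 : n.+1%:R != 0 :> R by rewrite gt_eqF.
  (* Half of [eps] is for the distance from the mean to the limit, half for the fluctuation. The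
     variance is of order N and [t ^+ 2] of order N squared. *)
  pose t : R := n.+1%:R * (eps / 2).
  have t0 : 0 < t by rewrite mulr_gt0.
  have Xt : `|mean (instance_prob n (nb_edges c n.+1)) (@instance_log n) -
      n.+1%:R * z| <= t.
    rewrite mean_instance_log distrC.
    have -> : n.+1%:R * z - mean_log_instance n =
        n.+1%:R * (z - n.+1%:R^-1 * mean_log_instance n).
      by rewrite mulrBr mulrA divff ?mul1r.
    by rewrite normrM gtr0_norm// /t ler_pM2l.
  rewrite (_ : [set w | _] =
      [set w | (2 * t < `|@instance_log n w - n.+1%:R * z|)%R]); last first.
    have E w : (2 * t < `|@instance_log n w - n.+1%:R * z|) =
        (eps%:E < `|(n.+1%:R^-1)%:E * lne (instance_partition_function h J w)
        - z%:E|)%E.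
      rewrite lne_instance_partition_function -/(instance_log w).
      transitivity (eps < `|n.+1%:R^-1 * instance_log w - z|).
        have -> : instance_log w - n.+1%:R * z =
            n.+1%:R * (n.+1%:R^-1 * instance_log w - z) by field.
        rewrite normrM gtr0_norm// (_ : 2 * t = n.+1%:R * eps).
          by rewrite ltr_pM2l.
        by rewrite /t; field.
      by [].
    by apply/seteqP; split => w /=; rewrite E.
  apply: (le_trans (chebyshev_near (bmeas_instance_log n) t0 Xt)); rewrite lee_fin.
  have -> : 4 * variance_rate / eps ^+ 2 / n.+1%:R =
      t ^- 2 * (variance_rate * n.+1%:R).
    have eps1 : eps != 0 by rewrite gt_eqF.
    by rewrite /t; field; rewrite eps1 nat1r.
  by rewrite ler_pM2l ?variance_instance_log// invr_gt0 exprn_gt0.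
- exact: cvg_cst.
- apply: cvg_EFin; first exact: nearW.
  rewrite -[X in _ --> X](mulr0 (4 * variance_rate / eps ^+ 2)).
  apply: cvgMr; exact: cvg_harmonic.
Qed.

End model.

(** * From almost sure to sure hypotheses *)

Section modification.
Context (R : realType) (K : nat) (dh dJ : measure_display).
Context (Th : measurableType dh) (TJ : measurableType dJ).
Variables (Ph : probability Th R) (PJ : probability TJ R).

Lemma measurable_instance_deviation (h : Th -> R -> R) (J : TJ -> K.-tuple R -> R)
    n m (z eps : R) :
  random_node_potential h -> random_edge_potential J ->
  measurable [set w : m.-tuple (K.-tuple 'I_n.+1) * ((n.+1).-tuple Th * m.-tuple TJ) |
    (eps%:E < `|(n.+1%:R^-1)%:E * lne (instance_partition_function h J w) - z%:E|)%E].
Proof.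
move=> random_h random_J.
have mZ : measurable_fun setT
    (fun w : m.-tuple (K.-tuple 'I_n.+1) * ((n.+1).-tuple Th * m.-tuple TJ) =>
      instance_partition_function h J w).
  have mc := measurableT_comp (@measurable_sample_partition _ _ _ _ _ _ _ _
      random_h random_J n m)
    (@measurable_instance_zip K _ _ Th TJ n m).
  by apply: eq_measurable_fun mc => w _ /=; rewrite instance_partition_functionE.
rewrite -[X in measurable X]setTI; apply: emeasurable_fun_o_infty => //.
apply: measurableT_comp; first exact: abse_measurable.
apply: emeasurable_funB; last exact: measurable_cst.
by apply: measurable_funeM; exact: (measurableT_comp (@measurable_lne R) mZ).
Qed.

Variables (h h' : Th -> R -> R) (J J' : TJ -> K.-tuple R -> R).
Hypotheses (random_h : random_node_potential h) (random_h' : random_node_potential h').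
Hypotheses (random_J : random_edge_potential J) (random_J' : random_edge_potential J').
Variables (Nh : set Th) (NJ : set TJ).
Hypotheses (mNh : measurable Nh) (Nh0 : Ph Nh = 0%E).
Hypotheses (mNJ : measurable NJ) (NJ0 : PJ NJ = 0%E).
Hypotheses (hE : forall w, ~ Nh w -> h w = h' w) (JE : forall w, ~ NJ w -> J w = J' w).

(** An instance draws finitely many potentials, so almost surely none falls in [Nh] or [NJ], and
    then the two partition functions agree. *)
Lemma right_converging_modification c :
  right_converging Ph PJ h' J' c -> right_converging Ph PJ h J c.
Proof.
move=> [z cvgz]; exists z => eps eps0.
apply: (@squeeze_cvge _ _ _ _ (cst 0%E) _ _ _ _ _ (cvgz eps eps0)); last exact: cvg_cst.
near=> n; set m := nb_edges c n.+1.
pose P := instance_prob K Ph PJ n m.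
have [mBh Bh0] := iid_law_null n.+1 mNh Nh0.
have [mBJ BJ0] := iid_law_null m mNJ NJ0.
set Bh := [set _ | _] in mBh Bh0; set BJ := [set _ | _] in mBJ BJ0.
pose B1 : set (m.-tuple (K.-tuple 'I_n.+1) * ((n.+1).-tuple Th * m.-tuple TJ)) :=
  setT `*` (Bh `*` setT).
pose B2 : set (m.-tuple (K.-tuple 'I_n.+1) * ((n.+1).-tuple Th * m.-tuple TJ)) :=
  setT `*` (setT `*` BJ).
have mB1 : measurable B1 by apply: measurableX => //; exact: measurableX.
have mB2 : measurable B2 by apply: measurableX => //; exact: measurableX.
have PB1 : P B1 = 0%E.
  transitivity (iid_law (edge_law R n K) m setT *
      (iid_law Ph n.+1 \x iid_law PJ m) (Bh `*` setT))%E.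
    by apply: product_measure1E => //; exact: measurableX.
  rewrite (_ : (_ \x _)%E (Bh `*` setT) = 0%E) ?mule0//.
  apply: etrans (product_measure1E _ _ mBh measurableT) _.
  by apply: etrans (congr1 (fun x => x * _)%E Bh0) _; exact: mul0e.
have PB2 : P B2 = 0%E.
  transitivity (iid_law (edge_law R n K) m setT *
      (iid_law Ph n.+1 \x iid_law PJ m) (setT `*` BJ))%E.
    by apply: product_measure1E => //; exact: measurableX.
  rewrite (_ : (_ \x _)%E (setT `*` BJ) = 0%E) ?mule0//.
  apply: etrans (product_measure1E _ _ measurableT mBJ) _.
  by apply: etrans (congr1 (fun x => _ * x)%E BJ0) _; exact: mule0.
have mA' := @measurable_instance_deviation h' J' n m z eps random_h' random_J'.
set A' := [set _ | _] in mA'.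
have mA := @measurable_instance_deviation h J n m z eps random_h random_J.
set A := [set _ | _] in mA.
suff le_PA : (P A <= P A')%E.
  by apply/andP; split; [exact: (measure_ge0 P A)|exact: le_PA].
clearbody P.
have mB : measurable (B1 `|` B2) by exact: measurableU.
have PB : P (B1 `|` B2) = 0%E by apply: etrans (measureU0 mB1 mB2 PB2) PB1.
rewrite -[leRHS](measureU0 mA' mB PB).
apply: le_measure; rewrite ?inE//.
  exact: measurableU.
move=> w Aw; case: (pselect (Bh w.2.1)) => [Bw|nBh]; first by right; left.
case: (pselect (BJ w.2.2)) => [Bw|nBJ]; first by right; right.
left; rewrite /A' /=.
have -> : instance_partition_function h' J' w = instance_partition_function h J w.
  rewrite /instance_partition_function; congr partition_function.
    by apply/funext => u; rewrite hE// => Nu; apply: nBh; exists u.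
  by apply/funext => e; rewrite JE// => Ne; apply: nBJ; exists e.
exact: Aw.
Unshelve. all: end_near.
Qed.

End modification.

(* Composing a random potential with [phi] makes its almost sure properties hold
   everywhere, and changes it on a null event only. *)
Lemma ae_retract d (T : measurableType d) (R : realType) (P : probability T R)
    (Q : T -> Prop) : {ae P, forall w, Q w} ->
  exists (phi : T -> T) (N : set T), [/\ measurable_fun setT phi,
    forall w, Q (phi w), measurable N, P N = 0%E & forall w, ~ N w -> phi w = w].
Proof.
move=> [N [mN N0 QN]].
have QNC w : ~ N w -> Q w by move=> nNw; apply: contrapT => /QN.
have [w0 nNw0] : exists w0, ~ N w0.
  apply: contrapT => /forallNP H.
  have NT : N = setT by apply/seteqP; split => // w _; exact: (contrapT (H w)).
  have := probability_setT P; rewrite -NT N0 => /eqP.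
  by rewrite eq_sym onee_eq0.
exists (fun w => if w \in N then w0 else w), N; split=> //.
- apply: measurable_fun_ifT => //.
  apply: (measurable_fun_bool true); rewrite setTI.
  by rewrite (_ : _ @^-1` _ = N)//; apply/seteqP; split => w; [exact: set_mem|exact: mem_set].
- by move=> w; case: ifPn => [_|/negP]; [exact: QNC|rewrite inE => /QNC].
- by move=> w nNw; rewrite memNset.
Qed.

Lemma random_node_potential_comp (R : realType) d (T : measurableType d)
    (h : T -> R -> R) (phi : T -> T) : measurable_fun setT phi ->
  random_node_potential h -> random_node_potential (h \o phi).
Proof.
move=> mphi [h0 mh]; split=> [w x|]; first exact: h0.
apply: (@measurableT_comp _ _ _ _ _ _ (fun p : T * measurableTypeR R => h p.1 p.2)
  _ (fun p : T * measurableTypeR R => (phi p.1, p.2))) => //.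
apply: measurable_fun_pair; last exact: measurable_snd.
exact: measurableT_comp mphi measurable_fst.
Qed.

Lemma random_edge_potential_comp (R : realType) (K : nat) d (T : measurableType d)
    (J : T -> K.-tuple R -> R) (phi : T -> T) : measurable_fun setT phi ->
  random_edge_potential J -> random_edge_potential (J \o phi).
Proof.
move=> mphi [J0 mJ]; split=> [w x|]; first exact: J0.
apply: (@measurableT_comp _ _ _ _ _ _
  (fun p : T * K.-tuple (measurableTypeR R) => J p.1 p.2)
  _ (fun p : T * K.-tuple (measurableTypeR R) => (phi p.1, p.2))) => //.
apply: measurable_fun_pair; last exact: measurable_snd.
exact: measurableT_comp mphi measurable_fst.
Qed.

(** Carries the convexity hypothesis over to the modified edge potential, whose expected arrays are
    the same. *)
Lemma expectation_retract d (T : measurableType d) (R : realType)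
    (P : probability T R) (N : set T) (phi : T -> T) (F : T -> R) :
  measurable N -> P N = 0%E -> (forall w, ~ N w -> phi w = w) ->
  measurable_fun setT phi -> measurable_fun setT F ->
  ('E_P[F \o phi] = 'E_P[F])%E.
Proof.
move=> mN N0 phiE mphi mF; rewrite unlock; apply: ae_eq_integral => //.
- by apply/measurable_EFinP; exact: measurableT_comp.
- exact/measurable_EFinP.
- exists N; split=> // w /= /not_implyP[_ ne].
  by apply: contrapT => /phiE e; apply: ne; rewrite e.
Qed.

Theorem theorem1 (R : realType) (K : nat) (K_ge1 : (1 <= K)%N)
  (dh dJ : measure_display)
  (Th : measurableType dh) (TJ : measurableType dJ)
  (Ph : probability Th R) (PJ : probability TJ R)
  (h : Th -> R -> R) (J : TJ -> K.-tuple R -> R)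
  (random_h : random_node_potential h) (random_J : random_edge_potential J)
  (kappa rho_min rho_max J_max : R) (Omega_h : set R)
  (kappa_gt0 : 0 < kappa)
  (rho_min_gt0 : 0 < rho_min) (rho_min_le : rho_min <= rho_max)
  (J_max_gt0 : 0 < J_max) (J_max_le : J_max <= rho_max)
  (Omega_h_itv : `[0, kappa] `<=` Omega_h)
  (h_support : {ae Ph, forall w, forall x, ~ Omega_h x -> h w x = 0})
  (h_mass : {ae Ph, forall w,
     [/\ (rho_min%:E <=
            \int[lebesgue_measure]_(x in `[0%R, kappa]) (h w x)%:E)%E,
         (\int[lebesgue_measure]_(x in `[0%R, kappa]) (h w x)%:E <=
            \int[lebesgue_measure]_x (h w x)%:E)%E &
         (\int[lebesgue_measure]_x (h w x)%:E <= rho_max%:E)%E]})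
  (J_sup : {ae PJ, forall w,
     (ereal_sup [set (J w x)%:E | x in [set: K.-tuple R]] <= J_max%:E)%E})
  (J_soft : forall i : 'I_K, {ae PJ, forall w,
     [set x : K.-tuple R | (tnth x i \in `[0, kappa[) /\
                           (forall k : 'I_K, Omega_h (tnth x k))]
     `<=` [set x | rho_min <= J w x]})
  (alpha : R) (alpha_ge : J_max <= alpha)
  (convexity : forall n r : nat, (1 <= n)%N -> (1 <= r)%N ->
     forall x : 'I_r -> n.-tuple R,
     (forall (l : 'I_r) (i : 'I_n), Omega_h (tnth (x l) i)) ->
     convex_over (nonneg_orthant R (r.-tuple 'I_n))
       (expected_array PJ (fun w => tensor_product (fun l =>
          (fun i => alpha - J w [tuple of map (tnth (x l)) i]))))) :
  forall c : R, 0 < c -> right_converging Ph PJ h J c.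
Proof.
move=> c c_gt0; pose i0 : 'I_K := Ordinal K_ge1.
have h_good : {ae Ph, forall w, (forall x, ~ Omega_h x -> h w x = 0) /\
    [/\ (rho_min%:E <=
            \int[lebesgue_measure]_(x in `[0%R, kappa]) (h w x)%:E)%E,
         (\int[lebesgue_measure]_(x in `[0%R, kappa]) (h w x)%:E <=
            \int[lebesgue_measure]_x (h w x)%:E)%E &
         (\int[lebesgue_measure]_x (h w x)%:E <= rho_max%:E)%E]}.
  exact: filterI h_support h_mass.
have J_good : {ae PJ, forall w,
    (ereal_sup [set (J w x)%:E | x in [set: K.-tuple R]] <= J_max%:E)%E /\
    forall i : 'I_K, [set x : K.-tuple R | (tnth x i \in `[0, kappa[) /\
                           (forall k : 'I_K, Omega_h (tnth x k))]
     `<=` [set x | rho_min <= J w x]}.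
  (* The null event of condition 3 depends on [i]; there are finitely many positions. *)
  by apply: filterI J_sup _; exact: filter_forall J_soft.
have [phi [Nh [mphi phiQ mNh Nh0 phiE]]] := ae_retract h_good.
have [psi [NJ [mpsi psiQ mNJ NJ0 psiE]]] := ae_retract J_good.
have random_h' := random_node_potential_comp mphi random_h.
have random_J' := random_edge_potential_comp mpsi random_J.
apply: (right_converging_modification random_h random_h' random_J random_J'
  mNh Nh0 mNJ NJ0) => [w /phiE /= ->//|w /psiE /= ->//|].
have J_le w x : J (psi w) x <= J_max.
  rewrite -lee_fin; have [+ _] := psiQ w; apply: le_trans.
  by apply: ereal_sup_ubound; exists x.
apply: (@right_converging_everywhere R K _ _ Th TJ _ _ random_h' random_J'
  kappa rho_min rho_max Omega_h rho_min_gt0 rho_min_le _ _ _ _ _ _ i0 Ph PJ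
  alpha _ _ c c_gt0).
- move=> x; rewrite in_itv/= => /andP[x0 /ltW xk].
  by apply: Omega_h_itv; rewrite /= in_itv/= x0.
- by move=> w x; have [+ _] := phiQ w; exact.
- move=> w; have [_ [+ _ _]] := phiQ w => /le_trans; apply.
  have mhw : measurable_fun [set: measurableTypeR R] (h (phi w)).
    exact: measurable_h random_h (phi w).
  (* The mass is assumed on the closed interval but the lower bound on [J] holds on the half-open
     one; the endpoint [kappa] is Lebesgue-null. *)
  rewrite -integral_itv_bndo_bndc; last first.
    by apply/measurable_EFinP; exact: measurable_funTS.
  rewrite integral_mkcond; rewrite le_eqVlt; apply/orP; left.
  apply/eqP/eq_integral => x _; rewrite patchE mem_setE.
  by case: ifP; rewrite ?mulr1 ?mulr0.
- by move=> w; have [_ [_ _]] := phiQ w.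
- by move=> w x; exact: le_trans (J_le w x) J_max_le.
- by move=> i w x xi Ox; have [_ /(_ i x)] := psiQ w; apply.
- by move=> w x; exact: le_trans (J_le w x) alpha_ge.
- move=> n r n1 r1 x Ox.
  have mJ y : measurable_fun [set: TJ] (J^~ y).
    have [_ mJ2] := random_J.
    apply: (@measurableT_comp _ _ _ _ _ _
      (fun p : TJ * K.-tuple (measurableTypeR R) => J p.1 p.2)
      _ (fun w : TJ => (w, y : K.-tuple (measurableTypeR R)))); first exact: mJ2.
    by apply: measurable_fun_pair => //; exact: measurable_cst.
  have := convexity n r n1 r1 x Ox.
  congr convex_over; apply/funext => i; rewrite /expected_array; congr fine.
  apply/esym; pose F w := \prod_(l < r) (alpha -
    J w [tuple of map (tnth (x l)) [tuple of map (fun j => tnth j l) i]]).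
  apply: (expectation_retract (F := F) mNJ NJ0 psiE mpsi).
  apply: measurable_prod => l _.
  exact: measurable_funB.
Qed.
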